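(* Let $\mathbf{x}$ be an arbitrary vector in $\mathbb{C}^n$ and $\mathbf{y} = |\mathbf{A} \mathbf{x}|^2 \in \mathbb{R}^m$ be $m$ quadratic samples with $m\ge c_0 \cdot n\log n$, where $c_0$ is a sufficiently large numerical constant. Then the Wirtinger flow initial estimate $\mathbf{z}_0$ normalized to have squared Euclidean norm equal to $m^{-1} \sum_r y_r$, obeys \begin{align*} \text{dist}(\mathbf{z}_0,\mathbf{x}) \le \frac{1}{8}\|\mathbf{x}\|_2 \end{align*} with probability at least $1-10e^{-\gamma n}-{8}/{n^2}$ ($\gamma$ is a fixed positive numerical constant). Further, take a constant learning parameter sequence, $\mu_\tau= \mu$ for all $\tau = 1, 2, \ldots$ and assume $\mu \le c_1/n$ for some fixed numerical constant $c_1$. Then there is an event of probability at least $1-13e^{-\gamma n}-me^{-1.5m}-{8}/{n^2}$, such that on this event, starting from any initial solution $\mathbf{z}_0$ obeying $\text{dist}(\mathbf{z}_0,\mathbf{x}) \le \frac{1}{8}\|\mathbf{x}\|_2$, we have \begin{equation*} \text{dist}(\mathbf{z}_\tau,\mathbf{x})\le \frac{1}{8}\left(1-\frac{\mu}{4}\right)^{\tau/2} \cdot \|\mathbf{x}\|_2. \end{equation*}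
   Context: Gaussian model: the sampling vectors $\mathbf{a}_r\in\mathbb{C}^n$, $r=1,\dots,m$, are i.i.d. $\mathcal{N}(\mathbf{0},\mathbf{I}/2)+i\mathcal{N}(\mathbf{0},\mathbf{I}/2)$, independent of $\mathbf{x}$. $\mathbf{A}$ is the $m\times n$ matrix whose $r$th row is $\mathbf{a}_r^*$, so $y_r=|\mathbf{a}_r^*\mathbf{x}|^2$. The loss is $f(\mathbf{z})=\frac{1}{2m}\sum_{r=1}^m(y_r-|\mathbf{a}_r^*\mathbf{z}|^2)^2$ with (Wirtinger) gradient $\nabla f(\mathbf{z})=\frac1m\sum_{r=1}^m(|\mathbf{a}_r^*\mathbf{z}|^2-y_r)\mathbf{a}_r\mathbf{a}_r^*\mathbf{z}$. The Wirtinger flow initial estimate $\mathbf{z}_0$ is the leading eigenvector of $\mathbf{Y}=\frac1m\sum_{r=1}^m y_r\mathbf{a}_r\mathbf{a}_r^*$ (suitably normalized), and the Wirtinger flow iterates are $\mathbf{z}_{\tau+1}=\mathbf{z}_\tau-\frac{\mu_{\tau+1}}{\|\mathbf{z}_0\|_2^2}\nabla f(\mathbf{z}_\tau)$. The distance is $\text{dist}(\mathbf{z},\mathbf{x})=\min_{\phi\in[0,2\pi]}\|\mathbf{z}-e^{i\phi}\mathbf{x}\|_2$. *)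

(* Defs.v *)
(* MathComp + MathComp-Analysis (probability), complex numbers from
   mathcomp-real-closed (R[i]), reals: an arbitrary realType. *)
From HB Require Import structures.
From mathcomp Require Import all_boot all_order all_algebra.
From mathcomp Require Import all_classical all_reals all_analysis.
From mathcomp Require Import complex.

Set Implicit Arguments.
Unset Strict Implicit.
Unset Printing Implicit Defensive.
Import Order.TTheory GRing.Theory Num.Theory.
Import numFieldNormedType.Exports.
Local Open Scope classical_set_scope.
Local Open Scope ring_scope.

Section WF.
Variable R : realType.

(** |z|^2 for z = a + i b, as a real number *)
Definition cabs2 (z : R[i]) : R := complex.Re z ^+ 2 + complex.Im z ^+ 2.

(** Euclidean norm ||v||_2 on C^n (column vectors) *)
Definition vnorm n (v : 'cV[R[i]]_n) : R := Num.sqrt (\sum_i cabs2 (v i 0)).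

(** e^{i phi} *)
Definition expi (phi : R) : R[i] := (cos phi +i* sin phi)%C.

(** dist(z,x) = min_{phi in [0,2pi]} ||z - e^{i phi} x||_2 *)
Definition dist n (z x : 'cV[R[i]]_n) : R :=
  inf [set vnorm (z - expi phi *: x) | phi in [set phi : R | 0 <= phi <= pi *+ 2]].

Variables (n m : nat).

(** the sampling vectors a_1..a_m in C^n *)
Variable a : 'I_m -> 'cV[R[i]]_n.

(** A: m x n matrix whose r-th row is a_r^* *)
Definition Amat : 'M[R[i]]_(m, n) := \matrix_(r, j) (a r j 0)^*.

(** y_r = |a_r^* x|^2 *)
Definition ymeas (x : 'cV[R[i]]_n) (r : 'I_m) : R := cabs2 ((Amat *m x) r 0).

(** Y = 1/m sum_r y_r a_r a_r^* *)
Definition Ymat (x : 'cV[R[i]]_n) : 'M[R[i]]_n :=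
  (m%:R)^-1 *: \sum_r (((ymeas x r)%:C)%C *: \matrix_(i, j) (a r i 0 * (a r j 0)^*)).

(** z0 is a Wirtinger flow initial estimate: a unit-norm eigenvector of Y for its
    largest eigenvalue, rescaled to have squared norm m^-1 sum_r y_r *)
Definition is_WF_init (x z0 : 'cV[R[i]]_n) : Prop :=
  exists (v : 'cV[R[i]]_n) (lam : R[i]),
    [/\ vnorm v = 1, Ymat x *m v = lam *: v,
        (forall (mu : R[i]) (w : 'cV[R[i]]_n), w != 0 -> Ymat x *m w = mu *: w -> mu <= lam)
      & z0 = ((Num.sqrt ((m%:R)^-1 * \sum_r ymeas x r))%:C)%C *: v].

(** Wirtinger gradient of f(z) = 1/(2m) sum_r (y_r - |a_r^* z|^2)^2 :
    1/m sum_r (|a_r^* z|^2 - y_r) a_r a_r^* z *)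
Definition wgrad (x z : 'cV[R[i]]_n) : 'cV[R[i]]_n :=
  (m%:R)^-1 *: \sum_r ((((cabs2 ((Amat *m z) r 0) - ymeas x r)%:C)%C
                         * (Amat *m z) r 0) *: a r).

(** Wirtinger flow iterates with constant step mu_tau = mu:
    z_{tau+1} = z_tau - mu/||z_0||^2 grad f(z_tau) *)
Definition wf_iter (x z0 : 'cV[R[i]]_n) (mu : R) (tau : nat) : 'cV[R[i]]_n :=
  iter tau (fun z => z - (((mu / vnorm z0 ^+ 2)%:C)%C *: wgrad x z)) z0.

End WF.

(** Mutual independence of a finite family of real random variables *)
Definition mutually_independent d (T : measurableType d) (R : realType)
    (P : probability T R) (I : finType) (X : I -> T -> R) : Prop :=
  forall B : I -> set R, (forall i, measurable (B i)) ->
    P (\bigcap_i (X i @^-1` B i)) = (\prod_i P (X i @^-1` B i))%E.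

(** Gaussian model: X r j true / X r j false are the real / imaginary parts of
    the j-th entry of a_r; all 2mn of them are independent N(0, 1/2). *)
Definition gaussian_model d (T : measurableType d) (R : realType)
    (P : probability T R) (m n : nat) (X : 'I_m -> 'I_n -> bool -> {RV P >-> R}) : Prop :=
  mutually_independent P (fun k : 'I_m * 'I_n * bool => (X k.1.1 k.1.2 k.2 : T -> R)) /\
  forall r j b (B : set R), measurable B ->
    distribution P (X r j b) B = normal_prob 0 (Num.sqrt (2^-1)) B.

(** the sampling vectors at outcome omega *)
Definition avec d (T : measurableType d) (R : realType) (P : probability T R)
    (m n : nat) (X : 'I_m -> 'I_n -> bool -> {RV P >-> R}) (omega : T) :
    'I_m -> 'cV[R[i]]_n :=
  fun r => \col_j ((X r j true omega +i* X r j false omega)%C).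

(* Main.v *)
Require Import Defs.
From HB Require Import structures.
From mathcomp Require Import all_boot all_order all_algebra.
From mathcomp Require Import all_classical all_reals all_analysis.
From mathcomp Require Import measurable_realfun complex.
From mathcomp Require Import ring lra.

(** Normalize [|x| = 1] and encode C^n as R^(2n), so that every [|a_r^* u|^2] is
    a quadratic form in independent real Gaussians. If [n] is bounded,
    [10 exp (- gamma n) >= 1] for a small [gamma] and nothing is to be proved.
    Otherwise all the randomness is in a few empirical means over [r], each of
    which is controlled for one vector by Chernoff and for all vectors by a
    union bound over a fine lattice in the ball: the quadratic forms [h |-> mean
    Re((a_r^* x)^bar (a_r^* h))^2], with or without truncation at large [|a_r^*
    x|], and the convex functions [h |-> mean huber(|a_r^* h|^2)], whose growth
    is slow enough for exponential moments.

    For the initial estimate, comparing the largest eigenvalue of [Y] with the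
    Rayleigh quotient at [x] forces the leading eigenvector to be nearly
    parallel to [x]. For the iteration, write [z = e^(i phi) (x + h)] with the
    optimal phase; the gradient at [z] then satisfies
    [Re <h, grad> >= (27/100) |h|^2 + (1/10) mean |a_r^* h|^4] and
    [|grad|^2 <= C n (|h|^2 + mean |a_r^* h|^4)], so that a step of size at most
    [c_1 / n] contracts the distance. *)

Set Implicit Arguments.
Unset Strict Implicit.
Unset Printing Implicit Defensive.
Import Order.TTheory GRing.Theory Num.Theory.
Import numFieldNormedType.Exports.
Local Open Scope classical_set_scope.
Local Open Scope ring_scope.

(** The product [|a^* x|^2 |a^* h|^2] is quartic in Gaussians and has no exponential moments.
    Truncated at [|a^* x|^2 <= B] it has them at a rate of order [1/B], so a union bound over
    [e^(O(n))] lattice points costs [m] of order [n B]. With [B] of order [log m] the truncation is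
    invisible, because with high probability no [|a_r^* x|^2] exceeds it; this is where
    [m >= c_0 n log n] enters. The term [mean |a_r^* h|^4] is bounded here only by a multiple of
    [n]. It is therefore kept in the lower bound for [Re <h, grad>], where it absorbs the same term
    in the bound for [|grad|^2]; only its Huber version is bounded by a constant. The factor [n] in
    the bound for [|grad|^2] is what forces steps of order [1/n]. In large dimension all failures
    are charged to [8 / n^2]. The numerical constants are rationals chosen before the real field, so
    they are defined over any field and transported by [ratr]. *)

(** * Independence of disjoint groups of coordinates *)

Section independence.
Context d (T : measurableType d) (R : realType) (P : probability T R).
Context (I : finType) (X : I -> T -> R).
Hypothesis mX : forall i, measurable_fun setT (X i).

(** A pi-system generating the sigma-algebra of the variables indexed by [S]. The sets [B i] are
    given for all [i], with [setT] off [S], because [mutually_independent] speaks of full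
    families. *)
Definition cylinders (S : {pred I}) : set (set T) :=
  [set A | exists B : I -> set R, [/\ forall i, measurable (B i),
    forall i, i \notin S -> B i = setT & A = \bigcap_i (X i @^-1` B i)]].

Definition sub_measurable (S : {pred I}) (f : T -> R) : Prop :=
  @measurable_fun _ _ (g_sigma_algebraType (cylinders S)) R setT f.

Lemma cylinders_measurable S A : cylinders S A -> measurable A.
Proof.
move=> [B [mB _ ->]]; apply: fin_bigcap_measurable => // i _.
by rewrite -[X in measurable X]setTI; exact: mX.
Qed.

Lemma s_cylinders_measurable S A : <<s cylinders S >> A -> measurable A.
Proof.
apply: smallest_sub; first exact: sigma_algebra_measurable.
by move=> ? /cylinders_measurable.
Qed.

Lemma sub_measurableW S f : sub_measurable S f -> measurable_fun setT f.
Proof.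
move=> mf _ B mB; rewrite setTI; apply: (@s_cylinders_measurable S).
by have := mf measurableT B mB; rewrite setTI.
Qed.

Lemma cylindersI S : setI_closed (cylinders S).
Proof.
move=> _ _ [B [mB BT ->]] [C [mC CT ->]].
exists (fun i => B i `&` C i); split.
- by move=> i; exact: measurableI.
- by move=> i iS; rewrite BT// CT// setTI.
- rewrite predeqE => w; split => [[h1 h2] i _|h]; first by split; [exact: h1|exact: h2].
  by split => i _; have [] := h i Logic.I.
Qed.

Lemma cylinders_subset S S' : {subset S <= S'} -> cylinders S `<=` cylinders S'.
Proof.
move=> SS' _ [B [mB BT ->]]; exists B; split => // i iS'.
by apply: BT; apply: contra iS'; exact: SS'.
Qed.

Lemma sub_measurable_subset S S' f : {subset S <= S'} ->
  sub_measurable S f -> sub_measurable S' f.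
Proof.
move=> SS' mf _ B mB; have := mf measurableT B mB.
apply: sub_smallest2r; last exact: cylinders_subset.
exact: smallest_sigma_algebra.
Qed.

Lemma sub_measurable_var S i : i \in S -> sub_measurable S (X i).
Proof.
move=> iS _ B mB; rewrite setTI; apply: sub_gen_smallest.
exists (fun j => if j == i then B else setT); split.
- by move=> j; case: ifP.
- by move=> j jS; case: ifP => // /eqP ji; rewrite ji iS in jS.
- rewrite predeqE => w; split => /=; last by move=> /(_ i Logic.I)/=; rewrite eqxx.
  by move=> BX j _; case: ifP => // /eqP ->.
Qed.

Let indep_extend S (A' : set T) : measurable A' ->
  (forall A, cylinders S A -> P (A `&` A') = (P A * P A')%E) ->
  forall A, <<s cylinders S >> A -> P (A `&` A') = (P A * P A')%E.
Proof.
move=> mA' H; pose Q : set_system (g_sigma_algebraType (cylinders S)) :=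
  fun A : set T => P (A `&` A') = (P A * P A')%E.
apply: (@dynkin_induction _ (g_sigma_algebraType (cylinders S)) (cylinders S) Q) => //.
- exact: cylindersI.
- by rewrite /Q setTI probability_setT mul1e.
- move=> A mA; rewrite /Q => QA.
  have {}mA : measurable (A : set T) by exact: s_cylinders_measurable mA.
  rewrite probability_setC// setIC -setDE measureD//; last first.
    by rewrite ltey_eq fin_num_measure.
  rewrite [X in (_ - X)%E](_ : _ = (P A * P A')%E); last by rewrite setIC; exact: QA.
  rewrite muleBl//.
  + by rewrite mul1e.
  + exact: fin_num_measure.
- move=> F mF tF QF.
  have {}mF n : measurable (F n : set T) by exact: s_cylinders_measurable (mF n).
  rewrite /Q setI_bigcupl measure_bigcup//; last 2 first.
    by move=> n _; apply: measurableI; [exact: mF|].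
    exact: trivIset_setIr.
  rewrite measure_bigcup//.
  rewrite -(fineK (fin_num_measure P _ mA')) muleC -nneseriesZl//.
  by apply: eq_eseriesr => n _; rewrite muleC fineK ?fin_num_measure//; exact: QF.
Qed.

Hypothesis iX : mutually_independent P X.

Lemma indep_sets S S' A A' : (forall i, i \in S -> i \notin S') ->
  <<s cylinders S >> A -> <<s cylinders S' >> A' -> P (A `&` A') = (P A * P A')%E.
Proof.
move=> SS' sA sA'; have mA' := s_cylinders_measurable sA'.
move: A sA; apply: indep_extend => // A cA.
have mA := cylinders_measurable cA.
rewrite setIC muleC; move: A' sA' {mA'}; apply: indep_extend => // A' cA'.
move: cA cA' => [B [mB BT ->]] [C [mC CT ->]].
rewrite (_ : _ `&` _ = \bigcap_i (X i @^-1` (B i `&` C i))); last first.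
  rewrite predeqE => w; split => [[h1 h2] i _|h].
    by split; [exact: h2|exact: h1].
  by split => i _; have [] := h i Logic.I.
rewrite !iX//; last by move=> i; exact: measurableI.
rewrite muleC -big_split/=; apply: eq_bigr => i _.
have [iS|iS] := boolP (i \in S).
  by rewrite (CT i (SS' _ iS)) setIT preimage_setT probability_setT mule1.
by rewrite BT// setTI preimage_setT probability_setT mul1e.
Qed.

End independence.

(** * Expectations of nonnegative functions *)

Section expectation.
Context d (T : measurableType d) (R : realType) (P : probability T R).
Implicit Types f g : T -> R.

(* For nonnegative [f], so that no integrability assumption is needed. *)
Definition Ex f : \bar R := (\int[P]_w (f w)%:E)%E.

Lemma Ex_ge0 f : (forall w, 0 <= f w) -> (0 <= Ex f)%E.
Proof. by move=> f0; apply: integral_ge0 => w _; rewrite lee_fin. Qed.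

Lemma Ex_cst (c : R) : Ex (fun=> c) = c%:E.
Proof. by rewrite /Ex integral_cst//= probability_setT mule1. Qed.

Lemma ExD f g : measurable_fun setT f -> measurable_fun setT g ->
  (forall w, 0 <= f w) -> (forall w, 0 <= g w) ->
  Ex (fun w => f w + g w) = (Ex f + Ex g)%E.
Proof.
move=> mf mg f0 g0; rewrite /Ex -ge0_integralD//.
- by move=> w _; rewrite lee_fin.
- exact/measurable_EFinP.
- by move=> w _; rewrite lee_fin.
- exact/measurable_EFinP.
Qed.

Lemma ExZ (c : R) f : measurable_fun setT f -> 0 <= c ->
  (forall w, 0 <= f w) -> Ex (fun w => c * f w) = (c%:E * Ex f)%E.
Proof.
move=> mf c0 f0; rewrite /Ex -ge0_integralZl//.
- exact/measurable_EFinP.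
- by move=> w _; rewrite lee_fin.
Qed.

Lemma Ex_le f g : measurable_fun setT f -> measurable_fun setT g ->
  (forall w, 0 <= f w) -> (forall w, f w <= g w) -> (Ex f <= Ex g)%E.
Proof.
move=> mf mg f0 fg; apply: ge0_le_integral => //.
- by move=> w _; rewrite lee_fin.
- exact/measurable_EFinP.
- exact/measurable_EFinP.
- by move=> w _; rewrite lee_fin.
Qed.

Lemma eq_Ex f g : f =1 g -> Ex f = Ex g.
Proof. by move=> fg; apply: eq_integral => w _; rewrite fg. Qed.

Lemma Ex_sum (J : finType) (F : J -> T -> R) :
  (forall j, measurable_fun setT (F j)) -> (forall j w, 0 <= F j w) ->
  Ex (fun w => \sum_j F j w) = (\sum_j Ex (F j))%E.
Proof.
move=> mF F0; rewrite /Ex.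
under eq_integral do rewrite -sumEFin.
rewrite ge0_integral_sum//.
- by move=> j; exact/measurable_EFinP.
- by move=> j w _; rewrite lee_fin.
Qed.

Lemma Ex_markov f (c : R) : measurable_fun setT f -> (forall w, 0 <= f w) ->
  0 < c -> (P [set w | (c <= f w)%R] <= (c^-1)%R%:E * Ex f)%E.
Proof.
move=> mf f0 c0.
have mS : measurable [set w | c <= f w].
  rewrite (_ : [set _ | _] = f @^-1` `[c, +oo[%classic).
    by rewrite -[X in measurable X]setTI; exact: mf.
  by apply/seteqP; split => w /=; rewrite in_itv/= andbT.
rewrite -(@ExZ _ f)//; last by rewrite invr_ge0 ltW.
have <- : Ex (\1_[set w | c <= f w] : T -> R) = P [set w | c <= f w].
  by rewrite /Ex integral_indic// setIT.
apply: Ex_le => //.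
- by apply: measurable_funM.
- move=> w; rewrite indicE; case: (boolP (_ \in _)) => /= [|_]; last by rewrite mulr_ge0// invr_ge0 ltW.
by rewrite inE/= => h; rewrite mulrC ler_pdivlMr// mul1r.
Qed.

(** The joint law of [(f, g)] agrees with the product of the laws on rectangles, hence everywhere;
    Tonelli's theorem then splits the integral. *)
Lemma Ex_mul f g : measurable_fun setT f -> measurable_fun setT g ->
  (forall w, 0 <= f w) -> (forall w, 0 <= g w) ->
  (forall A B, measurable A -> measurable B ->
     P (f @^-1` A `&` g @^-1` B) = (P (f @^-1` A) * P (g @^-1` B))%E) ->
  Ex (fun w => f w * g w) = (Ex f * Ex g)%E.
Proof.
move=> mf mg f0 g0 fg.
have mfg : measurable_fun setT (fun w => (f w, g w)) by exact: measurable_fun_pair.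
pose F : {RV P >-> R} := HB.pack f (isMeasurableFun.Build _ _ _ _ f mf).
pose G : {RV P >-> R} := HB.pack g (isMeasurableFun.Build _ _ _ _ g mg).
pose FG : {RV P >-> (R * R)%type} :=
  HB.pack (fun w => (f w, g w)) (isMeasurableFun.Build _ _ _ _ _ mfg).
(* Integrands must be nonnegative on all of [R]; the absolute value leaves [f] and [g] unchanged. *)
pose nn (x : R) := `|x|%:E : \bar R.
have mnn : measurable_fun setT nn.
  by apply/measurable_EFinP; exact: normr_measurable.
pose h (z : R * R) := (nn z.1 * nn z.2)%E.
have mh : measurable_fun setT h.
  by apply: emeasurable_funM; apply: (measurableT_comp mnn);
    [exact: measurable_fst|exact: measurable_snd].
have nn0 x : (0 <= nn x)%E by rewrite lee_fin.
transitivity (\int[distribution P FG]_z h z)%E.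
  rewrite ge0_integral_distribution//; last by move=> z; rewrite mule_ge0.
  by apply: eq_integral => w _; rewrite /h /nn/= EFinM !ger0_norm.
have -> : (Ex f = \int[distribution P F]_x nn x)%E.
  rewrite ge0_integral_distribution//.
  by apply: eq_integral => w _; rewrite /nn/= ger0_norm.
have -> : (Ex g = \int[distribution P G]_x nn x)%E.
  rewrite ge0_integral_distribution//.
  by apply: eq_integral => w _; rewrite /nn/= ger0_norm.
transitivity (\int[distribution P F \x distribution P G]_z h z)%E.
  apply: eq_measure_integral => A mA _; symmetry.
  apply: product_measure_unique => // B C mB mC.
rewrite fubini_tonelli1//; last by move=> z; rewrite mule_ge0.
rewrite /fubini_F/= /h/=.
under eq_integral do rewrite ge0_integralZl//.
by rewrite ge0_integralZr// integral_ge0.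
Qed.

End expectation.

(** * Expectations of products of independent functions *)

Section independent_expectation.
Context d (T : measurableType d) (R : realType) (P : probability T R).
Context (I : finType) (X : I -> T -> R).
Hypothesis mX : forall i, measurable_fun setT (X i).
Hypothesis iX : mutually_independent P X.

Lemma indep_Ex S S' f g : (forall i, i \in S -> i \notin S') ->
  sub_measurable X S f -> sub_measurable X S' g ->
  (forall w, 0 <= f w) -> (forall w, 0 <= g w) ->
  Ex P (fun w => f w * g w) = (Ex P f * Ex P g)%E.
Proof.
move=> SS' mf mg f0 g0; apply: Ex_mul => //.
- exact: (sub_measurableW mX mf).
- exact: (sub_measurableW mX mg).
- move=> A B mA mB; apply: (indep_sets mX iX SS').
  + by have := mf measurableT A mA; rewrite setTI.
  + by have := mg measurableT B mB; rewrite setTI.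
Qed.

Lemma indep_Ex_prod (J : finType) (S : J -> {pred I}) (f : J -> T -> R) :
  (forall j k i, i \in S j -> i \in S k -> j = k) ->
  (forall j, sub_measurable X (S j) (f j)) -> (forall j w, 0 <= f j w) ->
  Ex P (fun w => \prod_j f j w) = (\prod_j Ex P (f j))%E.
Proof.
move=> dS mf f0.
(* The induction also carries measurability of the partial product with respect to the union of its
   blocks, which makes it independent of the next factor. *)
suff [] : Ex P (fun w => \prod_(j <- index_enum J) f j w) =
    (\prod_(j <- index_enum J) Ex P (f j))%E /\
    sub_measurable X [pred i | has (fun j => i \in S j) (index_enum J)]
      (fun w => \prod_(j <- index_enum J) f j w) by [].
elim: (index_enum J) (index_enum_uniq J) => [_|j s ih /= /andP[js us]].
  split; last first.
    have -> : (fun w => \prod_(j <- [::]) f j w) = cst 1.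
      by apply/funext => w; rewrite big_nil.
    exact: measurable_cst.
  by rewrite big_nil -(Ex_cst P); apply: eq_Ex => w; rewrite big_nil.
have [ih1 ih2] := ih us.
have -> : (fun w => \prod_(k <- j :: s) f k w) =
   (fun w => f j w * \prod_(k <- s) f k w) by apply/funext => w; rewrite big_cons.
have pr0 w : 0 <= \prod_(k <- s) f k w by apply: prodr_ge0.
split.
  rewrite big_cons -ih1; apply: (@indep_Ex (S j) _ _ _ _ _ ih2) => //.
  move=> i ij; apply/negP => /hasP[k ks ik].
  by move: js; rewrite (dS _ _ _ ij ik) ks.
apply: measurable_funM.
- apply: sub_measurable_subset (mf j) => i /= ij; by rewrite inE/= ij.
- apply: sub_measurable_subset ih2 => i; rewrite !inE/= => ->; exact: orbT.
Qed.

End independent_expectation.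

(** * Exponential integrals of the normal law of variance 1/2 *)

Section normal_integrals.
Context (R : realType).
Local Notation mu := (@lebesgue_measure R).

Lemma ge0_integral_normal_prob (s : R) (f : R -> R) : s != 0 ->
  measurable_fun setT f -> (forall x, 0 <= f x) ->
  (\int[normal_prob 0 s]_x (f x)%:E =
   \int[mu]_x (f x * normal_pdf 0 s x)%:E)%E.
Proof.
move=> s0 mf f0.
have mfE : measurable_fun setT (EFin \o f) by exact/measurable_EFinP.
have dom := normal_prob_dominates (0 : R) s.
have mpdf : measurable_fun setT (EFin \o normal_pdf 0 s).
  by apply/measurable_EFinP; exact: measurable_normal_pdf.
transitivity (\int[mu]_x ((EFin \o f) x *
    Radon_Nikodym_SigmaFinite.f (normal_prob 0 s) mu x))%E.
  by rewrite Radon_Nikodym_SigmaFinite.change_of_variables//.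
have int_RN := Radon_Nikodym_SigmaFinite.f_integrable dom.
apply: ae_eq_integral => //.
- by apply: emeasurable_funM => //; exact: measurable_int int_RN.
- under eq_fun do rewrite EFinM.
  exact: emeasurable_funM.
- under [X in ae_eq _ _ _ X]eq_fun do rewrite EFinM.
  apply: ae_eqe_mul2l; apply: integral_ae_eq => //.
  by move=> E _ mE; rewrite -Radon_Nikodym_SigmaFinite.f_integral.
Qed.

(* The standard deviation of the real and imaginary parts in the model. *)
Local Notation sg := (Num.sqrt (2^-1) : R).

Lemma sg_neq0 : sg != 0.
Proof. by rewrite gt_eqF// sqrtr_gt0 invr_gt0. Qed.

Lemma sg2 : sg ^+ 2 = 2^-1.
Proof. by rewrite sqr_sqrtr. Qed.

(** Completing the square: [e^(s x)] times the density centred at 0 is [e^(s^2/4)] times the density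
    centred at [s/2]. *)
Lemma normal_mgf (s : R) :
  (\int[normal_prob 0 sg]_x (expR (s * x))%:E = (expR (s ^+ 2 / 4))%:E)%E.
Proof.
rewrite ge0_integral_normal_prob ?sg_neq0//; last first.
  by apply: measurableT_comp => //; exact: measurable_funM.
transitivity (\int[mu]_x ((expR (s ^+ 2 / 4))%:E * (normal_pdf (s / 2) sg x)%:E))%E.
  apply: eq_integral => x _; rewrite -EFinM; congr EFin.
  rewrite !normal_pdfE ?sg_neq0// mulrCA [RHS]mulrCA; congr (_ * _).
  rewrite /normal_fun sg2 -!expRD; congr expR; by field.
rewrite ge0_integralZl//; last first.
- by move=> x _; rewrite lee_fin normal_pdf_ge0.
- by apply/measurable_EFinP; exact: measurable_normal_pdf.
by rewrite integral_normal_pdf mule1.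
Qed.

(** The density is proportional to [e^(- x^2)], so the integrand becomes a multiple of the standard
    normal density; the ratio of the normalizing constants is [sqrt 2]. *)
Lemma normal_exp_sq :
  (\int[normal_prob 0 sg]_x (expR (x ^+ 2 / 2))%:E <= 2%:E)%E.
Proof.
rewrite ge0_integral_normal_prob ?sg_neq0//; last first.
  by apply: measurableT_comp => //; apply: measurable_funM.
rewrite [leLHS](_ : _ = \int[mu]_x
    ((normal_peak sg / normal_peak 1)%:E * (normal_pdf 0 1 x)%:E))%E; last first.
  apply: eq_integral => x _; rewrite -EFinM; congr EFin.
  rewrite !normal_pdfE ?sg_neq0 ?oner_neq0// [RHS]mulrA divfK ?gt_eqF ?normal_peak_gt0 ?oner_neq0//.
  rewrite mulrCA; congr (_ * _).
  rewrite /normal_fun sg2 -!expRD; congr expR; by field.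
rewrite ge0_integralZl//; first last.
- by rewrite lee_fin divr_ge0// normal_peak_ge0.
- by move=> x _; rewrite lee_fin normal_pdf_ge0.
- by apply/measurable_EFinP; exact: measurable_normal_pdf.
rewrite integral_normal_pdf mule1 lee_fin.
have pi0 := pi_gt0 R.
rewrite /normal_peak sg2 expr1n mul1r invrK mulrC.
rewrite ler_pdivrMr ?sqrtr_gt0; last by lra.
rewrite -ler_sqr ?nnegrE ?sqrtr_ge0 ?mulr_ge0 ?sqrtr_ge0//.
rewrite exprMn !sqr_sqrtr; lra.
Qed.

End normal_integrals.

(** * Linear forms in independent Gaussians *)

Section gaussian_family.
Context d (T : measurableType d) (R : realType) (P : probability T R).
Context (I : finType) (X : I -> T -> R).
Hypothesis mX : forall i, measurable_fun setT (X i).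
Hypothesis iX : mutually_independent P X.
Hypothesis gX : forall i (B : set R), measurable B ->
  P (X i @^-1` B) = normal_prob 0 (Num.sqrt (2^-1)) B.

Lemma Ex_gauss i (f : R -> R) : measurable_fun setT f -> (forall x, 0 <= f x) ->
  Ex P (fun w => f (X i w)) =
  (\int[normal_prob 0 (Num.sqrt (2^-1) : R)]_x (f x)%:E)%E.
Proof.
move=> mf f0.
pose F : {RV P >-> measurableTypeR R} := HB.pack (X i : T -> measurableTypeR R)
  (isMeasurableFun.Build _ _ _ _ (X i : T -> measurableTypeR R) (mX i)).
transitivity (\int[distribution P F]_x (f x)%:E)%E.
  by rewrite ge0_integral_distribution//; exact/measurable_EFinP.
by apply: eq_measure_integral => A mA _; exact: gX.
Qed.

Definition lin_form (c : I -> R) (w : T) : R := \sum_i c i * X i w.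
Definition sqnorm (c : I -> R) : R := \sum_i c i ^+ 2.

Lemma sqnorm_ge0 c : 0 <= sqnorm c.
Proof. by apply: sumr_ge0 => i _; exact: sqr_ge0. Qed.

Lemma measurable_lin_form c : measurable_fun setT (lin_form c).
Proof. by apply: measurable_sum => i; exact: measurable_funM. Qed.

Lemma lin_formZ (a : R) c w : lin_form (fun i => a * c i) w = a * lin_form c w.
Proof. by rewrite /lin_form mulr_sumr; apply: eq_bigr => i _; rewrite mulrA. Qed.

Lemma sqnormZ (a : R) c : sqnorm (fun i => a * c i) = a ^+ 2 * sqnorm c.
Proof. by rewrite /sqnorm mulr_sumr; apply: eq_bigr => i _; rewrite exprMn. Qed.

Lemma Ex_exp_lin_form c : Ex P (fun w => expR (lin_form c w)) = (expR (sqnorm c / 4))%:E.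
Proof.
transitivity (Ex P (fun w => \prod_i expR (c i * X i w))).
  by apply: eq_Ex => w; rewrite expR_sum.
rewrite (indep_Ex_prod mX iX (S := fun i => pred1 i)); first last.
- by move=> i w; exact: expR_ge0.
- move=> i; apply: measurableT_comp => //; apply: measurable_funM => //.
  by apply: sub_measurable_var; rewrite inE.
- by move=> i j k; rewrite !inE => /eqP -> /eqP.
rewrite /sqnorm mulr_suml expR_sum -prodEFin; apply: eq_bigr => i _.
rewrite (Ex_gauss i (f := fun x => expR (c i * x))) ?normal_mgf//.
by apply: measurableT_comp => //; exact: measurable_funM.
Qed.

(** Gaussian linearization: for an auxiliary [z] of law N(0, 1/2), [e^(L^2/2)] is the expectation
    over [z] of [e^(sqrt 2 L z)]. Once the integrals are exchanged, only the moment generating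
    function of [L] is needed, and [sqnorm c <= 1] leaves at most [e^(z^2/2)]. The law of [L] is
    never identified. *)
Lemma Ex_exp_sq_lin_form c : sqnorm c <= 1 ->
  (Ex P (fun w => expR (lin_form c w ^+ 2 / 2)) <= 2%:E)%E.
Proof.
move=> c1.
pose N := normal_prob 0 (Num.sqrt (2^-1) : R).
pose h (z : T * measurableTypeR R) : \bar R := (expR (Num.sqrt 2 * lin_form c z.1 * z.2))%:E.
have mh : measurable_fun setT h.
  apply/measurable_EFinP; apply: measurableT_comp => //.
  apply: measurable_funM; last exact: measurable_snd.
  apply: measurable_funM => //; apply: measurableT_comp; first exact: measurable_lin_form.
  exact: measurable_fst.
have h0 z : (0 <= h z)%E by rewrite lee_fin expR_ge0.
have -> : Ex P (fun w => expR (lin_form c w ^+ 2 / 2)) =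
    (\int[P]_w \int[N]_x h (w, x))%E.
  apply: eq_integral => w _.
  transitivity ((expR ((Num.sqrt 2 * lin_form c w) ^+ 2 / 4))%:E).
    by rewrite exprMn sqr_sqrtr//; congr (expR _)%:E; field.
  by rewrite -normal_mgf; apply: eq_integral => x _.
Check @fubini_tonelli. rewrite [leLHS](@fubini_tonelli _ _ _ _ _ P N h mh h0) /fubini_G.
apply: le_trans (normal_exp_sq R); apply: ge0_le_integral => //.
- by move=> x _; apply: integral_ge0.
- exact: measurable_fun_fubini_tonelli_G.
- by apply/measurable_EFinP; apply: measurableT_comp => //; exact: measurable_funM.
move=> x _; have -> : (\int[P]_w h (w, x))%E =
    Ex P (fun w => expR (lin_form (fun i => (Num.sqrt 2 * x) * c i) w)).
  by apply: eq_integral => w _; rewrite lin_formZ /h/=; congr (expR _)%:E; ring.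
rewrite Ex_exp_lin_form lee_fin ler_expR sqnormZ exprMn sqr_sqrtr//.
have := sqr_ge0 x; move: c1 (sqnorm_ge0 c) => /=; nra.
Qed.

End gaussian_family.

(** * Taylor bounds with explicit remainder *)

Section power_series_remainder.
Context (R : realType).

(** On the tail, [s <= 1] gives [s^k <= s^N], so the remainder is at most [s^N] times the full
    series at [s = 1]. *)
Lemma series_remainder (t : nat -> R) (s S S' : R) (N : nat) :
  (forall k, 0 <= t k) -> 0 <= s <= 1 ->
  series t @ \oo --> S -> series (fun k => s ^+ k * t k) @ \oo --> S' ->
  \sum_(0 <= k < N) s ^+ k * t k <= S' <=
    \sum_(0 <= k < N) s ^+ k * t k + s ^+ N * S.
Proof.
move=> t0 /andP[s0 s1] tS tS'; apply/andP; split.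
  have c1 : (fun _ : nat => \sum_(0 <= k < N) s ^+ k * t k) @ \oo -->
    \sum_(0 <= k < N) s ^+ k * t k by exact: cvg_cst.
  apply: (ler_cvg_to c1 tS').
  near=> n; have Nn : (N <= n)%N by near: n; exact: nbhs_infty_ge.
  rewrite /series/= (big_cat_nat _ Nn)//= lerDl sumr_ge0// => k _.
  by rewrite mulr_ge0// exprn_ge0.
have c2 : (fun n => \sum_(0 <= k < N) s ^+ k * t k + s ^+ N * series t n) @ \oo -->
    \sum_(0 <= k < N) s ^+ k * t k + s ^+ N * S.
  by apply: cvgD; [exact: cvg_cst|apply: cvgMr].
apply: (ler_cvg_to tS' c2).
near=> n; have Nn : (N <= n)%N by near: n; exact: nbhs_infty_ge.
rewrite /series/= (big_cat_nat _ Nn)//= lerD2l.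
apply: (@le_trans _ _ (s ^+ N * \sum_(N <= k < n) t k)).
  rewrite mulr_sumr big_nat_cond [leRHS]big_nat_cond; apply: ler_sum => k.
  rewrite andbT => /andP[Nk _]; rewrite ler_wpM2r//.
  exact: ler_wiXn2l.
rewrite ler_wpM2l ?exprn_ge0// [leRHS](big_cat_nat _ Nn)//= lerDr.
by apply: sumr_ge0.
Unshelve. all: by end_near.
Qed.

Lemma cvg_series_expR (y : R) : series (exp_coeff y) @ \oo --> expR y.
Proof. exact: is_cvg_series_exp_coeff. Qed.

Lemma expR_taylor2 (s v : R) : 0 <= s <= 1 -> 0 <= v ->
  1 + s * v + (s * v) ^+ 2 / 2 <= expR (s * v) <=
  1 + s * v + (s * v) ^+ 2 / 2 + s ^+ 3 * expR v.
Proof.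
move=> s01 v0.
have tS' : series (fun k => s ^+ k * exp_coeff v k) @ \oo --> expR (s * v).
  rewrite (_ : (fun k => _) = exp_coeff (s * v)); first exact: cvg_series_expR.
  by apply/funext => k; rewrite /exp_coeff/= exprMn mulrA.
have := series_remainder 3 (fun k => exp_coeff_ge0 k v0) s01 (@cvg_series_expR v) tS'.
rewrite !big_nat_recl// big_geq// /exp_coeff/= !factS fact0 !expr0 !expr1.
by rewrite (_ : 1 + s * v + (s * v) ^+ 2 / 2 =
  1 * (1 / (1)%:R) + (s * (v / (1 * 1)%:R) + (s ^+ 2 * (v ^+ 2 / (2 * (1 * 1))%:R) + 0))) //; field.
Qed.

Lemma cosh_taylor4 (s y : R) : 0 <= s <= 1 ->
  2 + (s * y) ^+ 2 + (s * y) ^+ 4 / 12 <= expR (s * y) + expR (- (s * y)) <=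
  2 + (s * y) ^+ 2 + (s * y) ^+ 4 / 12 + s ^+ 6 * (expR y + expR (- y)).
Proof.
move=> s01.
pose t (z : R) k := exp_coeff z k + exp_coeff (- z) k.
have tS z : series (t z) @ \oo --> expR z + expR (- z).
  rewrite (_ : series _ = series (exp_coeff z) \+ series (exp_coeff (- z))).
    by apply: cvgD; exact: cvg_series_expR.
  by apply/funext => n; rewrite /series/= -big_split.
have t0 k : 0 <= t y k.
  rewrite /t /exp_coeff/= -mulrDl divr_ge0// exprNn -signr_odd.
  have [ok|ek] := boolP (odd k); first by rewrite expr1 mulN1r subrr.
  rewrite expr0 mul1r addr_ge0// exprn_even_ge0//.
have tS' : series (fun k => s ^+ k * t y k) @ \oo --> expR (s * y) + expR (- (s * y)).
  rewrite (_ : (fun k => _) = t (s * y)); first exact: tS.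
  by apply/funext => k; rewrite /t /exp_coeff/= -mulrN !exprMn mulrDr !mulrA.
have := series_remainder 6 t0 s01 (tS y) tS'.
rewrite (_ : \sum_(0 <= k < 6) s ^+ k * t y k = 2 + (s * y) ^+ 2 + (s * y) ^+ 4 / 12)//.
rewrite !big_nat_recl// big_geq// /t /exp_coeff/= !factS fact0.
rewrite !muln1 /muln/=.
by field.
Qed.

End power_series_remainder.

(** * Second and fourth moments of linear forms *)

Section gaussian_moments.
Context (R : realType).

Lemma eq0_of_linear_bound (a K : R) :
  (forall t, 0 < t <= 1 -> `|a| <= K * t) -> a = 0.
Proof.
move=> H; apply/eqP; rewrite -normr_eq0; apply/negPn/negP => a0.
have {}a0 : 0 < `|a| by rewrite lt_neqAle eq_sym a0 normr_ge0.
have K0 : 0 < K.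
  have := H 1; rewrite ltr01 lexx => /(_ isT) h; move: a0 h; lra.
pose u := `|a| / (2 * K).
have u0 : 0 < u by rewrite divr_gt0// mulr_gt0.
have := H (Num.min 1 u); rewrite lt_min ltr01 u0 ge_min lexx/= => /(_ isT).
have : K * Num.min 1 u <= K * u by rewrite ler_pM2l// ge_min lexx orbT.
have -> : K * u = `|a| / 2 by rewrite /u; field; rewrite gt_eqF.
lra.
Qed.

Lemma eq0_of_cubic_bound (a b K : R) :
  (forall t, 0 < t <= 1 -> `|t * a + t ^+ 2 * b| <= K * t ^+ 3) ->
  a = 0 /\ b = 0.
Proof.
move=> H.
have K0 : 0 <= K.
  have := H 1; rewrite ltr01 lexx expr1n => /(_ isT) h.
  have := normr_ge0 (1 * a + 1 * b); lra.
have a0 : a = 0.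
  apply: (@eq0_of_linear_bound _ (`|b| + K)) => t /andP[t0 t1].
  have := H t; rewrite t0 t1 => /(_ isT) Ht.
  have h1 : `|t * a| <= `|t * a + t ^+ 2 * b| + `|t ^+ 2 * b|.
    by rewrite -{1}(addrK (t ^+ 2 * b) (t * a)); exact: ler_normB.
  have e1 : `|t * a| = t * `|a| by rewrite normrM (gtr0_norm t0).
  have e2 : `|t ^+ 2 * b| = t ^+ 2 * `|b| by rewrite normrM normrX (gtr0_norm t0).
  have h2 : K * t ^+ 3 <= K * t ^+ 2 by rewrite ler_wpM2l// ler_wiXn2l// ltW.
  rewrite e1 e2 in h1; rewrite -(ler_pM2l t0).
  have : t * ((`|b| + K) * t) = t ^+ 2 * `|b| + K * t ^+ 2 by ring.
  lra.
split => //; apply: (@eq0_of_linear_bound _ K) => t /andP[t0 t1].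
have := H t; rewrite t0 t1 a0 mulr0 add0r normrM normrX (gtr0_norm t0) => /(_ isT).
by rewrite (_ : K * t ^+ 3 = t ^+ 2 * (K * t)) ?ler_pM2l ?exprn_gt0//; ring.
Qed.

Context d (T : measurableType d) (P : probability T R).
Context (I : finType) (X : I -> T -> R).
Hypothesis mX : forall i, measurable_fun setT (X i).
Hypothesis iX : mutually_independent P X.
Hypothesis gX : forall i (B : set R), measurable B ->
  P (X i @^-1` B) = normal_prob 0 (Num.sqrt (2^-1)) B.

Local Notation L := (lin_form X).
Local Notation E := (Ex P).
Let mL := measurable_lin_form mX.

Lemma ExD_fin (f g : T -> R) (a b : R) : measurable_fun setT f -> measurable_fun setT g ->
  (forall w, 0 <= f w) -> (forall w, 0 <= g w) ->
  E f = a%:E -> E g = b%:E -> E (fun w => f w + g w) = (a + b)%:E.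
Proof. by move=> mf mg f0 g0 Ef Eg; rewrite ExD// Ef Eg. Qed.

Lemma ExZ_fin (f : T -> R) (a c : R) : measurable_fun setT f -> (forall w, 0 <= f w) ->
  0 <= c -> E f = a%:E -> E (fun w => c * f w) = (c * a)%:E.
Proof. by move=> mf f0 c0 Ef; rewrite ExZ// Ef. Qed.

Lemma ExB_fin (f g : T -> R) (a b : R) : measurable_fun setT f -> measurable_fun setT g ->
  (forall w, 0 <= f w) -> (forall w, 0 <= g w) ->
  E (fun w => f w + g w) = a%:E -> E g = b%:E -> E f = (a - b)%:E.
Proof.
move=> mf mg f0 g0; rewrite ExD// => + Eg; rewrite Eg.
by case: (E f) (Ex_ge0 P f0) => //= r _ [<-]; rewrite addrK.
Qed.

Lemma Ex_le_fin (f : T -> R) (a : R) : (forall w, 0 <= f w) -> (E f <= a%:E)%E ->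
  exists2 r, 0 <= r & E f = r%:E.
Proof.
move=> f0; have := Ex_ge0 P f0; case: (E f) => [r r0 _|_|].
- by exists r; rewrite // -lee_fin.
- by rewrite leye_eq.
- by rewrite leeNy_eq.
Qed.

Lemma lin_formN c w : L (fun i => - c i) w = - L c w.
Proof. by rewrite /lin_form -sumrN; apply: eq_bigr => i _; rewrite mulNr. Qed.

Lemma lin_formD c c' w : L (fun i => c i + c' i) w = L c w + L c' w.
Proof. by rewrite /lin_form -big_split; apply: eq_bigr => i _; rewrite mulrDl. Qed.

Let cosh_ge0 (y : R) : 0 <= expR y + expR (- y).
Proof. by rewrite addr_ge0// expR_ge0. Qed.

Let mcosh c (s : R) : measurable_fun setT
  (fun w => expR (s * L c w) + expR (- (s * L c w))).
Proof.
apply: measurable_funD; apply: measurableT_comp => //.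
  exact: measurable_funM.
by apply: measurableT_comp => //; exact: measurable_funM.
Qed.

Lemma Ex_cosh_lin_form c (s : R) :
  E (fun w => expR (s * L c w) + expR (- (s * L c w))) =
  (2 * expR (s ^+ 2 * (sqnorm c / 4)))%:E.
Proof.
rewrite (_ : 2 * _ = expR (sqnorm (fun i => s * c i) / 4) +
  expR (sqnorm (fun i => - s * c i) / 4)); last first.
  by rewrite !sqnormZ sqrrN mulrA; ring.
apply: ExD_fin.
- by apply: measurableT_comp => //; exact: measurable_funM.
- by apply: measurableT_comp => //; apply: measurableT_comp => //; exact: measurable_funM.
- by move=> w; exact: expR_ge0.
- by move=> w; exact: expR_ge0.
- by rewrite -(Ex_exp_lin_form mX iX gX); apply: eq_Ex => w; rewrite lin_formZ.
- by rewrite -(Ex_exp_lin_form mX iX gX); apply: eq_Ex => w; rewrite lin_formZ mulNr.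
Qed.

(** Comparison of coefficients: [e^(sL) + e^(-sL)] has expectation [2 e^(s^2 |c|^2 / 4)], and both
    sides are polynomials in [s] up to [O(s^6)]. With [t = s^2], [eq0_of_cubic_bound] equates the
    coefficients of [t] and [t^2]. Symmetrizing removes the odd powers, so every term is
    nonnegative, as [Ex] requires. *)
Lemma lin_form_moments c :
  E (fun w => L c w ^+ 2) = (sqnorm c / 2)%:E /\
  E (fun w => L c w ^+ 4) = (3 / 4 * sqnorm c ^+ 2)%:E.
Proof.
have m2 : measurable_fun setT (fun w => L c w ^+ 2) by exact: measurable_funX.
have m4 : measurable_fun setT (fun w => L c w ^+ 4) by exact: measurable_funX.
have p2 w : 0 <= L c w ^+ 2 by exact: sqr_ge0.
have p4 w : 0 <= L c w ^+ 4 by exact: exprn_even_ge0.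
have lowT (s : R) w : 0 <= s <= 1 ->
    2 + s ^+ 2 * L c w ^+ 2 + s ^+ 4 / 12 * L c w ^+ 4 <=
    expR (s * L c w) + expR (- (s * L c w)).
  move=> /(cosh_taylor4 (L c w))/andP[+ _]; rewrite !exprMn.
  by rewrite (mulrAC (s ^+ 4)).
have E1 : E (fun w => expR (1 * L c w) + expR (- (1 * L c w))) =
    (2 * expR (1 * (sqnorm c / 4)))%:E by rewrite Ex_cosh_lin_form expr1n.
have [a a0 Ea] : exists2 r, 0 <= r & E (fun w => L c w ^+ 2) = r%:E.
  apply: (@Ex_le_fin _ (2 * expR (1 * (sqnorm c / 4)))) => //.
  rewrite -E1; apply: Ex_le => // w.
  by apply: le_trans (lowT 1 w _); rewrite ?ler01 ?lexx// !expr1n; have := p4 w; lra.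
have [b b0 Eb] : exists2 r, 0 <= r & E (fun w => L c w ^+ 4) = r%:E.
  apply: (@Ex_le_fin _ (12 * (2 * expR (1 * (sqnorm c / 4))))) => //.
  rewrite EFinM -E1 -ExZ//; apply: Ex_le => // [|w]; first exact: measurable_funM.
  by have := lowT 1 w; rewrite ?ler01 ?lexx !expr1n => /(_ isT); have := p2 w; lra.
have Epoly (s : R) : 0 <= s ->
    E (fun w => 2 + s ^+ 2 * L c w ^+ 2 + s ^+ 4 / 12 * L c w ^+ 4) =
    (2 + s ^+ 2 * a + s ^+ 4 / 12 * b)%:E.
  move=> s0; have s20 : 0 <= s ^+ 2 by exact: exprn_ge0.
  have s40 : 0 <= s ^+ 4 / 12 by rewrite divr_ge0// exprn_ge0.
  apply: ExD_fin.
  - by apply: measurable_funD => //; exact: measurable_funM.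
  - exact: measurable_funM.
  - by move=> w; rewrite addr_ge0// mulr_ge0.
  - by move=> w; rewrite mulr_ge0.
  - apply: ExD_fin => //; [exact: measurable_funM| | |].
    + by move=> w; rewrite mulr_ge0.
    + exact: Ex_cst.
    + exact: ExZ_fin.
  - exact: ExZ_fin.
set K := 4 * expR (1 * (sqnorm c / 4)).
have key t : 0 < t <= 1 ->
    `|t * (a - sqnorm c / 2) + t ^+ 2 * (b / 12 - sqnorm c ^+ 2 / 16)| <= K * t ^+ 3.
  move=> /andP[t0 t1]; pose s := Num.sqrt t.
  have s2 : s ^+ 2 = t by rewrite sqr_sqrtr// ltW.
  have s0 : 0 <= s by exact: sqrtr_ge0.
  have s01 : 0 <= s <= 1 by rewrite s0 -(@sqrtr1 R) ler_sqrt.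
  have s4 : s ^+ 4 = t ^+ 2 by rewrite -s2 -exprM.
  have s6 : s ^+ 6 = t ^+ 3 by rewrite -s2 -exprM.
  have v0 : 0 <= sqnorm c / 4 by rewrite divr_ge0// sqnorm_ge0.
  have t01 : 0 <= t <= 1 by rewrite ltW.
  have /andP[T1 T2] := expR_taylor2 t01 v0.
  have lo : 2 + s ^+ 2 * a + s ^+ 4 / 12 * b <= 2 * expR (s ^+ 2 * (sqnorm c / 4)).
    rewrite -lee_fin -Ex_cosh_lin_form -Epoly//; apply: Ex_le => //.
    - apply: measurable_funD; last exact: measurable_funM.
      by apply: measurable_funD => //; exact: measurable_funM.
    - by move=> w; rewrite !addr_ge0// mulr_ge0// ?divr_ge0// exprn_ge0.
    - by move=> w; exact: lowT.
  have up : 2 * expR (s ^+ 2 * (sqnorm c / 4)) <=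
      2 + s ^+ 2 * a + s ^+ 4 / 12 * b + s ^+ 6 * (2 * expR (1 * (sqnorm c / 4))).
    have mp : measurable_fun setT
        (fun w => 2 + s ^+ 2 * L c w ^+ 2 + s ^+ 4 / 12 * L c w ^+ 4).
      apply: measurable_funD; last exact: measurable_funM.
      by apply: measurable_funD => //; exact: measurable_funM.
    have pp w : 0 <= 2 + s ^+ 2 * L c w ^+ 2 + s ^+ 4 / 12 * L c w ^+ 4.
      by rewrite !addr_ge0// mulr_ge0// ?divr_ge0// exprn_ge0.
    have p6 : 0 <= s ^+ 6 by exact: exprn_ge0.
    have ms : measurable_fun setT
        (fun w => s ^+ 6 * (expR (1 * L c w) + expR (- (1 * L c w)))).
      by apply: measurable_funM.
    rewrite -lee_fin -Ex_cosh_lin_form.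
    have EZ := ExZ_fin (mcosh c 1) (fun w => cosh_ge0 _) p6 E1.
    rewrite -(ExD_fin mp ms pp (fun w => mulr_ge0 p6 (cosh_ge0 _)) (Epoly s s0) EZ).
    apply: Ex_le => // [|w]; first exact: measurable_funD.
    have /andP[_] := cosh_taylor4 (L c w) s01; rewrite !exprMn mul1r.
    by rewrite (mulrAC (s ^+ 4)).
  rewrite s2 s4 s6 in lo up.
  rewrite /K mul1r in up *.
  rewrite ler_norml; apply/andP; split; lra.
have [/eqP + /eqP] := eq0_of_cubic_bound key.
rewrite !subr_eq0 => /eqP aE /eqP bE; rewrite Ea Eb; split; congr EFin => //.
lra.
Qed.

End gaussian_moments.

(** * Mixed fourth moments by polarization *)

Section mixed_moments.
Context (R : realType) (d : measure_display) (T : measurableType d) (P : probability T R).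
Context (I : finType) (X : I -> T -> R).
Hypothesis mX : forall i, measurable_fun setT (X i).
Hypothesis iX : mutually_independent P X.
Hypothesis gX : forall i (B : set R), measurable B ->
  P (X i @^-1` B) = normal_prob 0 (Num.sqrt (2^-1)) B.

Local Notation L := (lin_form X).
Local Notation E := (Ex P).
Let mL := measurable_lin_form mX.

Definition dot (J : finType) (c c' : J -> R) : R := \sum_i c i * c' i.

Lemma dotC (J : finType) (c c' : J -> R) : dot c c' = dot c' c.
Proof. by apply: eq_bigr => i _; rewrite mulrC. Qed.

Lemma dotDl (J : finType) (a b c : J -> R) :
  dot (fun i => a i + b i) c = dot a c + dot b c.
Proof. by rewrite /dot -big_split; apply: eq_bigr => i _; rewrite mulrDl. Qed.

Lemma dotNl (J : finType) (a c : J -> R) : dot (fun i => - a i) c = - dot a c.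
Proof. by rewrite /dot -sumrN; apply: eq_bigr => i _; rewrite mulNr. Qed.

Lemma dotZl (J : finType) (s : R) (a c : J -> R) :
  dot (fun i => s * a i) c = s * dot a c.
Proof. by rewrite /dot mulr_sumr; apply: eq_bigr => i _; rewrite mulrA. Qed.

Lemma dotDr (J : finType) (a b c : J -> R) :
  dot c (fun i => a i + b i) = dot c a + dot c b.
Proof. by rewrite dotC dotDl !(dotC c). Qed.

Lemma dotNr (J : finType) (a c : J -> R) : dot c (fun i => - a i) = - dot c a.
Proof. by rewrite dotC dotNl dotC. Qed.

Lemma dotZr (J : finType) (s : R) (a c : J -> R) :
  dot c (fun i => s * a i) = s * dot c a.
Proof. by rewrite dotC dotZl dotC. Qed.

Lemma sqnormE (J : finType) (c : J -> R) : sqnorm c = dot c c.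
Proof. by apply: eq_bigr => i _; rewrite expr2. Qed.

Lemma sqnormD (J : finType) (a b : J -> R) :
  sqnorm (fun i => a i + b i) = sqnorm a + 2 * dot a b + sqnorm b.
Proof. by rewrite !sqnormE dotDl !dotDr (dotC b a); ring. Qed.

Lemma sqnormB (J : finType) (a b : J -> R) :
  sqnorm (fun i => a i - b i) = sqnorm a - 2 * dot a b + sqnorm b.
Proof. by rewrite !sqnormE dotDl !dotDr !dotNl !dotNr (dotC b a); ring. Qed.

(** From [(F + G)^4 + (F - G)^4 = 2 F^4 + 2 G^4 + 12 F^2 G^2], all terms being nonnegative. *)
Lemma Ex_sq_sq (f g : I -> R) : E (fun w => L f w ^+ 2 * L g w ^+ 2) =
  ((sqnorm f * sqnorm g + 2 * dot f g ^+ 2) / 4)%:E.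
Proof.
have m4 c : measurable_fun setT (fun w => L c w ^+ 4) by exact: measurable_funX.
have p4 c w : 0 <= L c w ^+ 4 by exact: exprn_even_ge0.
have E4 c : E (fun w => L c w ^+ 4) = (3 / 4 * sqnorm c ^+ 2)%:E.
  by have [] := lin_form_moments mX iX gX c.
have m22 : measurable_fun setT (fun w => 12 * (L f w ^+ 2 * L g w ^+ 2)).
  by do 2 apply: measurable_funM => //; exact: measurable_funX.
have p22 w : 0 <= 12 * (L f w ^+ 2 * L g w ^+ 2) by rewrite mulr_ge0// mulr_ge0// sqr_ge0.
have mr c : measurable_fun setT (fun w => 2 * L c w ^+ 4) by exact: measurable_funM.
have pr c w : 0 <= 2 * L c w ^+ 4 by rewrite mulr_ge0.
have Er c := ExZ_fin (m4 c) (p4 c) (ler0n R 2) (E4 c).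
have Erhs := ExD_fin (mr f) (mr g) (pr f) (pr g) (Er f) (Er g).
have Elhs := ExD_fin (m4 (fun i => f i + g i)) (m4 (fun i => f i - g i))
  (p4 (fun i => f i + g i)) (p4 (fun i => f i - g i)) (E4 _) (E4 _).
have E12 := fun H => @ExB_fin _ _ _ P _ _ _ _ m22 (measurable_funD (mr f) (mr g))
  p22 (fun w => addr_ge0 (pr f w) (pr g w)) (etrans (eq_Ex P H) Elhs) Erhs.
have -> : E (fun w => L f w ^+ 2 * L g w ^+ 2) =
    E (fun w => 12^-1 * (12 * (L f w ^+ 2 * L g w ^+ 2))).
  by apply: eq_Ex => w; rewrite mulKf.
rewrite (ExZ_fin m22 p22 _ (E12 _)) ?invr_ge0//.
  by congr EFin; rewrite sqnormD sqnormB; field.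
by move=> w; rewrite /= !lin_formD lin_formN; ring.
Qed.

(** The product [F1 G1 F2 G2] has no sign and is out of reach of [Ex]. It is recovered from [16 F1
    F2 G1 G2 = ((F1 + F2)^2 - (F1 - F2)^2) ((G1 + G2)^2 - (G1 - G2)^2)], with the negative terms
    moved to the other side. *)
Lemma Ex_bilinear_sq (f1 g1 f2 g2 : I -> R) :
  E (fun w => (L f1 w * L g1 w + L f2 w * L g2 w) ^+ 2) =
  ((sqnorm f1 * sqnorm g1 + 2 * dot f1 g1 ^+ 2 + sqnorm f2 * sqnorm g2 +
    2 * dot f2 g2 ^+ 2 + 2 * (dot f1 g1 * dot f2 g2 + dot f1 f2 * dot g1 g2 +
    dot f1 g2 * dot g1 f2)) / 4)%:E.
Proof.
have mq f g : measurable_fun setT (fun w => L f w ^+ 2 * L g w ^+ 2).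
  by apply: measurable_funM; exact: measurable_funX.
have pq f g w : 0 <= L f w ^+ 2 * L g w ^+ 2 by rewrite mulr_ge0// ?sqr_ge0.
have mq8 f g : measurable_fun setT (fun w => 8 * (L f w ^+ 2 * L g w ^+ 2)).
  exact: measurable_funM.
have pq8 f g w : 0 <= 8 * (L f w ^+ 2 * L g w ^+ 2) by rewrite mulr_ge0.
have Eq8 f g := ExZ_fin (mq f g) (pq f g) (ler0n R 8) (Ex_sq_sq f g).
pose p a b : I -> R := fun i => a i + b i; pose q a b : I -> R := fun i => a i - b i.
have E1 := ExD_fin (mq8 f1 g1) (mq8 f2 g2) (pq8 f1 g1) (pq8 f2 g2) (Eq8 _ _) (Eq8 _ _).
have E2 := ExD_fin (mq (p f1 f2) (p g1 g2)) (mq (q f1 f2) (q g1 g2))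
  (pq (p f1 f2) (p g1 g2)) (pq (q f1 f2) (q g1 g2)) (Ex_sq_sq _ _) (Ex_sq_sq _ _).
have E3 := ExD_fin (mq (p f1 f2) (q g1 g2)) (mq (q f1 f2) (p g1 g2))
  (pq (p f1 f2) (q g1 g2)) (pq (q f1 f2) (p g1 g2)) (Ex_sq_sq _ _) (Ex_sq_sq _ _).
have mt : measurable_fun setT (fun w => 8 * (L f1 w * L g1 w + L f2 w * L g2 w) ^+ 2).
  by apply: measurable_funM => //; apply: measurable_funX; apply: measurable_funD;
    exact: measurable_funM.
have pt w : 0 <= 8 * (L f1 w * L g1 w + L f2 w * L g2 w) ^+ 2.
  by rewrite mulr_ge0// ?sqr_ge0.
have E12 := ExD_fin (measurable_funD (mq8 f1 g1) (mq8 f2 g2))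
  (measurable_funD (mq (p f1 f2) (p g1 g2)) (mq (q f1 f2) (q g1 g2)))
  (fun w => addr_ge0 (pq8 f1 g1 w) (pq8 f2 g2 w))
  (fun w => addr_ge0 (pq (p f1 f2) (p g1 g2) w) (pq (q f1 f2) (q g1 g2) w)) E1 E2.
have Et := fun H => @ExB_fin _ _ _ P _ _ _ _ mt
  (measurable_funD (mq (p f1 f2) (q g1 g2)) (mq (q f1 f2) (p g1 g2))) pt
  (fun w => addr_ge0 (pq (p f1 f2) (q g1 g2) w) (pq (q f1 f2) (p g1 g2) w))
  (etrans (eq_Ex P H) E12) E3.
have -> : E (fun w => (L f1 w * L g1 w + L f2 w * L g2 w) ^+ 2) =
    E (fun w => 8^-1 * (8 * (L f1 w * L g1 w + L f2 w * L g2 w) ^+ 2)).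
  by apply: eq_Ex => w; rewrite mulKf.
rewrite (ExZ_fin mt pt _ (Et _)) ?invr_ge0//.
  congr EFin; rewrite /p /q !sqnormB !sqnormD !dotDl !dotNl !dotDr !dotNr.
  by rewrite (dotC f2 g1); field.
by move=> w; rewrite /= !lin_formD !lin_formN; ring.
Qed.

End mixed_moments.

Lemma sum_pair (R : nmodType) (I J : finType) (F : I * J -> R) :
  \sum_p F p = \sum_i \sum_j F (i, j).
Proof. by rewrite pair_bigA; apply: eq_bigr => -[]. Qed.

(** * The hermitian structure in real coordinates *)

Section rotation.
Context (R : realType) (n : nat).
Local Notation K := ('I_n * bool)%type.
Implicit Types u v a : K -> R.

(* A vector [z] of C^n is encoded by [u (j, true) = Re z_j] and
   [u (j, false) = Im z_j]; [rot] is then multiplication by [-i]. *)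
Definition rot u : K -> R :=
  fun k => if k.2 then u (k.1, false) else - u (k.1, true).

(* [inten a u] is [|a^* u|^2] and [cross a u v] is the real part of
   [(a^* u)^bar (a^* v)]. *)
Definition inten a u : R := dot u a ^+ 2 + dot (rot u) a ^+ 2.
Definition cross a u v : R := dot u a * dot v a + dot (rot u) a * dot (rot v) a.

Lemma dotE u v :
  dot u v = \sum_j (u (j, true) * v (j, true) + u (j, false) * v (j, false)).
Proof.
rewrite /dot sum_pair; by apply: eq_bigr => j _; rewrite big_bool.
Qed.

Lemma dot_rot u v : dot (rot u) (rot v) = dot u v.
Proof. by rewrite !dotE; apply: eq_bigr => j _; rewrite /rot/=; ring. Qed.

Lemma dot_rotl u v : dot (rot u) v = - dot u (rot v).
Proof. by rewrite !dotE -sumrN; apply: eq_bigr => j _; rewrite /rot/=; ring. Qed.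

Lemma rotK u : rot (rot u) = (fun k => - u k).
Proof. by apply/funext => -[j []]; rewrite /rot/=. Qed.

Lemma dot_rot_self u : dot u (rot u) = 0.
Proof. by have := dot_rotl u u; rewrite dotC; lra. Qed.

Lemma sqnorm_rot u : sqnorm (rot u) = sqnorm u.
Proof. by rewrite !sqnormE dot_rot. Qed.

Lemma rotD u v : rot (fun k => u k + v k) = (fun k => rot u k + rot v k).
Proof. by apply/funext => -[j []]; rewrite /rot//= opprD. Qed.

Lemma rotZ s u : rot (fun k => s * u k) = (fun k => s * rot u k).
Proof. by apply/funext => -[j []]; rewrite /rot//= mulrN. Qed.

Lemma inten_ge0 a u : 0 <= inten a u.
Proof. by rewrite addr_ge0// sqr_ge0. Qed.

Lemma intenZ s a u : inten a (fun k => s * u k) = s ^+ 2 * inten a u.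
Proof. by rewrite /inten rotZ !dotZl; ring. Qed.

Lemma intenD a u v :
  inten a (fun k => u k + v k) = inten a u + 2 * cross a u v + inten a v.
Proof. by rewrite /inten /cross rotD !dotDl; ring. Qed.

Lemma crossC a u v : cross a u v = cross a v u.
Proof. by rewrite /cross; ring. Qed.

Lemma crossxx a u : cross a u u = inten a u.
Proof. by rewrite /cross /inten; ring. Qed.

Lemma crossDr a u v w :
  cross a u (fun k => v k + w k) = cross a u v + cross a u w.
Proof. by rewrite /cross rotD !dotDl; ring. Qed.

Lemma crossZr s a u v : cross a u (fun k => s * v k) = s * cross a u v.
Proof. by rewrite /cross rotZ !dotZl; ring. Qed.

Lemma intenB a u v :
  inten a (fun k => u k - v k) = inten a u - 2 * cross a u v + inten a v.
Proof.
have -> : (fun k => u k - v k) = (fun k => u k + -1 * v k).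
  by apply/funext => k; ring.
by rewrite intenD intenZ crossZr; ring.
Qed.

(** Passing from [v] to [rot v] turns the real part of [(a^* u)^bar (a^* v)] into its imaginary
    part, so the left side is a squared modulus. *)
Lemma cross_sqD a u v :
  cross a u v ^+ 2 + cross a u (rot v) ^+ 2 = inten a u * inten a v.
Proof. by rewrite /cross /inten rotK dotNl; ring. Qed.

Lemma cross_sq_le a u v : cross a u v ^+ 2 <= inten a u * inten a v.
Proof. by rewrite -cross_sqD lerDl sqr_ge0. Qed.

(** The expectation of [cross a u v ^+ 2] over a Gaussian vector [a], see [Ex_cross_sq]. *)
Definition cross_mean u v : R :=
  (sqnorm u * sqnorm v + 3 * dot u v ^+ 2 - dot u (rot v) ^+ 2) / 2.

End rotation.

(** * Moments attached to one sampling vector *)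

Section gaussian_blocks.
Context (R : realType) (d : measure_display) (T : measurableType d) (P : probability T R).
Context (n m : nat).
Local Notation K := ('I_n * bool)%type.
Context (X : 'I_m * 'I_n * bool -> T -> R).
Hypothesis mX : forall i, measurable_fun setT (X i).
Hypothesis iX : mutually_independent P X.
Hypothesis gX : forall i (B : set R), measurable B ->
  P (X i @^-1` B) = normal_prob 0 (Num.sqrt (2^-1)) B.

Definition sample (r : 'I_m) (w : T) : K -> R := fun k => X (r, k.1, k.2) w.
Definition block (r : 'I_m) : {pred 'I_m * 'I_n * bool} := [pred i | i.1.1 == r].
Definition lift_block (r : 'I_m) (u : K -> R) : 'I_m * 'I_n * bool -> R :=
  fun i => if i.1.1 == r then u (i.1.2, i.2) else 0.

Lemma sum_block r (F : 'I_m * 'I_n * bool -> R) :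
  (forall i, i.1.1 != r -> F i = 0) -> \sum_i F i = \sum_(k : K) F (r, k.1, k.2).
Proof.
move=> F0.
rewrite [LHS]sum_pair [LHS]sum_pair (bigD1 r)//= [X in _ + X]big1 ?addr0.
  by rewrite sum_pair.
by move=> p pr; rewrite big1// => j _; rewrite big1// => b _; rewrite F0.
Qed.

Lemma lin_form_block r u w : lin_form X (lift_block r u) w = dot u (sample r w).
Proof.
rewrite /lin_form (@sum_block r) => [|i ir]; last first.
  by rewrite /lift_block (negbTE ir) mul0r.
by apply: eq_bigr => -[j b] _; rewrite /lift_block/= eqxx.
Qed.

Lemma dot_block r u v : dot (lift_block r u) (lift_block r v) = dot u v.
Proof.
rewrite /dot (@sum_block r) => [|i ir]; last first.
  by rewrite /lift_block (negbTE ir) mul0r.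
by apply: eq_bigr => -[j b] _; rewrite /lift_block/= eqxx.
Qed.

Lemma sqnorm_block r u : sqnorm (lift_block r u) = sqnorm u.
Proof. by rewrite !sqnormE dot_block. Qed.

Lemma sub_measurable_dot r u :
  sub_measurable X (block r) (fun w => dot u (sample r w)).
Proof.
apply: measurable_sum => k; apply: measurable_funM; first exact: measurable_cst.
by apply: sub_measurable_var; rewrite inE.
Qed.

Lemma sub_measurable_inten r u :
  sub_measurable X (block r) (fun w => inten (sample r w) u).
Proof.
by apply: measurable_funD; apply: measurable_funX; exact: sub_measurable_dot.
Qed.

Lemma sub_measurable_cross r u v :
  sub_measurable X (block r) (fun w => cross (sample r w) u v).
Proof.
by apply: measurable_funD; apply: measurable_funM; exact: sub_measurable_dot.
Qed.

Lemma measurable_inten r u : measurable_fun setT (fun w => inten (sample r w) u).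
Proof. exact: (sub_measurableW mX (@sub_measurable_inten r u)). Qed.

Lemma measurable_cross r u v :
  measurable_fun setT (fun w => cross (sample r w) u v).
Proof. exact: (sub_measurableW mX (@sub_measurable_cross r u v)). Qed.

Lemma Ex_cross_sq r u v :
  Ex P (fun w => cross (sample r w) u v ^+ 2) = (cross_mean u v)%:E.
Proof.
transitivity (Ex P (fun w => (lin_form X (lift_block r u) w * lin_form X (lift_block r v) w +
  lin_form X (lift_block r (rot u)) w * lin_form X (lift_block r (rot v)) w) ^+ 2)).
  by apply: eq_Ex => w; rewrite !lin_form_block.
rewrite (Ex_bilinear_sq mX iX gX) !sqnorm_block !dot_block !sqnorm_rot.
rewrite dot_rot dot_rot_self [dot v (rot v)]dot_rot_self [dot v (rot u)]dotC dot_rotl.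
by congr EFin; rewrite /cross_mean; field.
Qed.

Lemma Ex_inten r u : Ex P (fun w => inten (sample r w) u) = (sqnorm u)%:E.
Proof.
have m2 v : measurable_fun setT (fun w => lin_form X v w ^+ 2).
  by apply: measurable_funX; exact: measurable_lin_form.
have p2 v w : 0 <= lin_form X v w ^+ 2 by exact: sqr_ge0.
have E2 v := (lin_form_moments mX iX gX v).1.
transitivity (Ex P (fun w => lin_form X (lift_block r u) w ^+ 2 +
    lin_form X (lift_block r (rot u)) w ^+ 2)).
  by apply: eq_Ex => w; rewrite !lin_form_block.
rewrite (ExD_fin (m2 _) (m2 _) (p2 _) (p2 _) (E2 _) (E2 _)) !sqnorm_block.
by rewrite sqnorm_rot; congr EFin; field.
Qed.

(** The arithmetic-geometric mean inequality [e^((p+q)/8) <= (e^(p/4) + e^(q/4)) / 2] separates the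
    real part of [a^* u] from the imaginary part. *)
Lemma Ex_exp_inten r u : sqnorm u <= 2 ->
  (Ex P (fun w => expR (inten (sample r w) u / 8)) <= 2%:E)%E.
Proof.
move=> u2; pose s := Num.sqrt (2^-1) : R.
have s2 : s ^+ 2 = 2^-1 by rewrite sqr_sqrtr.
pose f v (w : T) := expR (lin_form X (lift_block r (fun k => s * v k)) w ^+ 2 / 2).
have mf v : measurable_fun setT (f v).
  apply: measurableT_comp => //; apply: measurable_funM => //.
  by apply: measurable_funX; exact: measurable_lin_form.
have f0 v w : 0 <= f v w by exact: expR_ge0.
have Ef v : sqnorm v <= 2 -> (Ex P (f v) <= 2%:E)%E.
  move=> v2; apply: (Ex_exp_sq_lin_form mX iX gX).
  by rewrite sqnorm_block sqnormZ s2; lra.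
have mhf v : measurable_fun setT (fun w => 2^-1 * f v w) by exact: measurable_funM.
have hf0 v w : 0 <= 2^-1 * f v w by rewrite mulr_ge0.
apply: (@le_trans _ _ (Ex P (fun w => 2^-1 * f u w + 2^-1 * f (rot u) w))).
  apply: Ex_le => //.
  - apply: measurableT_comp => //; apply: measurable_funM => //.
    exact: measurable_inten.
  - exact: measurable_funD.
  - move=> w; rewrite /f !lin_form_block /inten !dotZl !exprMn s2.
    set p := dot u _ ^+ 2; set q := dot (rot u) _ ^+ 2.
    have -> : (p + q) / 8 = p / 8 + q / 8 by field.
    rewrite expRD (_ : 2^-1 * p / 2 = p / 8 + p / 8); last by field.
    rewrite (_ : 2^-1 * q / 2 = q / 8 + q / 8); last by field.
    rewrite !expRD; have := sqr_ge0 (expR (p / 8) - expR (q / 8)); nra.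
rewrite ExD// !ExZ//.
have -> : (2%:E = 2^-1%:E * 2%:E + 2^-1%:E * 2%:E :> \bar R)%E.
  by rewrite -!EFinM -EFinD; congr EFin; field.
apply: leeD; apply: lee_pmul => //; rewrite ?lee_fin//.
- exact: Ex_ge0.
- exact: Ef.
- exact: Ex_ge0.
- by apply: Ef; rewrite sqnorm_rot.
Qed.

(** In general [a^* u] and [a^* v] are correlated; the same inequality separates them at the price
    of halving the rate. *)
Lemma Ex_exp_inten2 r u v : sqnorm u <= 2 -> sqnorm v <= 2 ->
  (Ex P (fun w => expR ((inten (sample r w) u + inten (sample r w) v) / 16)) <= 2%:E)%E.
Proof.
move=> u2 v2; pose f v (w : T) := expR (inten (sample r w) v / 8).
have mf z : measurable_fun setT (f z).
  apply: measurableT_comp => //; apply: measurable_funM => //.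
  exact: measurable_inten.
have f0 z w : 0 <= f z w by exact: expR_ge0.
have mhf z : measurable_fun setT (fun w => 2^-1 * f z w) by exact: measurable_funM.
have hf0 z w : 0 <= 2^-1 * f z w by rewrite mulr_ge0.
apply: (@le_trans _ _ (Ex P (fun w => 2^-1 * f u w + 2^-1 * f v w))).
  apply: Ex_le => //.
  - apply: measurableT_comp => //; apply: measurable_funM => //.
    by apply: measurable_funD; exact: measurable_inten.
  - exact: measurable_funD.
  - move=> w; rewrite /f; set p := inten _ u; set q := inten _ v.
    have -> : (p + q) / 16 = p / 16 + q / 16 by field.
    rewrite expRD (_ : p / 8 = p / 16 + p / 16); last by field.
    rewrite (_ : q / 8 = q / 16 + q / 16); last by field.
    rewrite !expRD; have := sqr_ge0 (expR (p / 16) - expR (q / 16)); nra.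
rewrite ExD// !ExZ//.
have -> : (2%:E = 2^-1%:E * 2%:E + 2^-1%:E * 2%:E :> \bar R)%E.
  by rewrite -!EFinM -EFinD; congr EFin; field.
by apply: leeD; apply: lee_pmul => //; rewrite ?lee_fin//;
  [exact: Ex_ge0|exact: Ex_exp_inten|exact: Ex_ge0|exact: Ex_exp_inten].
Qed.

Lemma Ex_exp_sqnorm r :
  (Ex P (fun w => expR (sqnorm (sample r w) / 2)) <= (4 ^+ n)%:E)%E.
Proof.
pose f (k : K) (w : T) := expR (X (r, k.1, k.2) w ^+ 2 / 2).
rewrite (eq_Ex P (g := fun w => \prod_k f k w)); last first.
  move=> w; rewrite -expR_sum; congr expR.
  by rewrite /sqnorm mulr_suml; apply: eq_bigr.
rewrite (indep_Ex_prod mX iX (S := fun k => pred1 (r, k.1, k.2))); first last.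
- by move=> k w; exact: expR_ge0.
- move=> k; apply: measurableT_comp => //; apply: measurable_funM => //.
  by apply: measurable_funX; apply: sub_measurable_var; rewrite inE.
- by move=> [j b] [j' b'] i; rewrite !inE => /eqP -> /eqP [-> ->].
have mg : measurable_fun setT (fun x : R => expR (x ^+ 2 / 2)).
  by apply: measurableT_comp => //; exact: measurable_funM.
have Ef k : (Ex P (f k) <= 2%:E)%E.
  rewrite (Ex_gauss mX gX (r, k.1, k.2) mg (fun x => expR_ge0 _)).
  exact: normal_exp_sq.
have vk k : {v : R | 0 <= v <= 2 & Ex P (f k) = v%:E}.
  apply: cid2; have [|v v0 Ev] := Ex_le_fin _ (Ef k).
    by move=> w; exact: expR_ge0.
  by exists v => //; rewrite v0 -lee_fin -Ev Ef.
rewrite (eq_bigr (fun k => (s2val (vk k))%:E)); last by move=> k _; case: (vk k).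
rewrite prodEFin lee_fin.
have -> : 4 ^+ n = \prod_(k : K) 2 :> R.
  rewrite prodr_const card_prod card_ord card_bool mulnC exprM.
  by congr (_ ^+ _); ring.
by apply: ler_prod => k _; case: (vk k).
Qed.

End gaussian_blocks.

(** * Elementary exponential inequalities *)

Section exponential_inequalities.
Context (R : realType).

Lemma expR_le_quadratic (y : R) : 0 <= y -> expR y <= 1 + y + y ^+ 2 * expR y.
Proof.
move=> y0; have e0 := expR_gt0 y.
have h := expR_ge1Dx (- y); rewrite expRN in h.
have : (1 - y) * expR y <= 1 by rewrite -ler_pdivlMr// mul1r.
move=> h1; have : (1 + y) * ((1 - y) * expR y) <= (1 + y) * 1.
  by rewrite ler_wpM2l//; lra.
nra.
Qed.

Lemma expRN_le_quadratic (y : R) : 0 <= y -> expR (- y) <= 1 - y + y ^+ 2.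
Proof.
move=> y0; have h := expR_ge1Dx y; have e0 := expR_gt0 y.
rewrite expRN -[leLHS]mul1r ler_pdivrMr//.
apply: (@le_trans _ _ ((1 - y + y ^+ 2) * (1 + y))); last first.
  by rewrite ler_wpM2l//; have := sqr_ge0 (y - 2^-1); nra.
by have : 0 <= y ^+ 3 by [rewrite exprn_ge0]; lra.
Qed.

Lemma exprn_le_expR (k : nat) (y : R) : 0 <= y -> y ^+ k <= k`!%:R * expR y.
Proof.
move=> y0; case: k => [|k].
  by rewrite expr0 fact0 mul1r -[leLHS]expR0 ler_expR.
have := expR_ge1Dxn k y0.
have f0 : 0 < (k.+1)`!%:R :> R by rewrite ltr0n fact_gt0.
move=> h; rewrite -ler_pdivrMl// mulrC.
by apply: le_trans h; rewrite lerDr.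
Qed.

Lemma exprn_le_expR_scaled (k : nat) (c y : R) : 0 <= y -> 0 < c ->
  y ^+ k <= c ^+ k * k`!%:R * expR (y / c).
Proof.
move=> y0 c0; have -> : y ^+ k = c ^+ k * (y / c) ^+ k.
  by rewrite -exprMn mulrC divfK// gt_eqF.
rewrite -[leRHS]mulrA ler_wpM2l ?exprn_ge0 ?(ltW c0)//.
by apply: exprn_le_expR; rewrite divr_ge0 ?(ltW c0).
Qed.

End exponential_inequalities.

(** * Union, Markov and Chernoff bounds *)

Section high_probability.
Context (R : realType) (d : measure_display) (T : measurableType d) (P : probability T R).

(** Only a measurable event inside [Q] is asked for: the properties of interest quantify over all
    vectors, and their own measurability never has to be discussed. *)
Definition whp (e : R) (Q : T -> Prop) : Prop :=
  exists E : set T, [/\ measurable E, (P (~` E) <= e%:E)%E & forall w, E w -> Q w].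

Lemma whpW e e' (Q Q' : T -> Prop) : e <= e' -> (forall w, Q w -> Q' w) ->
  whp e Q -> whp e' Q'.
Proof.
move=> ee QQ [E [mE PE EQ]]; exists E; split => //.
  by apply: le_trans PE _; rewrite lee_fin.
by move=> w /EQ /QQ.
Qed.

Lemma whp_and e e' (Q Q' : T -> Prop) :
  whp e Q -> whp e' Q' -> whp (e + e') (fun w => Q w /\ Q' w).
Proof.
move=> [E [mE PE EQ]] [E' [mE' PE' EQ']]; exists (E `&` E'); split.
- exact: measurableI.
- rewrite setCI EFinD; apply: le_trans (leeD PE PE').
  by apply: measureU2; exact: measurableC.
- by move=> w [/EQ ? /EQ'].
Qed.

Lemma whp_true (Q : T -> Prop) : (forall w, Q w) -> whp 0 Q.
Proof.
by move=> h; exists setT; split => //; rewrite setCT measure0.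
Qed.

Lemma whp_forall (J : eqType) (s : seq J) (e : R) (Q : J -> T -> Prop) :
  (forall j, j \in s -> whp e (Q j)) ->
  whp ((size s)%:R * e) (fun w => forall j, j \in s -> Q j w).
Proof.
elim: s => [_|j s ih H] /=.
  by rewrite mul0r; apply: whp_true.
rewrite -natr1 mulrDl mul1r addrC.
have H1 := H j (mem_head _ _).
have H2 : whp ((size s)%:R * e) (fun w => forall j, j \in s -> Q j w).
  by apply: ih => k ks; apply: H; rewrite inE ks orbT.
apply: whpW (whp_and H1 H2) => // w [Hj Hs] k.
by rewrite inE => /orP[/eqP ->//|]; exact: Hs.
Qed.

Lemma whp_markov (f : T -> R) (c e : R) : measurable_fun setT f ->
  (forall w, 0 <= f w) -> 0 < c -> (Ex P f <= (c * e)%:E)%E ->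
  whp e (fun w => f w < c).
Proof.
move=> mf f0 c0 Ef.
have mS : measurable [set w | c <= f w].
  rewrite (_ : [set _ | _] = f @^-1` `[c, +oo[%classic).
    by rewrite -[X in measurable X]setTI; exact: mf.
  by apply/seteqP; split => w /=; rewrite in_itv/= andbT.
exists (~` [set w | c <= f w]); split; first exact: measurableC.
  rewrite setCK; apply: le_trans (Ex_markov P mf f0 c0) _.
  apply: (@le_trans _ _ ((c^-1)%:E * (c * e)%:E)%E).
    by rewrite lee_pmul// ?lee_fin ?invr_ge0 ?(ltW c0)// Ex_ge0.
  by rewrite -EFinM mulKf ?gt_eqF.
by move=> w /= /negP; rewrite -ltNge.
Qed.

Context (n m : nat) (X : 'I_m * 'I_n * bool -> T -> R).
Hypothesis mX : forall i, measurable_fun setT (X i).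
Hypothesis iX : mutually_independent P X.

Let block_disj (r r' : 'I_m) (i : 'I_m * 'I_n * bool) :
  i \in @block n m r -> i \in @block n m r' -> r = r'.
Proof. by rewrite !inE => /eqP -> /eqP. Qed.

Let Ex_prod_le (G : 'I_m -> T -> R) (b : R) :
  (forall r, sub_measurable X (@block n m r) (G r)) -> (forall r w, 0 <= G r w) ->
  (forall r, (Ex P (G r) <= b%:E)%E) ->
  (Ex P (fun w => \prod_r G r w)%R <= (b ^+ m)%:E)%E.
Proof.
move=> mG G0 EG; rewrite (indep_Ex_prod mX iX block_disj mG G0).
have vk r : {v : R | 0 <= v <= b & Ex P (G r) = v%:E}.
  apply: cid2; have [//|v v0 Ev] := Ex_le_fin _ (EG r).
  by exists v => //; rewrite v0 -lee_fin -Ev EG.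
rewrite (eq_bigr (fun r => (s2val (vk r))%:E)); last by move=> r _; case: (vk r).
rewrite prodEFin lee_fin -[X in b ^+ X]card_ord -prodr_const.
by apply: ler_prod => r _; case: (vk r).
Qed.

Variable F : 'I_m -> T -> R.
Hypothesis mF : forall r, sub_measurable X (@block n m r) (F r).
Hypothesis F0 : forall r w, 0 <= F r w.
Variables (mu lam delta C : R).
Hypotheses (m0 : (0 < m)%N) (lam0 : 0 < lam) (delta0 : 0 < delta) (C0 : 0 <= C).
Hypothesis lamC : 2 * C * lam <= delta.

Let mFT r : measurable_fun setT (F r) := sub_measurableW mX (@mF r).

(** The Chernoff computation common to both tails: [1 + y <= e^y] bounds the product of the [m]
    expectations, and [2 C lam <= delta] leaves half of the exponent [m lam delta]. *)
Let Ex_exp_sum_le (s c mu' : R) :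
  (forall r, (Ex P (fun w => expR (s * F r w)) <= (1 + mu' + lam ^+ 2 * C)%:E)%E) ->
  c = m%:R * (mu' + lam * delta) -> 0 <= 1 + mu' + lam ^+ 2 * C ->
  whp (expR (- (m%:R * (lam * delta / 2)))) (fun w => expR (s * \sum_r F r w) < expR c).
Proof.
move=> EF -> b0; apply: whp_markov.
- apply: measurableT_comp => //; apply: measurable_funM => //.
  by apply: measurable_sum => r; exact: mFT.
- by move=> w; exact: expR_ge0.
- exact: expR_gt0.
rewrite (eq_Ex P (g := fun w => \prod_r expR (s * F r w))); last first.
  by move=> w; rewrite -expR_sum mulr_sumr.
apply: le_trans (Ex_prod_le _ _ EF) _.
- by move=> r; apply: measurableT_comp => //; apply: measurable_funM => //; exact: mF.
- by move=> r w; exact: expR_ge0.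
rewrite lee_fin; apply: (@le_trans _ _ (expR (mu' + lam ^+ 2 * C) ^+ m)).
  by rewrite ler_pXn2r ?nnegrE ?expR_ge0// -addrA expR_ge1Dx.
rewrite -expRM_natl -expRD ler_expR -mulrBr ler_wpM2l//.
have : lam * (2 * C * lam) <= lam * delta by rewrite ler_pM2l.
by rewrite expr2; lra.
Qed.

Lemma chernoff_upper : 0 <= mu ->
  (forall r, (Ex P (F r) <= mu%:E)%E) ->
  (forall r, (Ex P (fun w => F r w ^+ 2 * expR (lam * F r w))%R <= C%:E)%E) ->
  whp (expR (- (m%:R * (lam * delta / 2))))
    (fun w => m%:R^-1 * \sum_r F r w < mu + delta).
Proof.
move=> mu0 EF EF2.
have := @Ex_exp_sum_le lam (m%:R * (lam * mu + lam * delta)) (lam * mu).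
move=> /(_ _ erefl) H; apply: whpW (H _ _) => //.
- move=> w; rewrite ltr_expR -mulrDr mulrCA ltr_pM2l// => h.
  by rewrite mulrC ltr_pdivrMr ?ltr0n// mulrC.
- move=> r; have mE : measurable_fun setT (fun w => expR (lam * F r w)).
    by apply: measurableT_comp => //; exact: measurable_funM.
  have m1 : measurable_fun setT (fun w => 1 + lam * F r w).
    by apply: measurable_funD => //; exact: measurable_funM.
  have m2 : measurable_fun setT (fun w => F r w ^+ 2 * expR (lam * F r w)).
    by apply: measurable_funM => //; exact: measurable_funX.
  have p1 w : 0 <= lam * F r w by rewrite mulr_ge0// ltW.
  have p2 w : 0 <= F r w ^+ 2 * expR (lam * F r w).
    by rewrite mulr_ge0 ?expR_ge0 ?sqr_ge0.
  apply: (@le_trans _ _ (Ex P (fun w => 1 + lam * F r w +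
      lam ^+ 2 * (F r w ^+ 2 * expR (lam * F r w))))).
    apply: Ex_le => // [|w].
    + by apply: measurable_funD => //; exact: measurable_funM.
    + by apply: le_trans (expR_le_quadratic (p1 w)) _; rewrite exprMn -!mulrA.
  rewrite ExD//; last 3 first.
  + exact: measurable_funM.
  + by move=> w; rewrite addr_ge0.
  + by move=> w; rewrite mulr_ge0// sqr_ge0.
  rewrite ExD//; last exact: measurable_funM.
  rewrite Ex_cst !ExZ ?(ltW lam0) ?sqr_ge0// !EFinD; apply: leeD.
    by rewrite leeD2l// EFinM lee_pmul2l// lte_fin.
  by rewrite (EFinM (lam ^+ 2)) lee_pmul2l// lte_fin exprn_gt0.
- by rewrite !addr_ge0// mulr_ge0 ?sqr_ge0// ltW.
Qed.

(** Since [F >= 0], a second moment suffices, by [e^(-y) <= 1 - y + y^2]. That inequality is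
    integrated as [e^(-y) + y <= 1 + y^2], which keeps every term nonnegative. *)
Lemma chernoff_lower :
  (forall r, (mu%:E <= Ex P (F r))%E) ->
  (forall r, (Ex P (fun w => F r w ^+ 2)%R <= C%:E)%E) ->
  whp (expR (- (m%:R * (lam * delta / 2))))
    (fun w => mu - delta < m%:R^-1 * \sum_r F r w).
Proof.
move=> EF EF2.
have Eexp r : (Ex P (fun w => expR (- lam * F r w)) <=
    (1 - lam * mu + lam ^+ 2 * C)%:E)%E.
  have mE : measurable_fun setT (fun w => expR (- lam * F r w)).
    by apply: measurableT_comp => //; exact: measurable_funM.
  have m1 : measurable_fun setT (fun w => lam * F r w) by exact: measurable_funM.
  have m2 : measurable_fun setT (fun w => F r w ^+ 2) by exact: measurable_funX.
  have p1 w : 0 <= lam * F r w by rewrite mulr_ge0// ltW.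
  have p2 w : 0 <= F r w ^+ 2 by exact: sqr_ge0.
  have le2 : (Ex P (fun w => expR (- lam * F r w) + lam * F r w)%R <=
      (1 + lam ^+ 2 * C)%:E)%E.
    apply: (@le_trans _ _ (Ex P (fun w => 1 + lam ^+ 2 * F r w ^+ 2))).
      apply: Ex_le => // [|||w].
      + exact: measurable_funD.
      + by apply: measurable_funD => //; exact: measurable_funM.
      + by move=> w; rewrite addr_ge0// expR_ge0.
      + have := expRN_le_quadratic (p1 w); rewrite exprMn mulNr; lra.
    rewrite ExD//; last 2 first.
    + exact: measurable_funM.
    + by move=> w; rewrite mulr_ge0// sqr_ge0.
    rewrite Ex_cst ExZ ?sqr_ge0// EFinD leeD2l// (EFinM (lam ^+ 2)) lee_pmul2l//.
    by rewrite lte_fin exprn_gt0.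
  rewrite (ExD _ mE m1 (fun w => expR_ge0 _) p1) (ExZ _ (mFT r) (ltW lam0) (F0 r)) in le2.
  have := Ex_ge0 P (f := fun w => expR (- lam * F r w)) (fun w => expR_ge0 _).
  have lmu : ((lam * mu)%:E <= lam%:E * Ex P (F r))%E.
    by rewrite EFinM lee_pmul2l// lte_fin.
  have : (Ex P (fun w => expR (- lam * F r w)) + (lam * mu)%:E <= (1 + lam ^+ 2 * C)%:E)%E.
    by apply: le_trans le2; rewrite leeD2l.
  case: (Ex P (fun w => expR (- lam * F r w))) => [v| |] //.
  by rewrite -EFinD !lee_fin; lra.
have b0 : 0 <= 1 + - (lam * mu) + lam ^+ 2 * C.
  have := Eexp (Ordinal m0); rewrite -lee_fin; apply: le_trans; apply: Ex_ge0 => w.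
  exact: expR_ge0.
have := @Ex_exp_sum_le (- lam) (m%:R * (- (lam * mu) + lam * delta)) (- (lam * mu)) Eexp erefl b0.
apply: whpW => // w; rewrite ltr_expR -mulrN -mulrDr mulrCA mulNr -mulrN ltr_pM2l// => h.
rewrite mulrC ltr_pdivlMr ?ltr0n// mulrC; lra.
Qed.

End high_probability.

(** * The Huber function *)

Section huber.
Context (R : realType).
Implicit Types k s t : R.

(* Being convex, [huber k] can be bounded by rounding its argument up to the
   lattice; growing linearly, it has exponential moments when [s = |a^* h|^2]. *)
Definition huber k s : R := if s <= k then s ^+ 2 else 2 * k * s - k ^+ 2.

Lemma huber_le_sq k s : huber k s <= s ^+ 2.
Proof. by rewrite /huber; case: ifP => // _; have := sqr_ge0 (s - k); nra. Qed.

Lemma huber_ge0 k s : 0 <= k -> 0 <= huber k s.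
Proof.
rewrite /huber => k0; case: ifPn => [_|]; first exact: sqr_ge0.
by rewrite -ltNge; nra.
Qed.

Lemma huber_le_lin k s : 0 <= k -> 0 <= s -> huber k s <= 2 * k * s.
Proof. by rewrite /huber => k0 s0; case: ifPn => [|]; nra. Qed.

Lemma huber_tail k s : 0 <= k -> k < s -> k * s <= huber k s.
Proof. by rewrite /huber => k0 ks; case: ifPn => [|_]; nra. Qed.

Lemma le_1_huber k s : 1 <= k -> s <= 1 + huber k s.
Proof. by rewrite /huber => k0; case: ifPn => [_|]; rewrite -?ltNge; nra. Qed.

(** The slope is the derivative [2 min(s, k)]. Its sign matters: the bound survives when [t - s] is
    replaced by a lower bound. *)
Lemma huber_support k s : 0 <= k -> 0 <= s ->
  exists2 c, 0 <= c & forall t, 0 <= t -> huber k s + c * (t - s) <= huber k t.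
Proof.
move=> k0 s0; exists (2 * Num.min s k) => [|t t0].
  by rewrite mulr_ge0// le_min s0.
have [sq1 sq2] := (sqr_ge0 (t - s), sqr_ge0 (t - k)).
rewrite /huber; case: (leP s k) => sk; case: (leP t k) => tk; [lra| |lra|lra].
have : 0 <= (k - s) * (2 * t - k - s) by rewrite mulr_ge0//; lra.
lra.
Qed.

End huber.

(** * Concentration at fixed vectors *)

Section sample_concentration.
Context (R : realType) (d : measure_display) (T : measurableType d) (P : probability T R).
Context (n m : nat).
Local Notation K := ('I_n * bool)%type.
Context (X : 'I_m * 'I_n * bool -> T -> R).
Hypothesis mX : forall i, measurable_fun setT (X i).
Hypothesis iX : mutually_independent P X.
Hypothesis gX : forall i (B : set R), measurable B ->
  P (X i @^-1` B) = normal_prob 0 (Num.sqrt (2^-1)) B.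
Hypothesis m0 : (0 < m)%N.

Local Notation a := (sample X).
Local Notation mean F := (m%:R^-1 * \sum_(r < m) F r).

(* Since [y ^ k e^(y/32) <= 32^k k! e^(y/16)], this bounds the expectation of the
   left-hand side when [e^(y/16)] has expectation at most 2. *)
Definition mom (k : nat) : R := 32 ^+ k * k`!%:R * 2.

Lemma mom_ge0 k : 0 <= mom k.
Proof. by rewrite !mulr_ge0// exprn_ge0. Qed.

Definition two_inten (r : 'I_m) (u v : K -> R) (w : T) : R :=
  inten (a r w) u + inten (a r w) v.

Lemma two_inten_ge0 r u v w : 0 <= two_inten r u v w.
Proof. by rewrite addr_ge0// inten_ge0. Qed.

Lemma measurable_two_inten r u v : measurable_fun setT (two_inten r u v).
Proof. by apply: measurable_funD; exact: measurable_inten. Qed.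

Lemma Ex_mom_le (f : T -> R) r u v k : measurable_fun setT f -> (forall w, 0 <= f w) ->
  sqnorm u <= 2 -> sqnorm v <= 2 ->
  (forall w, f w <= two_inten r u v w ^+ k * expR (two_inten r u v w / 32)) ->
  (Ex P f <= (mom k)%:E)%E.
Proof.
move=> mf f0 u2 v2 fle; pose c : R := 32 ^+ k * k`!%:R.
have c0 : 0 <= c by rewrite mulr_ge0// exprn_ge0.
have mE : measurable_fun setT (fun w => expR (two_inten r u v w / 16)).
  apply: measurableT_comp => //; apply: measurable_funM => //.
  exact: measurable_two_inten.
apply: (@le_trans _ _ (Ex P (fun w => c * expR (two_inten r u v w / 16)))).
  apply: Ex_le => // [|w]; first exact: measurable_funM.
  apply: le_trans (fle w) _.
  rewrite (_ : two_inten r u v w / 16 = two_inten r u v w / 32 + two_inten r u v w / 32);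
    last by field.
  rewrite expRD [leRHS]mulrA ler_wpM2r ?expR_ge0//.
  by apply: exprn_le_expR_scaled => //; exact: two_inten_ge0.
rewrite ExZ// (_ : mom k = c * 2)// (EFinM c); apply: lee_pmul => //; first exact: Ex_ge0.
exact: Ex_exp_inten2.
Qed.

(** The truncated square is at most [B * inten b h], which gives exponential moments at a rate of
    order [1 / B]. *)
Definition trunc_cross (B : R) (x h : K -> R) (b : K -> R) : R :=
  if inten b x <= B then cross b x h ^+ 2 else 0.

Lemma trunc_cross_ge0 B x h b : 0 <= trunc_cross B x h b.
Proof. by rewrite /trunc_cross; case: ifP => // _; exact: sqr_ge0. Qed.

Lemma trunc_cross_le B x h b : trunc_cross B x h b <= cross b x h ^+ 2.
Proof. by rewrite /trunc_cross; case: ifP => // _; exact: sqr_ge0. Qed.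

Lemma sub_measurable_trunc_cross B x h r :
  sub_measurable X (@block n m r) (fun w => trunc_cross B x h (a r w)).
Proof.
apply: measurable_fun_ifT => //.
- by apply: measurable_fun_ler => //; exact: sub_measurable_inten.
- by apply: measurable_funX; exact: sub_measurable_cross.
Qed.

Section fixed_vectors.
Variables (x h : K -> R).
Hypotheses (x2 : sqnorm x <= 2) (h2 : sqnorm h <= 2).
Variables (lam delta : R).
Hypotheses (lam0 : 0 < lam) (delta0 : 0 < delta) (lam4 : 2 * mom 4 * lam <= delta).

Let eps : R := expR (- (m%:R * (lam * delta / 2))).

Let inten_le r w : inten (a r w) h <= two_inten r x h w.
Proof. by rewrite lerDr inten_ge0. Qed.

Let intenx_le r w : inten (a r w) x <= two_inten r x h w.
Proof. by rewrite lerDl inten_ge0. Qed.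

Lemma cross_mean_ge0 : 0 <= cross_mean x h.
Proof.
rewrite -lee_fin -(Ex_cross_sq mX iX gX (Ordinal m0)).
by apply: Ex_ge0 => w; exact: sqr_ge0.
Qed.

Variable B : R.
Hypotheses (B1 : 1 <= B) (lamB : 32 * lam * B <= 1) (B3 : mom 3 / B <= delta).

Let F r w := trunc_cross B x h (a r w).
Let F0 r w : 0 <= F r w := trunc_cross_ge0 B x h (a r w).
Let mF r : sub_measurable X (@block n m r) (F r) := @sub_measurable_trunc_cross B x h r.
Let mFT r : measurable_fun setT (F r) := sub_measurableW mX (@mF r).

Let F_le_sq r w : F r w <= two_inten r x h w ^+ 2.
Proof.
apply: le_trans (trunc_cross_le _ _ _ _) _.
apply: le_trans (cross_sq_le _ _ _) _.
by rewrite expr2; apply: ler_pM; rewrite ?inten_ge0.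
Qed.

Let F_le_B r w : lam * F r w <= two_inten r x h w / 32.
Proof.
have u0 := two_inten_ge0 r x h w.
apply: (@le_trans _ _ (lam * (B * two_inten r x h w))).
  rewrite ler_pM2l// /F /trunc_cross; case: ifPn => AB; last by rewrite mulr_ge0// (le_trans ler01).
  by apply: le_trans (cross_sq_le _ _ _) _; apply: ler_pM; rewrite ?inten_ge0.
rewrite -(ler_pM2l (_ : 0 < 32))//.
have -> : 32 * (two_inten r x h w / 32) = two_inten r x h w by field.
have -> : 32 * (lam * (B * two_inten r x h w)) = (32 * lam * B) * two_inten r x h w by ring.
by rewrite ler_piMl.
Qed.

Lemma whp_trunc_cross : whp P (eps + eps) (fun w =>
  `|mean (fun r => trunc_cross B x h (a r w)) - cross_mean x h| <= 2 * delta).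
Proof.
have mcr r : measurable_fun setT (fun w => cross (a r w) x h ^+ 2).
  by apply: measurable_funX; exact: measurable_cross.
have Fup r : (Ex P (F r) <= (cross_mean x h)%:E)%E.
  rewrite -(Ex_cross_sq mX iX gX r); apply: Ex_le => // w.
  exact: trunc_cross_le.
have F2exp r : (Ex P (fun w => F r w ^+ 2 * expR (lam * F r w))%R <= (mom 4)%:E)%E.
  apply: (@Ex_mom_le _ r x h) => // [|w|w].
  - apply: measurable_funM; first exact: measurable_funX.
    by apply: measurableT_comp => //; exact: measurable_funM.
  - by rewrite mulr_ge0 ?sqr_ge0 ?expR_ge0.
  - apply: ler_pM; rewrite ?sqr_ge0 ?expR_ge0 ?ler_expR//.
    by rewrite (exprM _ 2 2) ler_pXn2r ?nnegrE ?exprn_ge0 ?two_inten_ge0.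
have F2 r : (Ex P (fun w => F r w ^+ 2)%R <= (mom 4)%:E)%E.
  apply: le_trans (F2exp r); apply: Ex_le => // [||w|w].
  - exact: measurable_funX.
  - apply: measurable_funM; first exact: measurable_funX.
    by apply: measurableT_comp => //; exact: measurable_funM.
  - exact: sqr_ge0.
  - by rewrite ler_peMr ?sqr_ge0// -[leLHS]expR0 ler_expR mulr_ge0// ltW.
(* Bias of the truncation: where [|a^* x|^2 > B], the lost term is at most
   [|a^* x|^4 |a^* h|^2 / B], of expectation at most [mom 3 / B]. *)
have Flow r : ((cross_mean x h - delta)%:E <= Ex P (F r))%E.
  have mt : measurable_fun setT (fun w => two_inten r x h w ^+ 3).
    by apply: measurable_funX; exact: measurable_two_inten.
  have pt w : 0 <= two_inten r x h w ^+ 3 by rewrite exprn_ge0// two_inten_ge0.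
  have B0 : 0 <= B^-1 by rewrite invr_ge0 (le_trans ler01).
  have : ((cross_mean x h)%:E <= Ex P (F r) + delta%:E)%E.
    rewrite -(Ex_cross_sq mX iX gX r).
    apply: (@le_trans _ _ (Ex P (fun w => F r w + B^-1 * two_inten r x h w ^+ 3))).
      apply: Ex_le => // [||w].
      - by apply: measurable_funD => //; exact: measurable_funM.
      - by move=> w; exact: sqr_ge0.
      - rewrite /F /trunc_cross; case: ifPn => [_|]; first by rewrite lerDl mulr_ge0.
        rewrite -ltNge add0r => AB; apply: le_trans (cross_sq_le _ _ _) _.
        rewrite ler_pdivlMl; last exact: lt_le_trans B1.
        rewrite !exprS expr0 mulr1.
        have u0 := two_inten_ge0 r x h w.
        apply: (@le_trans _ _ (inten (a r w) x * (inten (a r w) x * inten (a r w) h))).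
          by rewrite ler_wpM2r ?mulr_ge0 ?inten_ge0// ltW.
        by apply: ler_pM; rewrite ?mulr_ge0 ?inten_ge0//; apply: ler_pM; rewrite ?inten_ge0.
    rewrite ExD//; last 2 first.
    - exact: measurable_funM.
    - by move=> w; rewrite mulr_ge0.
    rewrite leeD2l// ExZ//; apply: (@le_trans _ _ (B^-1%:E * (mom 3)%:E)%E).
      rewrite lee_pmul// ?lee_fin//; first exact: Ex_ge0.
      apply: (@Ex_mom_le _ r x h) => // w.
      rewrite ler_peMr// -[leLHS]expR0 ler_expR divr_ge0// two_inten_ge0//.
    by rewrite -EFinM lee_fin mulrC.
  by rewrite EFinB leeBlDr.
have W1 := chernoff_upper mX iX mF F0 m0 lam0 (mom_ge0 4) lam4 cross_mean_ge0 Fup F2exp.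
have W2 := chernoff_lower mX iX mF F0 m0 lam0 lam4 Flow F2.
apply: whpW (whp_and W1 W2) => // w [/ltW h1' /ltW h2'].
by rewrite ler_norml; apply/andP; split; lra.
Qed.

End fixed_vectors.

Section fixed_vector.
Variables (h : K -> R).
Hypothesis h2 : sqnorm h <= 2.
Variables (lam delta : R).
Hypotheses (lam0 : 0 < lam) (delta0 : 0 < delta).

Let eps : R := expR (- (m%:R * (lam * delta / 2))).

Lemma whp_huber k : 0 <= k -> 2 * mom 4 * lam <= delta -> 64 * lam * k <= 1 ->
  whp P eps (fun w =>
    mean (fun r => huber k (inten (a r w) h)) < 2 * sqnorm h ^+ 2 + delta).
Proof.
move=> k0 lam4 lamk; pose F r w := huber k (inten (a r w) h).
have F0 r w : 0 <= F r w by exact: huber_ge0.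
have mF r : sub_measurable X (@block n m r) (F r).
  apply: measurable_fun_ifT => //.
  - by apply: measurable_fun_ler => //; exact: sub_measurable_inten.
  - by apply: measurable_funX; exact: sub_measurable_inten.
  - apply: measurable_funB => //; apply: measurable_funM => //.
    exact: sub_measurable_inten.
have mFT r : measurable_fun setT (F r) := sub_measurableW mX (@mF r).
have FA r w : F r w <= two_inten r h h w ^+ 2.
  apply: le_trans (huber_le_sq _ _) _.
  by rewrite ler_pXn2r ?nnegrE ?two_inten_ge0 ?inten_ge0// lerDl inten_ge0.
have Fup r : (Ex P (F r) <= (cross_mean h h)%:E)%E.
  rewrite -(Ex_cross_sq mX iX gX r); apply: Ex_le => // [|w].
    by apply: measurable_funX; exact: measurable_cross.
  by rewrite crossxx; exact: huber_le_sq.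
have F2exp r : (Ex P (fun w => F r w ^+ 2 * expR (lam * F r w))%R <= (mom 4)%:E)%E.
  apply: (@Ex_mom_le _ r h h) => // [|w|w].
  - apply: measurable_funM; first exact: measurable_funX.
    by apply: measurableT_comp => //; exact: measurable_funM.
  - by rewrite mulr_ge0 ?sqr_ge0 ?expR_ge0.
  - apply: ler_pM; rewrite ?sqr_ge0 ?expR_ge0 ?ler_expR//.
      by rewrite (exprM _ 2 2) ler_pXn2r ?nnegrE ?exprn_ge0 ?two_inten_ge0.
    have A0 := inten_ge0 (a r w) h.
    apply: (@le_trans _ _ (lam * (2 * k * inten (a r w) h))).
      by rewrite ler_pM2l// huber_le_lin.
    rewrite /two_inten; move: (inten _ _) A0 => A A0.
    rewrite (_ : lam * _ = 64 * lam * k * (A / 32)); last by field.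
    rewrite (_ : (A + A) / 32 = A / 32 + A / 32); last by field.
    by apply: (@le_trans _ _ (A / 32)); rewrite ?ler_piMl ?lerDl ?divr_ge0.
have cm : cross_mean h h = 2 * sqnorm h ^+ 2.
  by rewrite /cross_mean dot_rot_self -sqnormE; field.
have := chernoff_upper mX iX mF F0 m0 lam0 (mom_ge0 4) lam4 _ Fup F2exp.
by rewrite cm; apply; rewrite mulr_ge0// sqr_ge0.
Qed.

Lemma whp_mean_inten : 2 * mom 2 * lam <= delta -> 32 * lam <= 1 ->
  whp P (eps + eps) (fun w =>
    `|mean (fun r => inten (a r w) h) - sqnorm h| <= delta).
Proof.
move=> lam2 lam32; pose F r w := inten (a r w) h.
have F0 r w : 0 <= F r w by exact: inten_ge0.
have mF r : sub_measurable X (@block n m r) (F r) := @sub_measurable_inten _ _ _ _ _ X r h.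
have mFT r : measurable_fun setT (F r) := sub_measurableW mX (@mF r).
have EF r : Ex P (F r) = (sqnorm h)%:E by exact: Ex_inten.
have FA r w : F r w <= two_inten r h h w by rewrite lerDl inten_ge0.
have F2exp r : (Ex P (fun w => F r w ^+ 2 * expR (lam * F r w))%R <= (mom 2)%:E)%E.
  apply: (@Ex_mom_le _ r h h) => // [|w|w].
  - apply: measurable_funM; first exact: measurable_funX.
    by apply: measurableT_comp => //; exact: measurable_funM.
  - by rewrite mulr_ge0 ?sqr_ge0 ?expR_ge0.
  - apply: ler_pM; rewrite ?sqr_ge0 ?expR_ge0 ?ler_expR//.
      by rewrite ler_pXn2r ?nnegrE ?two_inten_ge0.
    apply: (@le_trans _ _ (F r w / 32)); last by rewrite ler_wpM2r.
    by rewrite ler_pdivlMr// mulrC mulrA ler_piMl.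
have F2 r : (Ex P (fun w => F r w ^+ 2)%R <= (mom 2)%:E)%E.
  apply: le_trans (F2exp r); apply: Ex_le => // [||w|w].
  - exact: measurable_funX.
  - apply: measurable_funM; first exact: measurable_funX.
    by apply: measurableT_comp => //; exact: measurable_funM.
  - exact: sqr_ge0.
  - by rewrite ler_peMr ?sqr_ge0// -[leLHS]expR0 ler_expR mulr_ge0// ltW.
have Eup r : (Ex P (F r) <= (sqnorm h)%:E)%E by rewrite EF.
have Elow r : ((sqnorm h)%:E <= Ex P (F r))%E by rewrite EF.
have W1 := chernoff_upper mX iX mF F0 m0 lam0 (mom_ge0 2) lam2 (sqnorm_ge0 h) Eup F2exp.
have W2 := chernoff_lower mX iX mF F0 m0 lam0 lam2 Elow F2.
apply: whpW (whp_and W1 W2) => // w [/ltW h1 /ltW h2'].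
by rewrite ler_norml; apply/andP; split; lra.
Qed.

(** Used with [l = ln m], where the failure probability is [2 / m^3]. *)
Lemma whp_max_inten (l : R) : whp P (m%:R * (2 * expR (- (4 * l))))
  (fun w => forall r, inten (a r w) h < 32 * l).
Proof.
have : forall r, r \in enum 'I_m ->
    whp P (2 * expR (- (4 * l))) (fun w => inten (a r w) h < 32 * l).
  move=> r _.
  have mf : measurable_fun setT (fun w => expR (inten (a r w) h / 8)).
    apply: measurableT_comp => //; apply: measurable_funM => //.
    exact: measurable_inten.
  have := @whp_markov _ _ _ P _ (expR (4 * l)) (2 * expR (- (4 * l))) mf
    (fun w => expR_ge0 _) (expR_gt0 _).
  rewrite mulrCA -expRD subrr expR0 mulr1 => /(_ (Ex_exp_inten mX iX gX r h2)).
  by apply: whpW => // w; rewrite ltr_expR; lra.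
move=> /(whp_forall); rewrite size_enum_ord; apply: whpW => // w H r.
by apply: H; rewrite mem_enum.
Qed.

End fixed_vector.

(** This controls the exceptionally long sampling vectors in [mean_inten_sq_le]. The failure
    probability decays because [4 < e^2]. *)
Lemma whp_exp_sqnorm : whp P (32 * 4 ^+ n * expR (- (2 * n%:R)))
  (fun w => mean (fun r => 32 * expR (sqnorm (a r w) / 2 - 2 * n%:R)) < 1).
Proof.
pose f r (w : T) := expR (sqnorm (a r w) / 2).
have mf r : measurable_fun setT (f r).
  apply: measurableT_comp => //; apply: measurable_funM => //.
  by apply: measurable_sum => k; apply: measurable_funX; exact: mX.
have f0 r w : 0 <= f r w by exact: expR_ge0.
have ms : measurable_fun setT (fun w => \sum_r f r w) by apply: measurable_sum.
have s0 w : 0 <= \sum_r f r w by apply: sumr_ge0.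
have mi : 0 <= m%:R^-1 :> R by rewrite invr_ge0.
have Es : (Ex P (fun w => mean (fun r => f r w)) <= (4 ^+ n)%:E)%E.
  rewrite ExZ// Ex_sum//.
  apply: (@le_trans _ _ ((m%:R^-1)%:E * (m%:R * 4 ^+ n)%:E)%E).
    rewrite lee_pmul ?lee_fin//; first by apply: sume_ge0 => r _; exact: Ex_ge0.
    apply: (@le_trans _ _ (\sum_(r < m) (4 ^+ n)%:E)%E).
      by apply: lee_sum => r _; exact: Ex_exp_sqnorm.
    by rewrite sumEFin sumr_const card_ord mulr_natl.
  by rewrite -EFinM mulKf// pnatr_eq0 -lt0n.
have := @whp_markov _ _ _ P _ (expR (2 * n%:R) / 32) (32 * 4 ^+ n * expR (- (2 * n%:R)))
   (measurable_funM (measurable_cst _) ms) (fun w => mulr_ge0 mi (s0 w)).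
rewrite (_ : expR (2 * n%:R) / 32 * (32 * 4 ^+ n * expR (- (2 * n%:R))) = 4 ^+ n); last first.
  by rewrite expRN; field; rewrite gt_eqF// expR_gt0.
have e0 : 0 < expR (2 * n%:R) / 32 :> R by rewrite divr_gt0 ?expR_gt0.
move=> /(_ e0 Es); apply: whpW => // w.
rewrite ltr_pdivlMr// => h.
under eq_bigr do rewrite expRD mulrA.
rewrite -mulr_suml -mulr_sumr expRN mulrA ltr_pdivrMr ?expR_gt0// mul1r.
by move: h; rewrite mulrCA mulrC.
Qed.

End sample_concentration.

(** * A lattice net of the ball and its cardinality *)

Section lattice.
Context (R : realType) (K : finType).
Hypothesis K0 : (0 < #|K|)%N.
Implicit Types u v h c : K -> R.

(* Rounding to a multiple of [mesh] in each coordinate moves a vector by at most 1/4. *)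
Definition mesh : R := (4 * Num.sqrt #|K|%:R)^-1.

Definition lattice v : Prop := exists z : K -> int, forall k, v k = mesh * (z k)%:~R.

Lemma card_gt0R : 0 < #|K|%:R :> R.
Proof. by rewrite ltr0n. Qed.

Lemma mesh_gt0 : 0 < mesh.
Proof. by rewrite invr_gt0 mulr_gt0// sqrtr_gt0 card_gt0R. Qed.

Lemma mesh_sq : mesh ^+ 2 * #|K|%:R = 1 / 16.
Proof.
have N0 := card_gt0R; rewrite exprVn exprMn sqr_sqrtr ?ler0n//.
by field; rewrite gt_eqF.
Qed.

Lemma latticeD u v : lattice u -> lattice v -> lattice (fun k => u k + v k).
Proof.
by move=> [y uy] [z vz]; exists (fun k => y k + z k) => k; rewrite uy vz intrD mulrDr.
Qed.

Lemma latticeB u v : lattice u -> lattice v -> lattice (fun k => u k - v k).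
Proof.
by move=> [y uy] [z vz]; exists (fun k => y k - z k) => k; rewrite uy vz intrB mulrBr.
Qed.

(** Each coordinate is rounded up or down according to the sign of [c k]. A convex function does not
    decrease when the rounding follows its subgradient, so passing to the lattice costs no
    approximation error. *)
Lemma lattice_rounding h c : exists p, [/\ lattice p,
  dot h c <= dot p c & sqnorm (fun k => p k - h k) <= 1 / 16].
Proof.
have t0 := mesh_gt0.
pose z k := if c k <= 0 then Num.floor (h k / mesh) else Num.floor (h k / mesh) + 1.
exists (fun k => mesh * (z k)%:~R); split; first by exists z.
- apply: ler_sum => k _; rewrite /z.
  have /andP[f1 f2] := floor_itv (h k / mesh).
  rewrite ler_pdivlMr// mulrC in f1; rewrite ltr_pdivrMr// mulrC in f2.
  case: ifPn => ck; first by rewrite ler_wnM2r.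
  by rewrite ler_wpM2r// ltW// ltNge.
- have -> : 1 / 16 = \sum_(k : K) mesh ^+ 2 by rewrite sumr_const -[RHS]mulr_natr mesh_sq.
  apply: ler_sum => k _; have /andP[f1 f2] := floor_itv (h k / mesh).
  rewrite ler_pdivlMr// mulrC in f1; rewrite ltr_pdivrMr// mulrC intrD mulrDr mulr1 in f2.
  rewrite -[leLHS]real_normK ?num_real// ler_pXn2r ?nnegrE ?(ltW t0)// ler_norml /z.
  by apply/andP; split; case: ifPn => _; rewrite ?intrD ?mulrDr ?mulr1; lra.
Qed.

Lemma sqnorm_perturb h p (s : R) : 0 < s ->
  sqnorm p <= (1 + s) * sqnorm h + (1 + s^-1) * sqnorm (fun k => p k - h k).
Proof.
move=> s0; rewrite /sqnorm !mulr_sumr -big_split; apply: ler_sum => k _ /=.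
move: (h k) (p k) => x y.
have : 0 <= s^-1 * (s * x - (y - x)) ^+ 2 by rewrite mulr_ge0 ?sqr_ge0// invr_ge0 ltW.
have -> : s^-1 * (s * x - (y - x)) ^+ 2 = s * x ^+ 2 - 2 * x * (y - x) + s^-1 * (y - x) ^+ 2.
  by field; rewrite gt_eqF.
nra.
Qed.

Local Notation bnd := (32 * #|K|)%N.
Local Notation code := {ffun K -> bool * 'I_bnd.+1}.

Definition decode (f : code) : K -> R :=
  fun k => mesh * ((-1) ^+ (f k).1 * (f k).2%:R).

(** As [mesh^2 = 1 / (16 #|K|)], squared norm at most 2 means that the squares of the integer
    coordinates sum to at most [32 #|K|]. A zero coordinate has two codes, which is harmless in a
    union bound. *)
Definition codes : seq code :=
  [seq f : code <- enum {: code} | (\sum_k (f k).2 ^ 2 <= bnd)%N].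

Lemma sqnorm_decode (f : code) :
  sqnorm (decode f) = mesh ^+ 2 * (\sum_k (f k).2 ^ 2)%N%:R.
Proof.
rewrite /sqnorm natr_sum mulr_sumr; apply: eq_bigr => k _.
by rewrite /decode exprMn exprMn sqrr_sign mul1r natrX.
Qed.

Lemma codes_sqnorm f : f \in codes -> sqnorm (decode f) <= 2.
Proof.
rewrite mem_filter => /andP[fs _]; rewrite sqnorm_decode.
have t0 := mesh_gt0.
apply: (@le_trans _ _ (mesh ^+ 2 * bnd%:R)).
  by rewrite ler_pM2l ?exprn_gt0// ler_nat.
by rewrite natrM mulrCA mesh_sq; lra.
Qed.

Lemma lattice_decode v : lattice v -> sqnorm v <= 2 ->
  exists2 f, f \in codes & v = decode f.
Proof.
move=> [z vz] v2; have t0 := mesh_gt0.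
have zS : (\sum_k `|z k| ^ 2 <= bnd)%N.
  have : mesh ^+ 2 * (\sum_k `|z k| ^ 2)%N%:R <= mesh ^+ 2 * bnd%:R.
    rewrite natrM (mulrCA (mesh ^+ 2)) mesh_sq.
    have -> : mesh ^+ 2 * (\sum_k `|z k| ^ 2)%N%:R = sqnorm v.
      rewrite /sqnorm natr_sum mulr_sumr; apply: eq_bigr => k _.
      rewrite vz exprMn natrX; congr (_ * _).
      by rewrite natr_absz intr_norm real_normK ?num_real.
    by apply: le_trans v2 _; lra.
  by rewrite ler_pM2l ?exprn_gt0// ler_nat.
have zle k : (`|z k| < bnd.+1)%N.
  rewrite ltnS; apply: leq_trans zS; rewrite (bigD1 k)//=.
  apply: leq_trans (leq_addr _ _); case: (`|z k|)%N => // j.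
  by rewrite expnS leq_pmulr.
exists [ffun k => (z k < 0, Ordinal (zle k))].
  rewrite mem_filter mem_enum andbT; apply: leq_trans zS.
  by apply: eq_leq; apply: eq_bigr => k _; rewrite ffunE.
apply/funext => k; rewrite vz /decode ffunE/=; congr (_ * _).
by rewrite {1}[z k]intEsign intrM -pmulrn; case: (z k < 0); rewrite /= ?expr0 ?expr1 ?intr1 ?mulrN1z.
Qed.

(** Counting each coordinate separately would give an exponent of order [N log N] for [N = #|K|].
    Instead each code gets the weight [2^(32 N)] times the product of the [2^(-|z_k|)]. It is at
    least 1, since [|z_k| <= z_k^2], and the sum over all codes factors into at most
    [2^(32 N) 4^N]. *)
Lemma size_codes : (size codes)%:R <= 2 ^+ (34 * #|K|) :> R.
Proof.
pose g (x : bool * 'I_bnd.+1) : R := 2^-1 ^+ x.2.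
have S4 : \sum_x g x <= 4.
  rewrite /g sum_pair big_bool/=.
  have : \sum_(j < bnd.+1) 2^-1 ^+ j <= 2 :> R.
    suff /(_ bnd.+1) : forall N, \sum_(j < N) 2^-1 ^+ j <= 2 - 2 * 2^-1 ^+ N :> R.
      move=> h; apply: le_trans h _; rewrite gerBl mulr_ge0// exprn_ge0//.
    elim=> [|N ih]; first by rewrite big_ord0 expr0; lra.
    by rewrite big_ord_recr/= exprS; lra.
  lra.
have pg (f : code) : 0 <= \prod_k g (f k).
  by apply: prodr_ge0 => k _; rewrite exprn_ge0.
have -> : (size codes)%:R = \sum_(f <- codes) 1 :> R.
  by rewrite big_const_seq count_predT iter_addr addr0.
apply: (@le_trans _ _ (\sum_(f <- codes) 2 ^+ bnd * \prod_k g (f k))).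
  rewrite big_seq [leRHS]big_seq; apply: ler_sum => f.
  rewrite mem_filter => /andP[fs _].
  have gE : \prod_k g (f k) = 2^-1 ^+ (\sum_k (f k).2) by rewrite /g prodrXr.
  have fle : (\sum_k (f k).2 <= bnd)%N.
    apply: leq_trans fs; apply: leq_sum => k _.
    by case: (nat_of_ord _) => // j; rewrite expnS leq_pmulr.
  rewrite gE; apply: (@le_trans _ _ (2 ^+ bnd * 2^-1 ^+ bnd)).
    by rewrite -exprMn divff// expr1n.
  by rewrite ler_wpM2l ?exprn_ge0// ler_wiXn2l//; lra.
apply: (@le_trans _ _ (\sum_(f : code) 2 ^+ bnd * \prod_k g (f k))).
  rewrite big_filter big_enum_cond big_mkcond/=; apply: ler_sum => f _.
  by case: ifP => // _; rewrite mulr_ge0// exprn_ge0.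
rewrite -mulr_sumr -(bigA_distr_bigA (fun (_ : K) x => g x))/=.
rewrite prodr_const (mulnDl 32 2) exprD ler_wpM2l ?exprn_ge0// exprM.
rewrite (_ : 2 ^+ 2 = 4); last by ring.
rewrite ler_pXn2r ?nnegrE//.
by apply: sumr_ge0 => x _; rewrite exprn_ge0.
Qed.

End lattice.

(** * Quadratic forms controlled on the lattice *)

Section linear_functionals.
Context (R : realType) (K : finType).
Implicit Types l : (K -> R) -> R.

Definition islin l : Prop := exists c, forall u, l u = dot u c.

Lemma islinZ s l : islin l -> islin (fun u => s * l u).
Proof. by move=> [c lc]; exists (fun k => s * c k) => u; rewrite lc dotZr. Qed.

Lemma islin_sum (J : finType) (L : J -> (K -> R) -> R) :
  (forall j, islin (L j)) -> islin (fun u => \sum_j L j u).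
Proof.
move=> HL; elim: (index_enum J) => [|j s [c ih]].
  exists (fun=> 0) => u; rewrite big_nil /dot big1// => k _; exact: mulr0.
have [c' lc'] := HL j; exists (fun k => c' k + c k) => u.
by rewrite big_cons lc' ih dotDr.
Qed.

Section symmetric_form.
Variable b : (K -> R) -> (K -> R) -> R.
Hypothesis bC : forall u v, b u v = b v u.
Hypothesis blin : forall v, islin (fun u => b u v).
Hypothesis K0 : (0 < #|K|)%N.

Let bD u u' v : b (fun k => u k + u' k) v = b u v + b u' v.
Proof. by have [c bc] := blin v; rewrite !bc dotDl. Qed.

Let bZ s u v : b (fun k => s * u k) v = s * b u v.
Proof. by have [c bc] := blin v; rewrite !bc dotZl. Qed.

Let bN u v : b (fun k => - u k) v = - b u v.
Proof. by have [c bc] := blin v; rewrite !bc dotNl. Qed.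

Let rounding_small (h p : K -> R) : sqnorm h <= 1 / 16 ->
  sqnorm (fun k => p k - h k) <= 1 / 16 -> sqnorm p <= 1 / 4.
Proof. by move=> h1 p1; have := sqnorm_perturb h p ltr01; rewrite invr1; lra. Qed.

(** Polarization gives [b p q <= eta / 2] for lattice points of squared norm at most 1/4, as [p + q]
    and [p - q] are again lattice points. A bilinear form may be rounded upwards in one argument and
    then in the other, so the bound extends to all vectors of squared norm at most 1/16. Homogeneity
    then produces the factor [16 / 2 = 8]. *)
Lemma form_bound (eta : R) :
  (forall v, lattice v -> sqnorm v <= 2 -> `|b v v| <= eta) ->
  forall h, `|b h h| <= 8 * eta * sqnorm h.
Proof.
move=> H.
have polar p q : lattice p -> lattice q -> sqnorm p <= 1 / 4 -> sqnorm q <= 1 / 4 ->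
    b p q <= eta / 2.
  move=> lp lq p4 q4.
  have par : sqnorm (fun k => p k + q k) + sqnorm (fun k => p k - q k) =
      2 * sqnorm p + 2 * sqnorm q by rewrite sqnormB sqnormD; ring.
  have := sqnorm_ge0 (fun k => p k + q k); have := sqnorm_ge0 (fun k => p k - q k).
  move=> n1 n2.
  have := H _ (latticeD lp lq); have := H _ (latticeB lp lq).
  rewrite !bD !bN ![b _ (fun k => p k + q k)]bC ![b _ (fun k => p k - q k)]bC !bD !bN.
  rewrite (bC q p) !ler_norml => h1 h2.
  have /andP[_ h2'] : - eta <= b p p + b p q + (b p q + b q q) <= eta by apply: h2; lra.
  have /andP[h1' _] : - eta <= b p p - b p q - (b p q - b q q) <= eta by apply: h1; lra.
  lra.
have small u v : sqnorm u <= 1 / 16 -> sqnorm v <= 1 / 16 -> b u v <= eta / 2.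
  move=> u1 v1; have [c bc] := blin v.
  have [p [lp hp pu]] := lattice_rounding K0 u c.
  have [c' bc'] := blin p.
  have [q [lq hq qv]] := lattice_rounding K0 v c'.
  have := polar q p lq lp (rounding_small v1 qv) (rounding_small u1 pu).
  rewrite -!bc -!bc' in hp hq; rewrite (bC p v) in hp; lra.
move=> h; have [h0|h0] := eqVneq (sqnorm h) 0.
  have hk k : h k = 0.
    by apply/eqP; rewrite -sqrf_eq0; move/eqP: h0; rewrite psumr_eq0 => [/allP/(_ k)|i _];
      [rewrite mem_index_enum => /(_ isT)|exact: sqr_ge0].
  have [c bc] := blin h; rewrite bc h0 mulr0 /dot big1 ?normr0// => k _.
  by rewrite hk mul0r.
have {}h0 : 0 < sqnorm h by rewrite lt_neqAle eq_sym h0 sqnorm_ge0.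
pose s := Num.sqrt (16 * sqnorm h)^-1.
have s2 : s ^+ 2 * sqnorm h = 1 / 16.
  rewrite sqr_sqrtr ?invr_ge0 ?mulr_ge0 ?(ltW h0)//.
  by field; rewrite gt_eqF.
have s0 : 0 < s ^+ 2 by rewrite sqr_sqrtr ?invr_gt0 ?invr_ge0 ?mulr_ge0 ?mulr_gt0 ?(ltW h0).
have sh : sqnorm (fun k => s * h k) <= 1 / 16 by rewrite sqnormZ s2.
have shN : sqnorm (fun k => - s * h k) <= 1 / 16 by rewrite sqnormZ sqrrN s2.
have := small _ _ sh sh; have := small _ _ shN sh.
rewrite !bZ ![b h _]bC !bZ !mulrA !mulNr -expr2 => b1 b2.
rewrite -(ler_pM2l s0).
have -> : s ^+ 2 * (8 * eta * sqnorm h) = 8 * eta * (s ^+ 2 * sqnorm h) by ring.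
rewrite -{1}(gtr0_norm s0) -normrM s2 ler_norml; apply/andP; split; lra.
Qed.

End symmetric_form.

End linear_functionals.

(** * Union bound over the lattice *)

Section lattice_union_bound.
Context (R : realType) (d : measure_display) (T : measurableType d) (P : probability T R).
Context (K : finType).
Hypothesis K0 : (0 < #|K|)%N.

Lemma whp_lattice (Q : (K -> R) -> T -> Prop) (e : R) : 0 <= e ->
  (forall v, sqnorm v <= 2 -> whp P e (Q v)) ->
  whp P (2 ^+ (34 * #|K|) * e)
    (fun w => forall v, lattice v -> sqnorm v <= 2 -> Q v w).
Proof.
move=> e0 HQ.
have := @whp_forall _ _ _ P _ (codes K) e (fun f => Q (decode R f))
  (fun f fc => HQ _ (@codes_sqnorm R K K0 f fc)).
apply: whpW; first by rewrite ler_wpM2r// size_codes.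
by move=> w H v lv v2; have [f fc ->] := lattice_decode K0 lv v2; exact: H.
Qed.

End lattice_union_bound.

(** * Concentration uniform over all vectors *)

Section uniform_concentration.
Context (R : realType) (d : measure_display) (T : measurableType d) (P : probability T R).
Context (n m : nat).
Local Notation K := ('I_n * bool)%type.
Context (X : 'I_m * 'I_n * bool -> T -> R).
Hypothesis mX : forall i, measurable_fun setT (X i).
Hypothesis iX : mutually_independent P X.
Hypothesis gX : forall i (B : set R), measurable B ->
  P (X i @^-1` B) = normal_prob 0 (Num.sqrt (2^-1)) B.
Hypotheses (n0 : (0 < n)%N) (m0 : (0 < m)%N).

Local Notation a := (sample X).
Local Notation mean F := (m%:R^-1 * \sum_(r < m) F r).

Let K0 : (0 < #|{: K}|)%N.
Proof. by rewrite card_prod card_ord card_bool muln_gt0 n0. Qed.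

Lemma islin_cross (b x : K -> R) : islin (fun u => cross b x u).
Proof.
exists (fun k => dot x b * b k - dot (rot x) b * rot b k) => u.
by rewrite dotDr dotNr !dotZr /cross (dot_rotl u); ring.
Qed.

Variables (lam delta : R).
Hypotheses (lam0 : 0 < lam) (delta0 : 0 < delta) (lam4 : 2 * mom R 4 * lam <= delta).
Let eps : R := expR (- (m%:R * (lam * delta / 2))).
Let M : R := 2 ^+ (68 * n).

Let cardE : (34 * #|{: K}| = 68 * n)%N.
Proof. by rewrite card_prod card_ord card_bool (mulnC n) mulnA. Qed.

Lemma whp_trunc_cross_unif (x : K -> R) (B : R) : sqnorm x = 1 -> 1 <= B ->
  32 * lam * B <= 1 -> mom R 3 / B <= delta ->
  whp P (M * (eps + eps)) (fun w => forall h,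
    `|mean (fun r => trunc_cross B x h (a r w)) - cross_mean x h| <= 16 * delta * sqnorm h).
Proof.
move=> x1 B1 lamB B3.
have x2 : sqnorm x <= 2 by rewrite x1; lra.
have := @whp_lattice _ _ _ P {: K} K0 (fun h w =>
  `|mean (fun r => trunc_cross B x h (a r w)) - cross_mean x h| <= 2 * delta) (eps + eps).
rewrite cardE => /(_ (addr_ge0 (expR_ge0 _) (expR_ge0 _))).
move=> /(_ (fun v v2 => whp_trunc_cross mX iX gX m0 x2 v2 lam0 lam4 B1 lamB B3)).
apply: whpW => // w H h.
pose ind r : R := if inten (a r w) x <= B then 1 else 0.
(* The deviation is the diagonal of a symmetric bilinear form, to which [form_bound] applies with
   [eta = 2 delta]. *)
pose b u v := mean (fun r => ind r * (cross (a r w) x u * cross (a r w) x v)) -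
  (dot u v + 3 * (dot x u * dot x v) - dot x (rot u) * dot x (rot v)) / 2.
have bE v : b v v = mean (fun r => trunc_cross B x v (a r w)) - cross_mean x v.
  rewrite /b /cross_mean x1 mul1r -sqnormE -!expr2; congr (_ * _ - _).
  apply: eq_bigr => r _; rewrite /ind /trunc_cross -expr2.
  by case: ifP => _; rewrite ?mul1r ?mul0r.
rewrite -bE (_ : 16 * delta = 8 * (2 * delta)); last by ring.
apply: form_bound => // [u v|v|v lv v2].
- rewrite /b (dotC u); congr (_ * _ - _); last by field.
  by apply: eq_bigr => r _; rewrite [X in _ * X]mulrC.
- have [c1 h1] : islin (fun u => mean (fun r => ind r * (cross (a r w) x u * cross (a r w) x v))).
    apply: islinZ; apply: islin_sum => r.
    have [c hc] := islinZ (ind r * cross (a r w) x v) (islin_cross (a r w) x).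
    by exists c => u; rewrite -hc; ring.
  exists (fun k => c1 k + (- 2^-1 * v k + (- (3 / 2 * dot x v) * x k +
    - (dot x (rot v) / 2) * rot x k))) => u.
  rewrite /b h1 !dotDr !dotZr; congr (_ + _).
  by rewrite (dotC x u) (dotC x (rot u)) dot_rotl; field.
- by rewrite bE; exact: H.
Qed.

Lemma whp_huber_unif k : 0 <= k -> 64 * lam * k <= 1 ->
  whp P (M * eps) (fun w => forall h, sqnorm h <= 1 ->
    mean (fun r => huber k (inten (a r w) h)) <= 5 + delta).
Proof.
move=> k0 lamk.
have := @whp_lattice _ _ _ P {: K} K0 (fun h w =>
  mean (fun r => huber k (inten (a r w) h)) < 2 * sqnorm h ^+ 2 + delta) eps.
rewrite cardE => /(_ (expR_ge0 _)).
move=> /(_ (fun v v2 => whp_huber mX iX gX m0 v2 lam0 k0 lam4 lamk)).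
apply: whpW => // w H h h1.
have sup r := cid2 (huber_support k0 (inten_ge0 (a r w) h)).
pose c r := s2val (sup r).
(* Up to a positive factor this is a subgradient at [h] of the convex function to be bounded;
   rounding along it yields a lattice point [p] where the function is at least as large. *)
have [C hC] : islin (fun u => \sum_r c r * cross (a r w) h u).
  by apply: islin_sum => r; apply: islinZ; exact: islin_cross.
have [p [lp hp ph]] := lattice_rounding K0 h C.
(* [(1 + 1/4) + (1 + 4) / 16 = 25/16], and [2 (25/16)^2 < 5]. *)
have p54 : sqnorm p <= 25 / 16.
  have := @sqnorm_perturb _ _ h p (1 / 4); have -> : (1 / 4)^-1 = 4 :> R by field.
  by move=> /(_ (divr_gt0 ltr01 _)); lra.
have Hp := H p lp; rewrite -!hC in hp.
have : mean (fun r => huber k (inten (a r w) h)) <= mean (fun r => huber k (inten (a r w) p)).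
  rewrite ler_pM2l ?invr_gt0 ?ltr0n//.
  apply: (@le_trans _ _ (\sum_r (huber k (inten (a r w) h) +
     2 * (c r * cross (a r w) h p - c r * cross (a r w) h h)))).
    by rewrite big_split/= -mulr_sumr sumrB; lra.
  apply: ler_sum => r _; rewrite /c; case: (sup r) => /= cr cr0 hr.
  apply: le_trans (hr _ (inten_ge0 _ p)); rewrite lerD2l -mulrBr mulrCA.
  apply: ler_wpM2l => //.
  by have := inten_ge0 (a r w) (fun k => p k - h k); rewrite intenB crossC crossxx; lra.
have : 2 * sqnorm p ^+ 2 <= 5.
  have := sqnorm_ge0 p; nra.
have : mean (fun r => huber k (inten (a r w) p)) < 2 * sqnorm p ^+ 2 + delta.
  by apply: Hp; lra.
lra.
Qed.

End uniform_concentration.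

(** * Cauchy-Schwarz and normalization of vectors *)

Section cauchy_schwarz.
Context (R : realType) (J : finType).
Implicit Types u v : J -> R.

(** Lagrange's identity: the double sum below is twice the defect. *)
Lemma dot_sq_le u v : dot u v ^+ 2 <= sqnorm u * sqnorm v.
Proof.
have : 0 <= \sum_i \sum_j (u i * v j - u j * v i) ^+ 2.
  by apply: sumr_ge0 => i _; apply: sumr_ge0 => j _; exact: sqr_ge0.
have -> : \sum_i \sum_j (u i * v j - u j * v i) ^+ 2 =
    sqnorm u * sqnorm v - 2 * dot u v ^+ 2 + sqnorm v * sqnorm u.
  rewrite {1 2}/sqnorm !mulr_suml expr2 {1}/dot mulr_suml mulr_sumr -sumrB -big_split/=.
  apply: eq_bigr => i _; rewrite /sqnorm /dot !mulr_sumr -sumrB -big_split/=.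
  by apply: eq_bigr => j _; ring.
rewrite (mulrC (sqnorm v)); lra.
Qed.

Lemma polar_decomp u : exists s v, [/\ 0 <= s, sqnorm v <= 1,
  s ^+ 2 = sqnorm u & u = (fun k => s * v k)].
Proof.
have [u0|u0] := eqVneq (sqnorm u) 0.
  exists 0, (fun=> 0); split => //.
  - by rewrite /sqnorm big1// => k _; rewrite expr0n.
  - by rewrite u0 expr0n.
  - apply/funext => k; rewrite mul0r; apply/eqP; rewrite -sqrf_eq0; move/eqP: u0.
    rewrite psumr_eq0 => [/allP/(_ k)|i _]; last exact: sqr_ge0.
    by rewrite mem_index_enum => /(_ isT).
have {}u0 : 0 < sqnorm u by rewrite lt_neqAle eq_sym u0 sqnorm_ge0.
have s0 : 0 < Num.sqrt (sqnorm u) by rewrite sqrtr_gt0.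
exists (Num.sqrt (sqnorm u)), (fun k => (Num.sqrt (sqnorm u))^-1 * u k); split.
- exact: ltW.
- by rewrite sqnormZ exprVn sqr_sqrtr ?(ltW u0)// mulVf// gt_eqF.
- by rewrite sqr_sqrtr ?(ltW u0).
- by apply/funext => k; rewrite mulrA divff ?mul1r// gt_eqF.
Qed.

End cauchy_schwarz.

(** * Overlap and contraction for a fixed sample *)

Section deterministic.
Context (R : realType) (n m : nat).
Hypotheses (n0 : (0 < n)%N) (m0 : (0 < m)%N).
Local Notation K := ('I_n * bool)%type.
Variables (a : 'I_m -> K -> R) (x : K -> R).
Hypothesis x1 : sqnorm x = 1.
Local Notation mean F := (m%:R^-1 * \sum_(r < m) F r).

Lemma mean_le (F G : 'I_m -> R) : (forall r, F r <= G r) -> mean F <= mean G.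
Proof. by move=> FG; rewrite ler_pM2l ?invr_gt0 ?ltr0n//; apply: ler_sum. Qed.

Lemma mean_ge0 (F : 'I_m -> R) : (forall r, 0 <= F r) -> 0 <= mean F.
Proof. by move=> F0; rewrite mulr_ge0// sumr_ge0. Qed.

Lemma meanD (F G : 'I_m -> R) : mean (fun r => F r + G r) = mean F + mean G.
Proof. by rewrite big_split mulrDr. Qed.

Lemma meanZ (c : R) (F : 'I_m -> R) : mean (fun r => c * F r) = c * mean F.
Proof. by rewrite -mulr_sumr mulrCA. Qed.

Lemma mean_cst (c : R) : mean (fun=> c) = c.
Proof. by rewrite sumr_const card_ord -[c *+ m]mulr_natl mulKf// pnatr_eq0 -lt0n. Qed.

Lemma mean_cauchy_schwarz (F G : 'I_m -> R) :
  mean (fun r => F r * G r) ^+ 2 <= mean (fun r => F r ^+ 2) * mean (fun r => G r ^+ 2).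
Proof.
rewrite exprMn [leRHS]mulrACA -[m%:R^-1 * m%:R^-1]expr2 ler_wpM2l ?sqr_ge0//; exact: dot_sq_le.
Qed.

Definition isometric (delta : R) : Prop := forall h,
  `|mean (fun r => cross (a r) x h ^+ 2) - cross_mean x h| <= delta * sqnorm h.

Lemma cross_mean_le h : cross_mean x h <= 2 * sqnorm h.
Proof.
rewrite /cross_mean x1; have := dot_sq_le x h; have := sqr_ge0 (dot x (rot h)).
rewrite x1; lra.
Qed.

Lemma isometric_inten delta h : isometric delta ->
  mean (fun r => inten (a r) x * inten (a r) h) <=
  (1 + 2 * delta) * sqnorm h + dot x h ^+ 2 + dot x (rot h) ^+ 2.
Proof.
move=> iso; have := iso h; have := iso (rot h); rewrite !ler_norml => /andP[_ i1] /andP[_ i2].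
have -> : mean (fun r => inten (a r) x * inten (a r) h) =
    mean (fun r => cross (a r) x h ^+ 2) + mean (fun r => cross (a r) x (rot h) ^+ 2).
  by rewrite -meanD; congr (_ * _); apply: eq_bigr => r _; rewrite cross_sqD.
move: i1 i2; rewrite /cross_mean sqnorm_rot x1 rotK dotNr sqrrN; lra.
Qed.

(** The left mean is at least [2 - delta], while [isometric_inten] bounds the right one by
    [1 + 2 delta] plus the squared overlap. *)
Lemma leading_overlap delta v : isometric delta -> sqnorm v = 1 ->
  mean (fun r => inten (a r) x ^+ 2) <= mean (fun r => inten (a r) x * inten (a r) v) ->
  1 - 3 * delta <= dot x v ^+ 2 + dot x (rot v) ^+ 2.
Proof.
move=> iso v1 le; have := isometric_inten v iso; rewrite v1.
have := iso x; rewrite ler_norml => /andP[+ _].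
under eq_bigr do rewrite crossxx.
rewrite /cross_mean x1 dot_rot_self -sqnormE x1; lra.
Qed.

Variables (L k : R).
Hypotheses (L0 : 0 < L) (k1 : 1 <= k) (Lk : 100 * L <= k).
Hypothesis iso : isometric (1 / 1000).
Hypothesis isoL : forall h,
  `|mean (fun r => trunc_cross L x h (a r)) - cross_mean x h| <= 1 / 1000 * sqnorm h.
Hypothesis hub : forall h, sqnorm h <= 1 ->
  mean (fun r => huber k (inten (a r) h)) <= 6.
Hypothesis norms : mean (fun r => 32 * expR (sqnorm (a r) / 2 - 2 * n%:R)) < 1.

Let k0 : 0 <= k. Proof. exact: le_trans k1. Qed.
Let n1 : 1 <= n%:R :> R. Proof. by rewrite ler1n. Qed.

Lemma mean_inten_le h : sqnorm h <= 1 -> mean (fun r => inten (a r) h) <= 7.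
Proof.
move=> h1; apply: (@le_trans _ _ (mean (fun r => 1 + huber k (inten (a r) h)))).
  by apply: mean_le => r; exact: le_1_huber.
by rewrite meanD mean_cst; have := hub h1; lra.
Qed.

(** Values up to [16 n] are bounded by [16 n] times the first power. A larger value forces
    [|a_r|^2 > 8 n], hence [|a_r|^2 / 4 <= |a_r|^2 / 2 - 2 n], and the exponential in [norms]
    dominates the square. *)
Lemma mean_inten_sq_le h : sqnorm h <= 1 ->
  mean (fun r => inten (a r) h ^+ 2) <= 116 * n%:R.
Proof.
move=> h1; have h7 := mean_inten_le h1.
pose e r := 32 * expR (sqnorm (a r) / 2 - 2 * n%:R).
apply: (@le_trans _ _ (mean (fun r => 16 * n%:R * inten (a r) h + 4 * e r))).
  apply: mean_le => r; rewrite /e.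
  have A0 := inten_ge0 (a r) h.
  have Aa : inten (a r) h <= 2 * sqnorm (a r).
    have := dot_sq_le h (a r); have := dot_sq_le (rot h) (a r); rewrite sqnorm_rot.
    have := sqnorm_ge0 (a r); have := sqnorm_ge0 h; rewrite /inten; nra.
  have e0 := expR_gt0 (sqnorm (a r) / 2 - 2 * n%:R).
  have [An|An] := leP (inten (a r) h) (16 * n%:R); first by rewrite expr2; nra.
  have := exprn_le_expR_scaled 2 A0 (ltr0n R 8).
  have : expR (inten (a r) h / 8) <= expR (sqnorm (a r) / 2 - 2 * n%:R).
    by rewrite ler_expR; lra.
  have nA : 0 <= 16 * n%:R * inten (a r) h by rewrite !mulr_ge0.
  rewrite (_ : 2`! = 2)%N//; lra.
rewrite meanD !meanZ; have := norms; rewrite meanZ => ne.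
have : 16 * n%:R * mean (fun r => inten (a r) h) <= 16 * n%:R * 7.
  by rewrite ler_pM2l// mulr_gt0// ltr0n.
have n1' := n1.
lra.
Qed.

(** This supplies the factor [n] in the bound on the gradient. It comes from the fourth powers of
    [a^* h] and [a^* u]; the products with [|a^* x|^2] contribute a constant only. *)
Lemma mean_inten_inten_le h g : sqnorm h <= 1 ->
  mean (fun r => inten (a r) (fun j => x j + h j) * inten (a r) g) <= 240 * n%:R * sqnorm g.
Proof.
move=> h1; have [s [u [s0 u1 s2 gE]]] := polar_decomp g.
rewrite -s2 gE.
have -> : mean (fun r => inten (a r) (fun j => x j + h j) * inten (a r) (fun j => s * u j)) =
    s ^+ 2 * mean (fun r => inten (a r) (fun j => x j + h j) * inten (a r) u).
  by rewrite -meanZ; congr (_ * _); apply: eq_bigr => r _; rewrite intenZ mulrCA.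
rewrite mulrC ler_wpM2r ?sqr_ge0//.
have su0 := sqnorm_ge0 u; have n1' := n1.
apply: (@le_trans _ _ (mean (fun r => 2 * (inten (a r) x * inten (a r) u) +
    (inten (a r) h ^+ 2 + inten (a r) u ^+ 2)))).
  apply: mean_le => r.
  have -> : inten (a r) (fun j => x j + h j) =
      2 * inten (a r) x + 2 * inten (a r) h - inten (a r) (fun j => x j - h j).
    by rewrite intenD intenB; ring.
  have := inten_ge0 (a r) (fun j => x j - h j); have := inten_ge0 (a r) u.
  have := sqr_ge0 (inten (a r) h - inten (a r) u); nra.
rewrite !meanD meanZ.
have := mean_inten_sq_le h1; have := mean_inten_sq_le u1.
have := isometric_inten u iso.
have := dot_sq_le x u; have := dot_sq_le x (rot u); rewrite sqnorm_rot x1.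
lra.
Qed.

(* For [t = Re((a^* x)^bar (a^* h))], [w = |a^* h|^2] and [A = |a^* x|^2], the
   right-hand side is the contribution of [a] to [Re <h, grad f (x + h)>]. It is
   negative only when [w] is of the order of [|t|], hence bounded by [huber]
   unless [A > L]. *)
Lemma sample_lower_bound (A t w s2 : R) : 0 <= A -> 0 <= w -> 0 < s2 -> t ^+ 2 <= A * w ->
  let tau := if A <= L then t ^+ 2 else 0 in
  tau - (t ^+ 2 - tau) / 2 - (27 / 20 * s2 ^+ 2 + 3 / 2 * (L / k) * s2) * huber k (w / s2)
    + w ^+ 2 / 10 <= 2 * t ^+ 2 + 3 * t * w + w ^+ 2.
Proof.
move=> A0 w0 s20 tAw /=; set z := w / s2.
have kp : 0 < k by exact: lt_le_trans k1.
have z0 : 0 <= z by rewrite divr_ge0// ltW.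
have ws : w = s2 * z by rewrite /z; field; rewrite gt_eqF.
have H0 := huber_ge0 z k0.
have Lk0 : 0 <= L / k by rewrite divr_ge0// ltW.
have g1 : 0 <= 27 / 20 * s2 ^+ 2 * huber k z by rewrite mulr_ge0// mulr_ge0// sqr_ge0.
have g2 : 0 <= 3 / 2 * (L / k) * s2 * huber k z.
  by rewrite mulr_ge0// mulr_ge0 ?(ltW s20)// mulr_ge0.
(* These squares fix the constants: [9/4 = 1 + 27/20 - 1/10] where [huber] is quadratic, and [(5 t +
   3 w)^2 / 10 = 5/2 t^2 + 3 t w + 9/10 w^2] in the two other cases. *)
have q1 := sqr_ge0 (t + 3 / 2 * w); have q2 := sqr_ge0 (5 * t + 3 * w).
case: ifPn => [AL|_]; last by nra.
have [zk|zk] := leP z k.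
  have -> : huber k z = z ^+ 2 by rewrite /huber zk.
  have e : s2 ^+ 2 * z ^+ 2 = w ^+ 2 by rewrite -exprMn -ws.
  have g3 : 0 <= 3 / 2 * (L / k) * s2 * z ^+ 2.
    by rewrite mulr_ge0 ?sqr_ge0// mulr_ge0 ?(ltW s20)// mulr_ge0.
  nra.
have tl : t ^+ 2 <= (L / k) * s2 * huber k z.
  apply: (le_trans tAw); apply: (@le_trans _ _ (L * w)); first by rewrite ler_wpM2r.
  rewrite ws (_ : L * (s2 * z) = (L / k) * s2 * (k * z)); last by field; rewrite gt_eqF.
  by rewrite ler_wpM2l ?huber_tail// mulr_ge0// ltW.
nra.
Qed.

Lemma contraction (h g : K -> R) (eta mu : R) :
  dot x (rot h) = 0 -> sqnorm h <= 1 / 64 -> 0 < mu -> 100 * (1000 * (mu * n%:R)) <= 1 ->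
  64 / 81 * mu <= eta -> eta <= 64 / 49 * mu ->
  (forall u, dot g u = mean (fun r => (2 * cross (a r) x h + inten (a r) h) *
     cross (a r) (fun j => x j + h j) u)) ->
  sqnorm (fun j => h j - eta * g j) <= (1 - mu / 4) * sqnorm h.
Proof.
move=> hperp h64 mu0 mun eta1 eta2 gE.
have h1 : sqnorm h <= 1 by lra.
have eta0 : 0 < eta by apply: lt_le_trans eta1; rewrite mulr_gt0.
pose t r := cross (a r) x h; pose w r := inten (a r) h.
pose s2 := sqnorm h; pose W := mean (fun r => w r ^+ 2).
pose tm := mean (fun r => t r ^+ 2).
have W0 : 0 <= W by apply: mean_ge0 => r; exact: sqr_ge0.
have s20 : 0 <= s2 by exact: sqnorm_ge0.
have tm_ub : tm <= 21 / 10 * s2.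
  have := iso h; rewrite ler_norml => /andP[_]; have := cross_mean_le h.
  by rewrite /tm /t -/s2; lra.
(* The optimal phase makes [x] orthogonal to [rot h], which removes the only negative term of
   [cross_mean]. *)
have cm_lb : s2 / 2 <= cross_mean x h.
  rewrite /cross_mean hperp x1 expr0n/=; have := sqr_ge0 (dot x h); rewrite -/s2; lra.
have tail : tm - mean (fun r => trunc_cross L x h (a r)) <= 2 / 1000 * s2.
  have := iso h; have := isoL h; rewrite !ler_norml => /andP[+ _] /andP[_].
  by rewrite /tm /t -/s2; lra.
have tau_lb : s2 / 2 - s2 / 1000 <= mean (fun r => trunc_cross L x h (a r)).
  have := isoL h; rewrite ler_norml => /andP[]; rewrite -/s2; lra.
have hg_lb : 27 / 100 * s2 + W / 10 <= dot g h.
  have -> : dot g h = mean (fun r => 2 * t r ^+ 2 + 3 * t r * w r + w r ^+ 2).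
    rewrite gE; congr (_ * _); apply: eq_bigr => r _.
    have -> : cross (a r) (fun j => x j + h j) h = t r + w r.
      by rewrite crossC crossDr crossxx crossC.
    by rewrite /t /w; ring.
  have [s2z|s2p] := eqVneq s2 0.
    have [s [v [_ _ sE hE]]] := polar_decomp h.
    have sz : s = 0 by apply/eqP; rewrite -sqrf_eq0 sE -/s2 s2z.
    have wz r : w r = 0 by rewrite /w hE intenZ sz expr0n mul0r.
    have tz r : t r = 0 by rewrite /t hE crossZr sz mul0r.
    have Wz : W = 0 by rewrite /W big1 ?mulr0// => r _; rewrite wz expr0n.
    rewrite s2z Wz big1 => [|r _]; first by rewrite !mulr0 mul0r addr0.
    by rewrite wz tz expr0n/= !mulr0 !addr0.
  have {}s2p : 0 < s2 by rewrite lt_neqAle eq_sym s2p.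
  pose C := 27 / 20 * s2 ^+ 2 + 3 / 2 * (L / k) * s2.
  have C0 : 0 <= C.
    by rewrite /C addr_ge0// mulr_ge0 ?sqr_ge0// mulr_ge0// divr_ge0// ltW.
  pose H r := huber k (w r / s2).
  apply: (@le_trans _ _ (mean (fun r => trunc_cross L x h (a r) -
     (t r ^+ 2 - trunc_cross L x h (a r)) / 2 - C * H r + w r ^+ 2 / 10))); last first.
    apply: mean_le => r; apply: sample_lower_bound; rewrite ?inten_ge0//.
    exact: cross_sq_le.
  have -> : mean (fun r => trunc_cross L x h (a r) -
     (t r ^+ 2 - trunc_cross L x h (a r)) / 2 - C * H r + w r ^+ 2 / 10) =
     3 / 2 * mean (fun r => trunc_cross L x h (a r)) - tm / 2 - C * mean H + W / 10.
    transitivity (mean (fun r => 3 / 2 * trunc_cross L x h (a r) +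
        (- 2^-1 * t r ^+ 2 + (- C * H r + 10^-1 * w r ^+ 2)))).
      by congr (_ * _); apply: eq_bigr => r _; field.
    by rewrite !meanD !meanZ /tm /W; field; rewrite pnatr_eq0 -lt0n.
  have Hm : mean H <= 6.
    have [s [v [s00 v1 sE hE]]] := polar_decomp h.
    rewrite (_ : mean H = mean (fun r => huber k (inten (a r) v))); first exact: hub.
    congr (_ * _); apply: eq_bigr => r _; rewrite /H /w {1}hE intenZ sE -/s2.
    by rewrite mulrC mulKf// gt_eqF.
  (* The main part is close to [s2 / 2]. By [s2 <= 1/64] and [L / k <= 1/100] the loss is at most
     [6 (27/1280 + 3/200) s2 < 0.22 s2], which leaves [27/100 s2]. *)
  have CH : C * mean H <= C * 6 by rewrite ler_wpM2l.
  have kp : 0 < k := lt_le_trans ltr01 k1.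
  have Lk1 : L / k <= 1 / 100 by rewrite ler_pdivrMr//; move: Lk; lra.
  have s264 : s2 * s2 <= 1 / 64 * s2 by rewrite ler_pM2r.
  have Lks : (L / k) * s2 <= 1 / 100 * s2 by rewrite ler_pM2r.
  move: CH; rewrite /C expr2; lra.
(* Cauchy-Schwarz is applied to [dot g g]; the bound on [|g|^4] contains a factor [|g|^2], which is
   divided out. *)
have g_ub : sqnorm g <= 240 * n%:R * (84 / 5 * s2 + 2 * W).
  have gg : sqnorm g = mean (fun r => (2 * t r + w r) * cross (a r) (fun j => x j + h j) g).
    by rewrite sqnormE gE.
  have := mean_cauchy_schwarz (fun r => 2 * t r + w r)
    (fun r => cross (a r) (fun j => x j + h j) g).
  rewrite -gg => cs.
  have b1 : mean (fun r => (2 * t r + w r) ^+ 2) <= 84 / 5 * s2 + 2 * W.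
    apply: (@le_trans _ _ (mean (fun r => 8 * t r ^+ 2 + 2 * w r ^+ 2))).
      apply: mean_le => r; have := sqr_ge0 (2 * t r - w r); nra.
    by rewrite meanD !meanZ -/tm -/W; lra.
  have b2 : mean (fun r => cross (a r) (fun j => x j + h j) g ^+ 2) <=
      240 * n%:R * sqnorm g.
    apply: le_trans (mean_inten_inten_le g h1); apply: mean_le => r.
    exact: cross_sq_le.
  have g0 := sqnorm_ge0 g.
  have m2 : 0 <= mean (fun r => (2 * t r + w r) ^+ 2).
    by apply: mean_ge0 => r; exact: sqr_ge0.
  have c0 : 0 <= 240 * n%:R * sqnorm g by rewrite !mulr_ge0.
  have [gz|gz] := eqVneq (sqnorm g) 0.
    by rewrite gz !mulr_ge0// addr_ge0// mulr_ge0// divr_ge0.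
  have {}gz : 0 < sqnorm g by rewrite lt_neqAle eq_sym gz.
  rewrite -(ler_pM2r gz) -expr2; apply: (le_trans cs).
  apply: (@le_trans _ _ ((84 / 5 * s2 + 2 * W) * (240 * n%:R * sqnorm g))).
    apply: (@le_trans _ _ (mean (fun r => (2 * t r + w r) ^+ 2) * (240 * n%:R * sqnorm g))).
      by rewrite ler_wpM2l.
    by rewrite ler_wpM2r.
  by rewrite le_eqVlt; apply/orP; left; apply/eqP; ring.
have -> : sqnorm (fun j => h j - eta * g j) = s2 - 2 * (eta * dot g h) + eta ^+ 2 * sqnorm g.
  by rewrite sqnormB sqnormZ dotZr (dotC h g) /s2.
set D := dot g h in hg_lb *; rewrite -/s2.
have etan : eta * n%:R <= 2 / 1000 / 100.
  have : eta * n%:R <= 64 / 49 * (mu * n%:R) by rewrite mulrA ler_wpM2r.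
  lra.
have e1 : eta * (27 / 100 * s2 + W / 10) <= eta * D by rewrite ler_pM2l.
(* This is at most [eta (0.081 s2 + 0.01 W)], against a gain of [eta (0.54 s2 + 0.2 W)] from the
   cross term; the rate follows from [64/81 * 0.45 > 1/4]. *)
have e2 : eta ^+ 2 * sqnorm g <= eta * (480 / 1000 / 100 * (84 / 5 * s2 + 2 * W)).
  have z0 : 0 <= 84 / 5 * s2 + 2 * W by lra.
  apply: (@le_trans _ _ (eta ^+ 2 * (240 * n%:R * (84 / 5 * s2 + 2 * W)))).
    by rewrite ler_wpM2l ?sqr_ge0.
  rewrite expr2 -mulrA ler_pM2l//.
  have := ler_wpM2r z0 etan; lra.
have e3 : 64 / 81 * mu * s2 <= eta * s2 by rewrite ler_wpM2r.
have e4 : 0 <= eta * W by rewrite mulr_ge0// ltW.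
have e5 : 0 <= mu * s2 by rewrite mulr_ge0// ltW.
lra.
Qed.

End deterministic.

(** * Translation from complex to real vectors *)

Section complex_encoding.
Context (R : realType).
Local Notation C := R[i].
Local Notation Re := complex.Re.
Local Notation Im := complex.Im.

Lemma Re_mul (x y : C) : Re (x * y) = Re x * Re y - Im x * Im y.
Proof. by case: x; case: y. Qed.

Lemma Im_mul (x y : C) : Im (x * y) = Re x * Im y + Im x * Re y.
Proof. by case: x; case: y. Qed.

Lemma Re_add (x y : C) : Re (x + y) = Re x + Re y.
Proof. by case: x; case: y. Qed.

Lemma Im_add (x y : C) : Im (x + y) = Im x + Im y.
Proof. by case: x; case: y. Qed.

Lemma Re_opp (x : C) : Re (- x) = - Re x. Proof. by case: x. Qed.

Lemma Im_opp (x : C) : Im (- x) = - Im x. Proof. by case: x. Qed.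

Lemma Re_conjc (x : C) : Re x^* = Re x. Proof. by case: x. Qed.

Lemma Im_conjc (x : C) : Im x^* = - Im x. Proof. by case: x. Qed.

Lemma Re_bigsum (J : finType) (F : J -> C) : Re (\sum_j F j) = \sum_j Re (F j).
Proof. exact: (big_morph _ Re_add). Qed.

Lemma Im_bigsum (J : finType) (F : J -> C) : Im (\sum_j F j) = \sum_j Im (F j).
Proof. exact: (big_morph _ Im_add). Qed.

Lemma invn_real (k : nat) : (k%:R : C)^-1 = ((k%:R^-1 : R)%:C)%C.
Proof. by rewrite fmorphV rmorph_nat. Qed.

Context (n m : nat).
Local Notation K := ('I_n * bool)%type.
Implicit Types z w x : 'cV[C]_n.

Definition enc z : K -> R := fun k => if k.2 then Re (z k.1 0) else Im (z k.1 0).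

Lemma encD z w : enc (z + w) = (fun k => enc z k + enc w k).
Proof. by apply/funext => -[j []]; rewrite /enc !mxE/= ?Re_add ?Im_add. Qed.

Lemma encB z w : enc (z - w) = (fun k => enc z k - enc w k).
Proof. by apply/funext => -[j []]; rewrite /enc !mxE/= ?Re_add ?Im_add ?Re_opp ?Im_opp. Qed.

Lemma encZ (c : C) z :
  enc (c *: z) = (fun k => Re c * enc z k - Im c * rot (enc z) k).
Proof.
apply/funext => -[j []]; rewrite /enc /rot !mxE/= ?Re_mul ?Im_mul//.
by rewrite mulrN opprK.
Qed.

Lemma encZr (c : R) z : enc ((c%:C)%C *: z) = (fun k => c * enc z k).
Proof. by rewrite encZ; apply/funext => k; rewrite mul0r subr0. Qed.

Lemma vnorm_sq z : vnorm z ^+ 2 = sqnorm (enc z).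
Proof.
rewrite sqr_sqrtr; last by apply: sumr_ge0 => j _; rewrite addr_ge0 ?sqr_ge0.
rewrite /sqnorm sum_pair; apply: eq_bigr => j _.
by rewrite big_bool.
Qed.

Lemma vnorm_ge0 z : 0 <= vnorm z. Proof. exact: sqrtr_ge0. Qed.

Variable a : 'I_m -> 'cV[C]_n.
Local Notation b := (fun r => enc (a r)).
Local Notation mean F := (m%:R^-1 * \sum_(r < m) F r).

Lemma Re_Amat z r : Re ((Amat a *m z) r 0) = dot (enc z) (b r).
Proof.
rewrite !mxE Re_bigsum dotE; apply: eq_bigr => j _.
by rewrite !mxE Re_mul Re_conjc Im_conjc /enc/=; ring.
Qed.

Lemma Im_Amat z r : Im ((Amat a *m z) r 0) = dot (rot (enc z)) (b r).
Proof.
rewrite !mxE Im_bigsum dotE; apply: eq_bigr => j _.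
by rewrite !mxE Im_mul Re_conjc Im_conjc /enc /rot/=; ring.
Qed.

Lemma ymeasE z r : ymeas a z r = inten (b r) (enc z).
Proof. by rewrite /ymeas /cabs2 Re_Amat Im_Amat. Qed.

Lemma dot_enc_sum (J : finType) (F : J -> 'cV[C]_n) (u : K -> R) :
  dot (enc (\sum_j F j)) u = \sum_j dot (enc (F j)) u.
Proof.
elim: (index_enum J) => [|j s ih].
  by rewrite !big_nil /dot big1// => -[k []] _; rewrite /enc mxE/= mul0r.
by rewrite !big_cons encD dotDl ih.
Qed.

Lemma dot_wgrad x z (u : K -> R) : dot (enc (wgrad a x z)) u =
  mean (fun r => (inten (b r) (enc z) - inten (b r) (enc x)) *
     cross (b r) (enc z) u).
Proof.
rewrite /wgrad invn_real encZr dotZl dot_enc_sum; congr (_ * _).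
apply: eq_bigr => r _; rewrite -scalerA encZr dotZl -/(ymeas a z r) !ymeasE; congr (_ * _).
rewrite encZ Re_Amat Im_Amat dotDl dotNl !dotZl /cross.
by rewrite (dot_rotl (enc (a r))) !(dotC (enc (a r))); ring.
Qed.

Lemma enc_expi phi z :
  enc (expi phi *: z) = (fun k => cos phi * enc z k - sin phi * rot (enc z) k).
Proof. by rewrite encZ. Qed.

End complex_encoding.

Lemma le_of_sqr (R : realDomainType) (u v : R) : 0 <= v -> u ^+ 2 <= v ^+ 2 -> u <= v.
Proof.
move=> v0 uv; have [//|vu] := leP u v.
by move: uv; rewrite ler_pXn2r ?nnegrE ?(le_trans v0 (ltW vu))// leNgt vu.
Qed.

(** * The optimal phase *)

Section phases.
Context (R : realType).

Lemma angle_exists (u v : R) : exists phi, [/\ 0 <= phi <= pi *+ 2,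
  cos phi * Num.sqrt (u ^+ 2 + v ^+ 2) = u & sin phi * Num.sqrt (u ^+ 2 + v ^+ 2) = v].
Proof.
set rho := Num.sqrt _; have pi0 := pi_gt0 R.
have s0 : 0 <= u ^+ 2 + v ^+ 2 by rewrite addr_ge0 ?sqr_ge0.
have [r0|r0] := eqVneq rho 0.
  have uv : u ^+ 2 + v ^+ 2 = 0.
    by apply/eqP; rewrite eq_le s0 andbT -sqrtr_eq0 -/rho r0.
  have u0 : u = 0 by apply/eqP; rewrite -sqrf_eq0; have := sqr_ge0 u; have := sqr_ge0 v; lra.
  have v0 : v = 0 by apply/eqP; rewrite -sqrf_eq0; have := sqr_ge0 u; have := sqr_ge0 v; lra.
  by exists 0; rewrite r0 !mulr0 u0 v0 lexx mulrn_wge0// ltW.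
have rp : 0 < rho by rewrite lt_neqAle eq_sym r0 sqrtr_ge0.
have r2 : rho ^+ 2 = u ^+ 2 + v ^+ 2 by rewrite sqr_sqrtr.
have c2 : (u / rho) ^+ 2 + (v / rho) ^+ 2 = 1.
  by rewrite !exprMn -mulrDl -r2 -exprMn divff// expr1n.
have c1 : -1 <= u / rho <= 1.
  rewrite -ler_norml -(@ler_pXn2r _ 2) ?nnegrE// expr1n real_normK ?num_real//.
  by have := sqr_ge0 (v / rho); lra.
have sE : sin (acos (u / rho)) = `|v / rho|.
  by rewrite sin_acos// -sqrtr_sqr; congr Num.sqrt; lra.
have [v0|v0] := leP 0 v.
  exists (acos (u / rho)); split.
  - by rewrite acos_ge0//= (le_trans (acos_lepi c1))// mulr2n lerDl ltW.
  - by rewrite acosK ?in_itv//= divfK.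
  - by rewrite sE ger0_norm ?divr_ge0 ?(ltW rp)// divfK.
exists (pi *+ 2 - acos (u / rho)); split.
- by rewrite subr_ge0 lerBlDr lerDl acos_ge0//= andbT (le_trans (acos_lepi c1))// mulr2n lerDl ltW.
- by rewrite cosB cos2pi sin2pi mul1r mul0r addr0 acosK ?in_itv//= divfK.
- rewrite sinB cos2pi sin2pi mul1r mul0r add0r sE ltr0_norm ?opprK ?divfK//.
  by rewrite pmulr_llt0// invr_gt0.
Qed.

Context (n : nat).
Implicit Types z x : 'cV[R[i]]_n.

Lemma dist_le z x phi : 0 <= phi <= pi *+ 2 ->
  dist z x <= vnorm (z - expi phi *: x).
Proof.
move=> hphi; apply: ge_inf; last by exists phi.
by exists 0 => _ [psi _ <-]; exact: vnorm_ge0.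
Qed.

Lemma dist_ge0 z x : 0 <= dist z x.
Proof.
apply: lb_le_inf; last by move=> _ [psi _ <-]; exact: vnorm_ge0.
exists (vnorm (z - expi 0 *: x)), 0 => //=.
by rewrite lexx mulrn_wge0// ltW// pi_gt0.
Qed.

(** The modulus of the hermitian product of [z] and [x]. *)
Definition overlap z x : R :=
  Num.sqrt (dot (enc z) (enc x) ^+ 2 + dot (rot (enc z)) (enc x) ^+ 2).

Lemma overlap_sq z x : overlap z x ^+ 2 =
  dot (enc z) (enc x) ^+ 2 + dot (rot (enc z)) (enc x) ^+ 2.
Proof. by rewrite sqr_sqrtr// addr_ge0 ?sqr_ge0. Qed.

Lemma sqnorm_phase_diff z x phi : vnorm (z - expi phi *: x) ^+ 2 =
  sqnorm (enc z) + sqnorm (enc x) -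
  2 * (cos phi * dot (enc z) (enc x) + sin phi * dot (rot (enc z)) (enc x)).
Proof.
rewrite vnorm_sq encB enc_expi sqnormB.
have -> : sqnorm (fun k => cos phi * enc x k - sin phi * rot (enc x) k) = sqnorm (enc x).
  rewrite sqnormB !sqnormZ !dotZl !dotZr dot_rot_self sqnorm_rot.
  by rewrite -[RHS]mul1r -(cos2Dsin2 phi); ring.
by rewrite !dotDr dotNr !dotZr dot_rotl; ring.
Qed.

(** By Cauchy-Schwarz in the plane, [cos psi * p + sin psi * q] is largest when [psi] is the
    argument of [(p, q)]. The last clause says that the hermitian product becomes real after
    rotation; [flow_step] turns it into orthogonality to [rot h]. *)
Lemma dist_attained z x : exists phi, [/\ 0 <= phi <= pi *+ 2,
  dist z x = vnorm (z - expi phi *: x),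
  dist z x ^+ 2 = sqnorm (enc z) + sqnorm (enc x) - 2 * overlap z x &
  cos phi * dot (rot (enc z)) (enc x) = sin phi * dot (enc z) (enc x)].
Proof.
have [phi [hphi cE sE]] := angle_exists (dot (enc z) (enc x)) (dot (rot (enc z)) (enc x)).
rewrite -/(overlap z x) in cE sE.
have o2 := overlap_sq z x.
have vE : vnorm (z - expi phi *: x) ^+ 2 =
    sqnorm (enc z) + sqnorm (enc x) - 2 * overlap z x.
  rewrite sqnorm_phase_diff -{1}cE -{1}sE; congr (_ - 2 * _).
  by rewrite -[RHS]mul1r -(cos2Dsin2 phi); ring.
have dE : dist z x = vnorm (z - expi phi *: x).
  apply/eqP; rewrite eq_le dist_le//=.
  apply: lb_le_inf; first by exists (vnorm (z - expi phi *: x)), phi.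
  move=> _ [psi _ <-]; apply: le_of_sqr; first exact: vnorm_ge0.
  suff : cos psi * dot (enc z) (enc x) + sin psi * dot (rot (enc z)) (enc x) <= overlap z x.
    by move=> ?; rewrite [leLHS]vE [leRHS]sqnorm_phase_diff; lra.
  apply: le_of_sqr; first exact: sqrtr_ge0.
  rewrite o2; set p := dot _ _; set q := dot _ _.
  have := sqr_ge0 (cos psi * q - sin psi * p).
  have -> : (cos psi * q - sin psi * p) ^+ 2 = (cos psi ^+ 2 + sin psi ^+ 2) * (p ^+ 2 + q ^+ 2) -
    (cos psi * p + sin psi * q) ^+ 2 by ring.
  by rewrite cos2Dsin2; lra.
exists phi; split => //; first by rewrite dE.
by rewrite -{1}sE -{1}cE; ring.
Qed.

End phases.

(** * Rotating the iterate instead of the signal *)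

Section rotated_iteration.
Context (R : realType) (n m : nat).
Hypotheses (n0 : (0 < n)%N) (m0 : (0 < m)%N).
Local Notation K := ('I_n * bool)%type.
Variables (a : 'I_m -> 'cV[R[i]]_n) (x : 'cV[R[i]]_n).
Local Notation b := (fun r => enc (a r)).
Local Notation mean F := (m%:R^-1 * \sum_(r < m) F r).

Variable phi : R.
(** Multiplication by [e^(- i phi)]. Applied to the iterate, it lets the signal stay fixed in all
    estimates. *)
Definition turn (u : K -> R) : K -> R := fun k => cos phi * u k + sin phi * rot u k.

Lemma sqnorm_turn u : sqnorm (turn u) = sqnorm u.
Proof.
rewrite /turn sqnormD !sqnormZ dotZl dotZr dot_rot_self sqnorm_rot.
by rewrite -[RHS]mul1r -(cos2Dsin2 phi); ring.
Qed.

Lemma dot_turn u v : dot (turn u) v = cos phi * dot u v - sin phi * dot u (rot v).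
Proof. by rewrite /turn dotDl !dotZl dot_rotl; ring. Qed.

Lemma inten_turn c u : inten c (turn u) = inten c u.
Proof.
rewrite /inten /turn rotD !rotZ rotK !dotDl !dotZl dotNl.
rewrite -[RHS]mul1r -(cos2Dsin2 phi); ring.
Qed.

Lemma cross_turn c u v :
  cross c (turn u) v = cos phi * cross c u v - sin phi * cross c u (rot v).
Proof. by rewrite /cross /turn rotD !rotZ !rotK !dotDl !dotZl !dotNl; ring. Qed.

Lemma dot_turn_wgrad z u : dot (turn (enc (wgrad a x z))) u =
  mean (fun r => (inten (b r) (turn (enc z)) - inten (b r) (enc x)) *
     cross (b r) (turn (enc z)) u).
Proof.
rewrite dot_turn !dot_wgrad mulrCA (mulrCA (sin phi)) -mulrBr; congr (_ * _).
rewrite !mulr_sumr -sumrB; apply: eq_bigr => r _; rewrite inten_turn cross_turn; ring.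
Qed.

Lemma vnorm_turn z : vnorm (z - expi phi *: x) ^+ 2 =
  sqnorm (fun k => turn (enc z) k - enc x k).
Proof.
rewrite sqnorm_phase_diff sqnormB sqnorm_turn dot_turn dot_rotl; ring.
Qed.

End rotated_iteration.

(** * Contraction of the flow *)

Section flow.
Context (R : realType) (n m : nat).
Hypotheses (n0 : (0 < n)%N) (m0 : (0 < m)%N).
Local Notation K := ('I_n * bool)%type.
Local Notation mean F := (m%:R^-1 * \sum_(r < m) F r).

(** All that the flow requires of the randomness, collected for a fixed sample: [L] is a truncation
    level, [k] the Huber parameter. *)
Definition tame (b : 'I_m -> K -> R) (u : K -> R) : Prop := exists L k,
  [/\ 0 < L, 1 <= k & 100 * L <= k] /\
  [/\ isometric b u (1 / 1000),
     forall h, `|mean (fun r => trunc_cross L u h (b r)) - cross_mean u h|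
       <= 1 / 1000 * sqnorm h,
     forall h, sqnorm h <= 1 -> mean (fun r => huber k (inten (b r) h)) <= 6 &
     mean (fun r => 32 * expR (sqnorm (b r) / 2 - 2 * n%:R)) < 1].

Variables (a : 'I_m -> 'cV[R[i]]_n) (x : 'cV[R[i]]_n).
Hypothesis x0 : 0 < vnorm x.
Local Notation b := (fun r => enc (a r)).
Local Notation c := (vnorm x).
Local Notation unitx := (fun k => c^-1 * enc x k).
Hypothesis good : tame b unitx.

Let c_neq0 : c != 0. Proof. by rewrite gt_eqF. Qed.

Lemma sqnorm_unitx : sqnorm unitx = 1.
Proof. by rewrite sqnormZ -vnorm_sq exprVn mulVf// expf_neq0. Qed.

Lemma enc_scale : enc x = (fun k => c * unitx k).
Proof. by apply/funext => k; rewrite mulVKf. Qed.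

Lemma init_norm z : dist z x <= c / 8 ->
  49 / 64 * c ^+ 2 <= vnorm z ^+ 2 <= 81 / 64 * c ^+ 2.
Proof.
move=> zx; have [phi [_ dE _ _]] := dist_attained z x.
set h := fun k => turn phi (enc z) k - enc x k.
have hE : sqnorm h <= c ^+ 2 / 64.
  rewrite /h -vnorm_turn -dE (_ : c ^+ 2 / 64 = (c / 8) ^+ 2); last by field.
  by rewrite ler_pXn2r ?nnegrE ?dist_ge0// ltW// divr_gt0.
have zE : vnorm z ^+ 2 = c ^+ 2 + 2 * dot (enc x) h + sqnorm h.
  rewrite !vnorm_sq -(sqnorm_turn phi) -sqnormD; congr sqnorm.
  by apply/funext => k; rewrite /h; ring.
have cs : dot (enc x) h ^+ 2 <= (c ^+ 2 / 8) ^+ 2.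
  apply: le_trans (dot_sq_le _ _) _; rewrite -vnorm_sq.
  rewrite (_ : (c ^+ 2 / 8) ^+ 2 = c ^+ 2 * (c ^+ 2 / 64)); last by field.
  by rewrite ler_wpM2l ?sqr_ge0.
have c20 : 0 <= c ^+ 2 / 8 by rewrite divr_ge0 ?sqr_ge0.
have : `|dot (enc x) h| <= c ^+ 2 / 8.
  by apply: le_of_sqr => //; rewrite real_normK ?num_real.
rewrite ler_norml zE => /andP[d1 d2]; have := sqnorm_ge0 h => h0.
(* [49/64 = (1 - 1/8)^2] *)
have tri : 49 / 64 * c ^+ 2 <= c ^+ 2 + 2 * dot (enc x) h + sqnorm h.
  pose s := Num.sqrt (sqnorm h).
  have s2 : s ^+ 2 = sqnorm h by rewrite sqr_sqrtr.
  have s0 : 0 <= s by exact: sqrtr_ge0.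
  have sc : s <= c / 8.
    apply: le_of_sqr; first exact: ltW (divr_gt0 x0 (ltr0Sn _ _)).
    rewrite s2.
    by rewrite (_ : (c / 8) ^+ 2 = c ^+ 2 / 64)//; field.
  have cs2 : `|dot (enc x) h| <= c * s.
    apply: le_of_sqr; first exact: mulr_ge0 (ltW x0) s0.
    rewrite real_normK ?num_real//.
    by rewrite exprMn s2 vnorm_sq; exact: dot_sq_le.
  move: cs2; rewrite ler_norml -s2 => /andP[cs2 _].
  have : 0 <= (c / 8 - s) * (2 * c - s - c / 8) by rewrite mulr_ge0//; have := x0; lra.
  have -> : (c / 8 - s) * (2 * c - s - c / 8) =
     15 / 64 * c ^+ 2 - 2 * (c * s) + s ^+ 2 by field.
  lra.
rewrite tri; lra.
Qed.

Lemma flow_step z0 z mu : 0 < mu -> 100 * (1000 * (mu * n%:R)) <= 1 ->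
  dist z0 x <= c / 8 -> dist z x <= c / 8 ->
  dist (z - ((mu / vnorm z0 ^+ 2)%:C)%C *: wgrad a x z) x ^+ 2 <=
  (1 - mu / 4) * dist z x ^+ 2.
Proof.
move=> mu0 mun z0x zx.
have [phi [hphi dE _ align]] := dist_attained z x.
have /andP[N1 N2] := init_norm z0x.
have c2 : 0 < c ^+ 2 by rewrite exprn_gt0.
set s := mu / vnorm z0 ^+ 2.
have N0 : 0 < vnorm z0 ^+ 2 by apply: lt_le_trans N1; rewrite mulr_gt0.
pose h k := c^-1 * (turn phi (enc z) k - enc x k).
(* The gradient is homogeneous of degree 3 in [(x, z)]. After normalization the step is
   [s * c ^+ 2], which [init_norm] places between [64/81 mu] and [64/49 mu]. *)
pose g k := c^-1 ^+ 3 * turn phi (enc (wgrad a x z)) k.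
have hE : (fun k => turn phi (enc z) k - enc x k) = (fun k => c * h k).
  by apply/funext => k; rewrite /h mulVKf.
have zE : turn phi (enc z) = (fun k => c * (unitx k + h k)).
  by apply/funext => k; rewrite /h; field.
have d2 : dist z x ^+ 2 = c ^+ 2 * sqnorm h by rewrite dE vnorm_turn hE sqnormZ.
have h64 : sqnorm h <= 1 / 64.
  rewrite -(ler_pM2l c2) -d2 (_ : c ^+ 2 * (1 / 64) = (c / 8) ^+ 2); last by field.
  by rewrite ler_pXn2r ?nnegrE ?dist_ge0// ltW// divr_gt0.
have hperp : dot unitx (rot h) = 0.
  rewrite /h rotZ dotZl dotZr.
  have -> : rot (fun k => turn phi (enc z) k - enc x k) =
     (fun k => rot (turn phi (enc z)) k - rot (enc x) k).
    by apply/funext => -[j []]; rewrite /rot//= opprD.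
  rewrite dotDr dotNr dot_rot_self subr0.
  have -> : dot (enc x) (rot (turn phi (enc z))) = 0; last by rewrite !mulr0.
  rewrite -[LHS]opprK -dot_rotl dotC dot_turn rotK dotNr.
  by move: align; rewrite dot_rotl; lra.
have gE u : dot g u = mean (fun r => (2 * cross (b r) unitx h + inten (b r) h) *
     cross (b r) (fun j => unitx j + h j) u).
  rewrite /g dotZl dot_turn_wgrad mulrCA mulr_sumr; congr (_ * _).
  apply: eq_bigr => r _.
  have iE : inten (b r) (enc x) = c ^+ 2 * inten (b r) unitx by rewrite -intenZ -enc_scale.
  have cE : cross (b r) (fun k => c * (unitx k + h k)) u =
      c * cross (b r) (fun k => unitx k + h k) u by rewrite crossC crossZr crossC.
  rewrite iE zE cE intenZ intenD; move: (inten _ _) (cross _ _ _) (cross _ _ _) => p q s'.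
  by field.
have [L [k [[L0 k1 Lk] [iso isoL hub norms]]]] := good.
have sc2 : s * c ^+ 2 = mu * (c ^+ 2 / vnorm z0 ^+ 2) by rewrite /s -mulrA [_^-1 * _]mulrC.
have eta1 : 64 / 81 * mu <= s * c ^+ 2.
  rewrite sc2 mulrC ler_pM2l// ler_pdivlMr//; lra.
have eta2 : s * c ^+ 2 <= 64 / 49 * mu.
  rewrite sc2 [leRHS]mulrC ler_pM2l// ler_pdivrMr//; lra.
have := contraction n0 m0 sqnorm_unitx L0 k1 Lk iso isoL hub norms hperp h64 mu0 mun eta1 eta2 gE.
rewrite -(ler_pM2l c2) [X in _ <= X -> _]mulrCA -d2; apply: le_trans.
(* The phase optimal for [z] is kept for the new iterate, which can only overestimate its
   distance. *)
set z' := _ - _; apply: (@le_trans _ _ (vnorm (z' - expi phi *: x) ^+ 2)).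
  by rewrite ler_pXn2r ?nnegrE ?dist_ge0 ?vnorm_ge0 ?dist_le.
rewrite vnorm_turn -sqnormZ le_eqVlt; apply/orP; left; apply/eqP; congr sqnorm.
apply/funext => j; rewrite /z' encB encZr /g.
have -> : turn phi (fun k => enc z k - s * enc (wgrad a x z) k) j =
   turn phi (enc z) j - s * turn phi (enc (wgrad a x z)) j.
  by rewrite /turn /rot; case: j => i [] /=; ring.
by rewrite /h; field.
Qed.

Lemma flow_contraction z0 mu : 0 < mu -> 100 * (1000 * (mu * n%:R)) <= 1 ->
  dist z0 x <= c / 8 -> forall tau : nat,
  dist (wf_iter a x z0 mu tau) x <= 8^-1 * (1 - mu / 4) `^ (tau%:R / 2) * c.
Proof.
move=> mu0 mun z0x tau.
have mu1 : mu <= 1.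
  have : mu * 1 <= mu * n%:R by rewrite ler_pM2l// ler1n.
  lra.
have q0 : 0 <= 1 - mu / 4 by lra.
(* The induction runs on squared distances, which shrink by [1 - mu / 4] at each step; hence the
   exponent [tau / 2]. *)
suff : dist (wf_iter a x z0 mu tau) x ^+ 2 <= (1 - mu / 4) ^+ tau * (c / 8) ^+ 2.
  move=> H; have pw : (1 - mu / 4) `^ (tau%:R / 2) ^+ 2 = (1 - mu / 4) ^+ tau.
    by rewrite -powR_mulrn ?powR_ge0// -powRrM divfK// powR_mulrn.
  apply: le_of_sqr.
    by rewrite mulr_ge0 ?vnorm_ge0// mulr_ge0 ?powR_ge0.
  apply: le_trans H _; rewrite !exprMn pw le_eqVlt; apply/orP; left; apply/eqP.
  by field.
elim: tau => [|tau ih].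
  by rewrite expr0 mul1r ler_pXn2r ?nnegrE ?dist_ge0// ltW// divr_gt0.
have small : dist (wf_iter a x z0 mu tau) x <= c / 8.
  apply: le_of_sqr; first exact: ltW (divr_gt0 x0 (ltr0Sn _ _)).
  apply: le_trans ih _; rewrite ler_piMl ?sqr_ge0// exprn_ile1//; lra.
rewrite /wf_iter iterS -/(wf_iter a x z0 mu tau).
apply: le_trans (flow_step mu0 mun z0x small) _.
by rewrite [_ ^+ tau.+1]exprS -mulrA ler_wpM2l.
Qed.

End flow.

(** * Rayleigh quotients *)

Section rayleigh.
Context (R : realType) (n : nat).
Local Notation C := R[i].
Local Open Scope sesquilinear_scope.
Local Notation Re := complex.Re.
Local Notation Im := complex.Im.
Implicit Types (z w : 'cV[C]_n) (A : 'M[C]_n).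

Lemma Re_adjoint_mul z w : Re ((z ^t* *m w) 0 0) = dot (enc z) (enc w).
Proof.
rewrite !mxE Re_bigsum dotE; apply: eq_bigr => j _.
by rewrite !mxE Re_mul Re_conjc Im_conjc /enc/=; ring.
Qed.

(** The spectral theorem diagonalizes [A] by a unitary [U]. The columns of [U ^t*] are eigenvectors,
    so every diagonal entry is at most [lam] in the order of the complex numbers, which compares
    real parts. *)
Lemma rayleigh_le A (lam : C) z : A ^t* = A ->
  (forall (mu : C) w, w != 0 -> A *m w = mu *: w -> mu <= lam) ->
  dot (enc z) (enc (A *m z)) <= Re lam * sqnorm (enc z).
Proof.
move=> Aadj lam_max.
have /orthomx_spectralP AE : A \is normalmx by apply/normalmxP; rewrite Aadj.
set U := spectralmx A in AE; set D := spectral_diag A in AE.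
have Uu : U \is unitarymx := spectral_unitarymx A.
have Uinv : invmx U = U ^t* by exact: invmx_unitary.
have UU : U *m U ^t* = 1%:M by apply/unitarymxP.
have UtU : U ^t* *m U = 1%:M by rewrite -Uinv mulVmx// unitarymx_unit.
have dle i : D 0 i <= lam.
  apply: (lam_max _ (U ^t* *m delta_mx i 0)).
    apply/eqP => /(congr1 (mulmx U)); rewrite mulmxA UU mul1mx mulmx0.
    by move=> /matrixP/(_ i 0); rewrite !mxE !eqxx => /eqP; rewrite oner_eq0.
  rewrite {1}AE Uinv -!mulmxA (mulmxA U) UU mul1mx scalemxAr; congr (_ *m _).
  apply/matrixP => j k; rewrite ord1 mul_diag_mx !mxE eqxx andbT.
  by case: eqP => [->//|_]; rewrite !mulr0.
pose y := U *m z.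
have E1 : z ^t* *m (A *m z) = y ^t* *m (diag_mx D *m y).
  by rewrite {1}AE Uinv /y trmx_mul map_mxM -!mulmxA.
have E2 : z ^t* *m z = y ^t* *m y.
  by rewrite /y trmx_mul map_mxM -!mulmxA (mulmxA _ U) UtU mul1mx.
rewrite -Re_adjoint_mul E1 sqnormE -Re_adjoint_mul E2 !mxE !Re_bigsum mulr_sumr.
apply: ler_sum => i _; rewrite mul_diag_mx !mxE.
have := dle i; rewrite lecE => /andP[_].
rewrite !Re_mul !Im_mul Re_conjc Im_conjc; set p := Re _; set q := Im _.
set r := Re (\sum_j _); set t := Im (\sum_j _) => pl.
have : 0 <= (Re lam - p) * (r ^+ 2 + t ^+ 2).
  by rewrite mulr_ge0 ?subr_ge0// addr_ge0 ?sqr_ge0.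
lra.
Qed.

End rayleigh.

(** * The initial estimate *)

Section initialization.
Context (R : realType) (n m : nat).
Hypotheses (n0 : (0 < n)%N) (m0 : (0 < m)%N).
Local Notation C := R[i].
Local Notation Re := complex.Re.
Local Open Scope sesquilinear_scope.
Local Notation K := ('I_n * bool)%type.
Local Notation mean F := (m%:R^-1 * \sum_(r < m) F r).
Variables (a : 'I_m -> 'cV[C]_n) (x : 'cV[C]_n).
Local Notation b := (fun r => enc (a r)).

Lemma Ymat_adjoint : Ymat a x ^t* = Ymat a x.
Proof.
apply/matrixP => i j; rewrite /Ymat !mxE rmorphM/= !summxE rmorph_sum/=.
congr (_ * _); first by rewrite fmorphV rmorph_nat.
apply: eq_bigr => r _; rewrite !mxE !rmorphM/= conjCK.
by rewrite [(a r j 0)^* * _]mulrC; congr (_ * _); exact: conjc_real.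
Qed.

Lemma Ymat_mul (w : 'cV[C]_n) : Ymat a x *m w =
  (m%:R)^-1 *: \sum_r (((ymeas a x r)%:C)%C *: ((Amat a *m w) r 0 *: a r)).
Proof.
rewrite /Ymat -scalemxAl mulmx_suml; congr (_ *: _); apply: eq_bigr => r _.
rewrite -scalemxAl; congr (_ *: _).
apply/matrixP => i j; rewrite ord1 !mxE mulr_suml; apply: eq_bigr => k _.
by rewrite !mxE; ring.
Qed.

Lemma dot_Ymat (w : 'cV[C]_n) (u : K -> R) : dot (enc (Ymat a x *m w)) u =
  mean (fun r => inten (b r) (enc x) * cross (b r) (enc w) u).
Proof.
rewrite Ymat_mul invn_real encZr dotZl dot_enc_sum; congr (_ * _).
apply: eq_bigr => r _; rewrite encZr dotZl ymeasE; congr (_ * _).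
rewrite encZ Re_Amat Im_Amat dotDl dotNl !dotZl /cross.
by rewrite (dot_rotl (enc (a r))) !(dotC (enc (a r))); ring.
Qed.

Hypothesis x0 : 0 < vnorm x.
Local Notation c := (vnorm x).
Local Notation unitx := (fun k => c^-1 * enc x k).
Hypothesis iso : isometric b unitx (1 / 1000).
Hypothesis scale : `|mean (fun r => inten (b r) unitx) - 1| <= 1 / 1000.

Lemma init_dist z0 : is_WF_init a x z0 -> dist z0 x <= c / 8.
Proof.
move=> [v [lam [v1 Yv lam_max ->]]].
have c2 : 0 < c ^+ 2 by rewrite exprn_gt0.
have u1 := sqnorm_unitx x0.
have iE r : inten (b r) (enc x) = c ^+ 2 * inten (b r) unitx.
  by rewrite -intenZ -enc_scale.
have vv : sqnorm (enc v) = 1 by rewrite -vnorm_sq v1 expr1n.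
have lamE : Re lam = c ^+ 2 * mean (fun r => inten (b r) unitx * inten (b r) (enc v)).
  transitivity (dot (enc (Ymat a x *m v)) (enc v)).
    rewrite Yv encZ dotDl dotNl !dotZl -sqnormE vv dotC.
    by rewrite [dot (enc v) _]dot_rot_self; ring.
  rewrite dot_Ymat mulrCA; congr (_ * _); rewrite mulr_sumr; apply: eq_bigr => r _.
  by rewrite iE crossxx mulrA.
have ray := rayleigh_le x Ymat_adjoint lam_max.
have le : mean (fun r => inten (b r) unitx ^+ 2) <=
    mean (fun r => inten (b r) unitx * inten (b r) (enc v)).
  rewrite dotC dot_Ymat lamE -vnorm_sq in ray.
  rewrite -(ler_pM2l c2) -(ler_pM2r c2); apply: le_trans ray.
  rewrite le_eqVlt; apply/orP; left; apply/eqP.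
  rewrite mulrAC mulrCA; congr (_ * _); rewrite mulr_sumr.
  by apply: eq_bigr => r _; rewrite crossxx iE; ring.
have ov := leading_overlap u1 iso vv le.
pose q := mean (fun r => inten (b r) unitx).
have qE : (m%:R)^-1 * \sum_r ymeas a x r = c ^+ 2 * q.
  rewrite /q mulrCA; congr (_ * _); rewrite mulr_sumr; apply: eq_bigr => r _.
  by rewrite ymeasE iE.
rewrite qE sqrtrM ?sqr_ge0// sqrtr_sqr (gtr0_norm x0).
move: scale; rewrite -/q ler_norml => /andP[q1 q2].
set s := Num.sqrt q.
have q0 : 0 <= q by lra.
have s2 : s ^+ 2 = q by rewrite sqr_sqrtr.
have s0 : 0 <= s by exact: sqrtr_ge0.
have s1 : 1 - 1 / 1000 <= s by apply: le_of_sqr => //; rewrite s2; lra.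
have [phi [_ _ d2 _]] := dist_attained ((((c * s)%:C)%C : C) *: v) x.
apply: le_of_sqr; first exact: ltW (divr_gt0 x0 (ltr0Sn _ _)).
rewrite d2 encZr sqnormZ vv mulr1 -vnorm_sq exprMn s2.
have : c ^+ 2 * s * (1 - 3 / 1000) <= overlap (((c * s)%:C)%C *: v) x.
  apply: le_of_sqr; first exact: sqrtr_ge0.
  rewrite overlap_sq encZr rotZ !dotZl {1 2}(enc_scale x0) !(dotZr c).
  rewrite (dotC unitx) (dotC unitx) in ov.
  set p1 := dot (enc v) _ in ov *; set p2 := dot (rot (enc v)) _ in ov *.
  have -> : (c * s * (c * p1)) ^+ 2 + (c * s * (c * p2)) ^+ 2 =
    (c ^+ 2 * s) ^+ 2 * (p1 ^+ 2 + p2 ^+ 2) by ring.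
  rewrite [leLHS]exprMn ler_wpM2l ?sqr_ge0//; apply: le_trans ov; lra.
have e1 : c ^+ 2 * (1 - 1 / 1000) <= c ^+ 2 * s by rewrite ler_pM2l.
have e2 : c ^+ 2 * q <= c ^+ 2 * (1 + 1 / 1000) by rewrite ler_pM2l//; lra.
(* Divided by [c^2], the squared distance is at most [1.001 + 1 - 2 * 0.999 * 0.997 < 1/64]. *)
rewrite expr_div_n; lra.
Qed.

End initialization.

(** * Choice of parameters and failure probabilities *)

Section assembly.
Context (R : realType) (d : measure_display) (T : measurableType d) (P : probability T R).
Context (n m : nat).
Local Notation K := ('I_n * bool)%type.
Context (X : 'I_m * 'I_n * bool -> T -> R).
Hypothesis mX : forall i, measurable_fun setT (X i).
Hypothesis iX : mutually_independent P X.
Hypothesis gX : forall i (B : set R), measurable B ->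
  P (X i @^-1` B) = normal_prob 0 (Num.sqrt (2^-1)) B.
Hypotheses (n0 : (0 < n)%N) (m0 : (0 < m)%N).

Local Notation a := (sample X).
Local Notation mean F := (m%:R^-1 * \sum_(r < m) F r).
Local Notation tiny := ((n%:R ^+ 2)^-1 : R).

Variables (M : R) (x : K -> R).
Hypothesis x1 : sqnorm x = 1.
Hypotheses (M1 : 1 <= M) (M2 : mom R 2 <= M) (M3 : mom R 3 <= M) (M4 : mom R 4 <= M).

Local Notation thousand := (1000 : R).
(** [L] makes the truncation bias [mom 3 / B] at most [1/16000] for [B >= L]; with
    [lam = 1 / (Q B)], [Q] gives the Chernoff condition [2 mom 4 lam <= 1/16000]. *)
Let L : R := 16 * thousand * M.
Let Q : R := 32 * thousand * M.
Let lnm : R := ln m%:R.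
Hypothesis m_large : 70 * (32 * thousand) * Q * n%:R * (L + 32 * lnm) <= m%:R.
Hypothesis nm : (n <= m)%N.
Hypothesis n_large : 32 * 48 <= n%:R :> R.

Let nR : 0 < n%:R :> R. Proof. by rewrite ltr0n. Qed.
Let mR : 0 < m%:R :> R. Proof. by rewrite ltr0n. Qed.
Let M0 : 0 < M. Proof. exact: lt_le_trans M1. Qed.
Let L1 : 1 <= L. Proof. by have := M1; rewrite /L; lra. Qed.
Let L0 : 0 < L. Proof. exact: lt_le_trans L1. Qed.
Let Q64 : 64 <= Q. Proof. by have := M1; rewrite /Q; lra. Qed.
Let Q0 : 0 < Q. Proof. by apply: lt_le_trans Q64. Qed.
Let lnm0 : 0 <= lnm. Proof. by rewrite ln_ge0// ler1n. Qed.

(** [70 = 68 + 2]: the lattice points cost [2^(68 n) <= e^(68 n)], and what remains is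
    [2 e^(-2n) <= 1 / n^2]. *)
Let union_small (t : R) : 70 * n%:R <= t ->
  2 ^+ (68 * n) * (expR (- t) + expR (- t)) <= tiny.
Proof.
move=> nt; have e2 : 2 <= expR 1 :> R by have := expR_ge1Dx (1 : R); lra.
have p68 : 2 ^+ (68 * n) <= expR (68 * n%:R) :> R.
  by rewrite -[68 * n%:R]mulr1 -natrM expRM_natl lerXn2r ?nnegrE ?expR_ge0.
have et : expR (- t) <= expR (- (70 * n%:R)) by rewrite ler_expR lerN2.
apply: (@le_trans _ _ (expR (68 * n%:R) * (expR (- (70 * n%:R)) + expR (- (70 * n%:R))))).
  by apply: ler_pM => //; rewrite ?exprn_ge0 ?addr_ge0 ?expR_ge0// lerD.
have -> : expR (68 * n%:R) * (expR (- (70 * n%:R)) + expR (- (70 * n%:R))) =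
    2 * (expR (2 * n%:R))^-1 :> R.
  rewrite -expRN (_ : - (2 * n%:R) = 68 * n%:R + - (70 * n%:R)); last by ring.
  by rewrite expRD; ring.
have h := exprn_le_expR 2 (mulr_ge0 (ler0n R 2) (ltW nR)).
have -> : tiny = 2 * (2 * n%:R ^+ 2)^-1 :> R by field; rewrite gt_eqF.
rewrite ler_pM2l// lef_pV2 ?posrE ?expR_gt0 ?mulr_gt0 ?exprn_gt0//.
rewrite exprMn (_ : 2`! = 2)%N// in h; lra.
Qed.

Let large_div (c : R) : 0 < c -> 70 * n%:R * c <= m%:R -> 70 * n%:R <= m%:R / c.
Proof. by move=> c0; rewrite ler_pdivlMr. Qed.

Let c32 : 0 < 32 * thousand. Proof. lra. Qed.

Let delta : R := 1 / 16 / thousand.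

Let whp_trunc (B : R) : L <= B -> 70 * (32 * thousand) * Q * n%:R * B <= m%:R ->
  whp P tiny (fun w => forall h,
    `|mean (fun r => trunc_cross B x h (a r w)) - cross_mean x h| <= 1 / 1000 * sqnorm h).
Proof.
move=> LB mB; have B0 : 0 < B by exact: lt_le_trans LB.
have B1 : 1 <= B by exact: le_trans LB.
have QB0 : 0 < Q * B by exact: mulr_gt0.
pose lam := (Q * B)^-1.
have lam0 : 0 < lam by rewrite invr_gt0.
have delta0 : 0 < delta by rewrite /delta; lra.
have lam4 : 2 * mom R 4 * lam <= delta.
  rewrite ler_pdivrMr// /delta; have := M4; have : M <= M * B by rewrite ler_peMr// ltW.
  by rewrite /Q; lra.
have lamB : 32 * lam * B <= 1.
  have -> : 32 * lam * B = 32 / Q by rewrite /lam; field; rewrite !gt_eqF.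
  by rewrite ler_pdivrMr// mul1r; have := Q64; lra.
have B3 : mom R 3 / B <= delta.
  by rewrite ler_pdivrMr// /delta; have := M3; move: LB; rewrite /L; lra.
have := whp_trunc_cross_unif mX iX gX n0 m0 lam0 lam4 x1 B1 lamB B3.
apply: whpW; last by move=> w H h; have := H h; rewrite /delta; lra.
apply: union_small.
have -> : m%:R * (lam * delta / 2) = m%:R / ((32 * thousand) * (Q * B)).
  by rewrite /lam /delta; field; rewrite !gt_eqF.
apply: large_div; first exact: mulr_gt0.
by rewrite (_ : _ * _ * _ = 70 * (32 * thousand) * Q * n%:R * B)//; ring.
Qed.

Let whp_bounded : whp P tiny (fun w => forall r, inten (a r w) x < 32 * lnm).
Proof.
have x2 : sqnorm x <= 2 by rewrite x1; lra.
have := whp_max_inten mX iX gX x2 lnm; apply: whpW => //.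
have -> : expR (- (4 * lnm)) = (m%:R ^+ 4)^-1 :> R.
  by rewrite expRN expRM_natl /lnm lnK// posrE.
have -> : m%:R * (2 * (m%:R ^+ 4)^-1) = 2 / m%:R * (m%:R ^+ 2)^-1 :> R.
  by field; rewrite gt_eqF.
have mn : n%:R <= m%:R :> R by rewrite ler_nat.
have l1 : 2 / m%:R <= 1 :> R.
  by rewrite ler_pdivrMr// mul1r; have := n_large; move: mn; lra.
have l2 : (m%:R ^+ 2)^-1 <= tiny.
  by rewrite lef_pV2 ?posrE ?exprn_gt0// ler_pXn2r ?nnegrE.
by apply: le_trans l2; rewrite ler_piMl// invr_ge0 exprn_ge0.
Qed.

(** Truncation at [L + 32 ln m] changes nothing on the event of [whp_bounded]. *)
Lemma whp_isometric : whp P (tiny + tiny) (fun w => isometric (fun r => a r w) x (1 / 1000)).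
Proof.
have LB : L <= L + 32 * lnm by rewrite lerDl mulr_ge0.
apply: whpW (whp_and (whp_trunc LB m_large) whp_bounded) => // w [H bd] h.
have := H h; congr (_ <= _); congr (`| _ - _|); congr (_ * _).
apply: eq_bigr => r _; rewrite /trunc_cross ifT//.
have := bd r; have := L0; lra.
Qed.

Let m_large_L (c : R) : 0 <= c -> c <= 70 * (32 * thousand) * Q * L -> c * n%:R <= m%:R.
Proof.
move=> c0 cL; apply: le_trans m_large.
apply: (@le_trans _ _ (70 * (32 * thousand) * Q * L * n%:R)); first by rewrite ler_wpM2r// ltW.
rewrite [leLHS]mulrAC; apply: ler_wpM2l.
  by have := ltW (mulr_gt0 Q0 nR); lra.
by rewrite lerDl mulr_ge0.
Qed.

Lemma whp_scale : whp P tiny (fun w => `|mean (fun r => inten (a r w) x) - 1| <= 1 / 1000).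
Proof.
have x2 : sqnorm x <= 2 by rewrite x1; lra.
pose lam := Q^-1.
have lam0 : 0 < lam by rewrite invr_gt0.
have d0 : 0 < 1 / 1000 :> R by lra.
have lam2 : 2 * mom R 2 * lam <= 1 / 1000.
  by rewrite ler_pdivrMr//; have := M2; have := M1; rewrite /Q; lra.
have lam32 : 32 * lam <= 1 by rewrite ler_pdivrMr// mul1r; have := Q64; lra.
have := whp_mean_inten mX iX gX m0 x2 lam0 lam2 lam32.
apply: whpW => [|w]; last by rewrite x1.
set e := expR _.
have e0 : 0 <= e by exact: expR_ge0.
apply: (@le_trans _ _ (2 ^+ (68 * n) * (e + e))).
  by rewrite ler_peMl ?addr_ge0// exprn_ege1//; lra.
apply: union_small.
have -> : m%:R * (lam * (1 / 1000) / 2) = m%:R / (2 * thousand * Q).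
  by rewrite /lam; field; rewrite !gt_eqF.
have c2 : 0 < 2 * thousand by lra.
apply: large_div; first exact: mulr_gt0 c2 Q0.
rewrite mulrAC; apply: m_large_L.
  by have := Q0; lra.
have : Q <= Q * L by rewrite ler_peMr// ltW.
by have := Q0; lra.
Qed.

Lemma whp_tame : whp P (5 * tiny) (fun w => tame (fun r => a r w) x).
Proof.
pose k := 100 * L.
have k1 : 1 <= k by have := L1; rewrite /k; lra.
have k0 : 0 < k by exact: lt_le_trans k1.
have QL0 : 0 < Q * L by exact: mulr_gt0.
have HL : 70 * (32 * thousand) * Q * n%:R * L <= m%:R.
  by rewrite mulrAC; apply: m_large_L (lexx _); lra.
have whpL := whp_trunc (lexx L) HL.
have whpH : whp P tiny (fun w => forall h, sqnorm h <= 1 ->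
    mean (fun r => huber k (inten (a r w) h)) <= 6).
  pose lam := (Q * k)^-1.
  have Qk0 : 0 < Q * k by exact: mulr_gt0.
  have lam0 : 0 < lam by rewrite invr_gt0.
  have lam4 : 2 * mom R 4 * lam <= 1.
    rewrite ler_pdivrMr// mul1r; have : Q <= Q * k by rewrite ler_peMr// ltW.
    by have := M4; have := M1; rewrite /Q; lra.
  have lamk : 64 * lam * k <= 1.
    have -> : 64 * lam * k = 64 / Q by rewrite /lam; field; rewrite !gt_eqF.
    by rewrite ler_pdivrMr// mul1r.
  have := whp_huber_unif mX iX gX n0 m0 lam0 lam4 (ltW k0) lamk.
  apply: whpW => [|w H h h1]; last by have := H h h1; lra.
  set e := expR _; have e0 : 0 <= e by exact: expR_ge0.
  apply: (@le_trans _ _ (2 ^+ (68 * n) * (e + e))).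
    by rewrite ler_wpM2l ?exprn_ge0// lerDl.
  apply: union_small.
  have -> : m%:R * (lam * 1 / 2) = m%:R / (2 * (Q * k)).
    by rewrite /lam; field; rewrite !gt_eqF.
  apply: large_div; first exact: mulr_gt0 (ltr0n R 2) Qk0.
  rewrite mulrAC; apply: m_large_L; rewrite /k; have := QL0; lra.
have whpN : whp P tiny (fun w =>
    mean (fun r => 32 * expR (sqnorm (a r w) / 2 - 2 * n%:R)) < 1).
  have := whp_exp_sqnorm mX iX gX m0; apply: whpW => //.
  have q34 : 0 <= 3 / 4 :> R by lra.
  have e2 : 2 <= expR (3 / 4) :> R.
    have s01 : 0 <= (1 : R) <= 1 by rewrite ler01 lexx.
    by have /andP[+ _] := expR_taylor2 s01 q34; rewrite !mul1r; lra.
  have e4 : 4 ^+ n <= expR (3 / 2 * n%:R) :> R.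
    rewrite mulrC expRM_natl lerXn2r ?nnegrE ?expR_ge0//.
    have -> : (3 / 2 = 3 / 4 + 3 / 4 :> R) by field.
    by rewrite expRD; have := e2; nra.
  apply: (@le_trans _ _ (32 * expR (3 / 2 * n%:R) * expR (- (2 * n%:R)))).
    by rewrite ler_wpM2r ?expR_ge0// ler_wpM2l.
  rewrite -mulrA -expRD (_ : 3 / 2 * n%:R + - (2 * n%:R) = - (n%:R / 2)); last by field.
  rewrite expRN ler_pdivrMr ?expR_gt0// mulrC -ler_pdivrMr ?invr_gt0 ?exprn_gt0// invrK.
  (* [e^(n/2) >= (n/2)^3 / 6 = n^3 / 48 >= 32 n^2], whence the threshold [32 * 48 <= n]. *)
  have h := exprn_le_expR 3 (divr_ge0 (ltW nR) (ler0n R 2)).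
  have : 32 * n%:R ^+ 2 <= n%:R / 48 * n%:R ^+ 2 :> R.
    by rewrite ler_wpM2r ?exprn_ge0 ?(ltW nR)//; have := n_large; lra.
  rewrite expr_div_n (_ : 3`! = 6)%N// in h.
  have -> : n%:R / 48 * n%:R ^+ 2 = n%:R ^+ 3 / 2 ^+ 3 / 6 :> R by field.
  by move=> h'; apply: le_trans h' _; move: h; lra.
have := whp_and (whp_and whp_isometric whpL) (whp_and whpH whpN).
apply: whpW => [|w [[iso isoL] [hub norms]]]; first by lra.
exists L, k; split; first by split.
by split.
Qed.

End assembly.

(** * Universal constants and sample size *)

Section constants.

(** One bound serves every [R], since the constants of the theorem are fixed before the real
    field. *)
Lemma mom_bounded (k : nat) : exists M : nat, forall R : realType, mom R k <= M%:R.
Proof.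
by exists (32 ^ k * k`! * 2)%N => R; rewrite /mom !natrM natrX.
Qed.

(** This trades [ln m] for [ln n]. If [m <= n^3] then [ln m <= 3 ln n], which explains
    [192 = 2 * 32 * 3]. Otherwise [ln m <= 3 n + m / n^3], and [256 D <= n] makes the term
    negligible before [m]. *)
Lemma sample_size (R : realType) (n m : nat) (D L : R) :
  0 <= D -> 0 <= L -> (0 < n)%N -> 4 <= n%:R :> R -> 256 * D <= n%:R ->
  (2 * D * L + 192 * D + 1) * n%:R * ln (n%:R : R) <= m%:R ->
  (n <= m)%N /\ D * n%:R * (L + 32 * ln (m%:R : R)) <= m%:R.
Proof.
move=> D0 L0 n0 n4 nD mn.
have nR : 0 < n%:R :> R by rewrite ltr0n.
have e4 : expR 1 <= 4 :> R.
  have h := expR_ge1Dx (- (1 / 2) : R); rewrite expRN in h.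
  have e0 := expR_gt0 (1 / 2 : R).
  have h2 : expR (1 / 2) <= 2 :> R.
    have h3 : 1 / 2 * expR (1 / 2) <= 1 :> R.
      by rewrite -[leRHS](mulVf (lt0r_neq0 e0)) ler_wpM2r ?(ltW e0)//; lra.
    lra.
  rewrite [X in expR X](_ : 1 = 1 / 2 + 1 / 2); last by field.
  rewrite expRD; nra.
have ln1 : 1 <= ln n%:R :> R.
  by rewrite -ler_expR lnK ?posrE// (le_trans e4).
have nln : n%:R <= n%:R * ln n%:R :> R by rewrite ler_peMr// ltW.
have nln0 : 0 <= n%:R * ln n%:R :> R by lra.
have DL0 : 0 <= D * L by rewrite mulr_ge0.
have nm : n%:R <= m%:R :> R.
  apply: (le_trans nln); apply: le_trans mn; rewrite -mulrA ler_peMl//; lra.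
have mR : 0 < m%:R :> R by lra.
split; first by rewrite -(ler_nat R).
have t1 : D * L * n%:R <= m%:R / 2.
  have : 2 * (D * L) * n%:R <= 2 * (D * L) * (n%:R * ln n%:R) by rewrite ler_wpM2l//; lra.
  have : 0 <= (192 * D + 1) * (n%:R * ln n%:R) by rewrite mulr_ge0//; lra.
  move: mn; rewrite -mulrA; lra.
have t2 : 32 * D * (n%:R * ln m%:R) <= m%:R / 2.
  have [m3|m3] := leP (m%:R : R) (n%:R ^+ 3).
    have lm : ln m%:R <= 3 * ln n%:R :> R.
      by rewrite mulr_natl -lnXn// ler_ln ?posrE ?exprn_gt0.
    have : 32 * D * (n%:R * ln m%:R) <= 32 * D * (n%:R * (3 * ln n%:R)).
      by rewrite ler_wpM2l ?mulr_ge0// ler_wpM2l// ltW.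
    have : 0 <= (2 * (D * L) + 1) * (n%:R * ln n%:R) by rewrite mulr_ge0//; lra.
    move: mn; rewrite -mulrA; lra.
  have n3 : 0 < n%:R ^+ 3 :> R by rewrite exprn_gt0.
  (* [ln m = 3 ln n + ln (m / n^3) <= 3 n + m / n^3] *)
  have lm : ln m%:R <= 3 * n%:R + m%:R / n%:R ^+ 3 :> R.
    have -> : ln m%:R = 3 * ln n%:R + ln (m%:R / n%:R ^+ 3) :> R.
      by rewrite mulr_natl -lnXn// -lnM ?posrE ?divr_gt0// mulrC divfK// gt_eqF.
    have l1 := ln_sublinear nR.
    have l2 : ln (m%:R / n%:R ^+ 3) < m%:R / n%:R ^+ 3 :> R by rewrite ln_sublinear// divr_gt0.
    lra.
  have lm' : 32 * D * (n%:R * ln m%:R) <= 32 * D * (n%:R * (3 * n%:R + m%:R / n%:R ^+ 3)).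
    by rewrite ler_wpM2l ?mulr_ge0// ler_wpM2l// ltW.
  have s1 : 256 * D * (3 / 8 * n%:R ^+ 2) <= n%:R * (3 / 8 * n%:R ^+ 2).
    by rewrite ler_wpM2r// mulr_ge0 ?exprn_ge0//; lra.
  have s2 : 256 * D * (m%:R / (8 * n%:R ^+ 2)) <= n%:R * (m%:R / (8 * n%:R ^+ 2)).
    by rewrite ler_wpM2r// divr_ge0// mulr_ge0.
  have s3 : n%:R * (m%:R / (8 * n%:R ^+ 2)) <= m%:R / 32 :> R.
    have -> : n%:R * (m%:R / (8 * n%:R ^+ 2)) = m%:R / (8 * n%:R) :> R.
      by field; rewrite gt_eqF.
    by rewrite ler_wpM2l ?(ltW mR)// lef_pV2 ?posrE//; lra.
  apply: (le_trans lm').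
  have -> : 32 * D * (n%:R * (3 * n%:R + m%:R / n%:R ^+ 3)) =
      256 * D * (3 / 8 * n%:R ^+ 2) + 256 * D * (m%:R / (8 * n%:R ^+ 2)).
    by field; rewrite gt_eqF.
  have s4 : n%:R * (3 / 8 * n%:R ^+ 2) = 3 / 8 * n%:R ^+ 3 :> R by ring.
  lra.
have -> : D * n%:R * (L + 32 * ln m%:R) =
    D * L * n%:R + 32 * D * (n%:R * ln m%:R) by ring.
lra.
Qed.

Lemma small_dimension (R : realType) (n : nat) (g : R) : 0 < g -> n%:R <= (2 * g)^-1 ->
  1 <= 10 * expR (- (g * n%:R)).
Proof.
move=> g0 ng; have h : g * n%:R <= 1 / 2.
  have -> : 1 / 2 = g * (2 * g)^-1 by field; rewrite gt_eqF.
  by rewrite ler_pM2l.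
by have := expR_ge1Dx (- (g * n%:R)); lra.
Qed.

End constants.

(** * From failure bounds to events *)

Section events.
Context (R : realType) (d : measure_display) (T : measurableType d) (P : probability T R).

Lemma whp_ge1 (e : R) (Q : T -> Prop) : 1 <= e -> whp P e Q.
Proof.
move=> e1; exists set0; split => //.
by rewrite setC0 probability_setT lee_fin.
Qed.

Lemma whp_event (e : R) (Q : T -> Prop) : whp P e Q ->
  exists E : set T, [/\ measurable E, ((1 - e)%:E <= P E)%E & forall w, E w -> Q w].
Proof.
move=> [E [mE PE EQ]]; exists E; split => //.
rewrite -[E]setCK probability_setC; last exact: measurableC.
by rewrite EFinB leeB.
Qed.

End events.

(** * The zero signal *)

Section zero_signal.
Context (R : realType) (n m : nat) (a : 'I_m -> 'cV[R[i]]_n) (x : 'cV[R[i]]_n).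
Hypothesis x0 : vnorm x = 0.

Lemma vnorm_eq0 (z : 'cV[R[i]]_n) : vnorm z = 0 -> z = 0.
Proof.
move=> z0; have : sqnorm (enc z) = 0 by rewrite -vnorm_sq z0 expr0n.
move=> /eqP; rewrite psumr_eq0 => [|k _]; last exact: sqr_ge0.
move=> /allP h; apply/matrixP => i j; rewrite ord1 mxE.
have := h (i, true) (mem_index_enum _); have := h (i, false) (mem_index_enum _).
rewrite /enc/= !sqrf_eq0; case: (z i 0) => u v /= /eqP -> /eqP ->.
by [].
Qed.

Lemma dist_zero_signal (z : 'cV[R[i]]_n) : dist z x = vnorm z.
Proof.
have [phi [_ ->]] := dist_attained z x.
by rewrite (vnorm_eq0 x0) scaler0 subr0.
Qed.

Lemma init_zero_signal z0 : is_WF_init a x z0 -> vnorm z0 = 0.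
Proof.
move=> [v [lam [_ _ _ ->]]].
rewrite big1 ?mulr0 ?sqrtr0 => [|r _].
  by rewrite scale0r /vnorm big1 ?sqrtr0// => i _; rewrite mxE /cabs2/= expr0n addr0.
have e0 k : enc (0 : 'cV[R[i]]_n) k = 0 by case: k => i []; rewrite /enc/= mxE.
rewrite ymeasE (vnorm_eq0 x0) /inten /dot.
rewrite big1 => [|k _]; last by rewrite e0 mul0r.
rewrite big1 ?expr0n ?addr0// => k _.
by case: k => i []; rewrite /rot /enc/= mxE ?oppr0 mul0r.
Qed.

(** Division by zero has value 0, so the step size vanishes and the flow is stationary. *)
Lemma iter_zero_signal z0 mu tau : vnorm z0 = 0 -> wf_iter a x z0 mu tau = z0.
Proof.
move=> h; rewrite /wf_iter h expr0n invr0 mulr0.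
by elim: tau => //= t ->; rewrite scale0r subr0.
Qed.

End zero_signal.

(** The coefficient [70 * (32 * thousand) * Q] of [m_large] in the assembly. *)
Definition oversampling (F : numFieldType) (M : F) : F := 70 * (32 * 1000) * (32 * 1000 * M).

(* Below this dimension the failure probability [10 exp (- gamma n)] exceeds 1. *)
Definition dimension_threshold (F : numFieldType) (M : F) : F :=
  256 * oversampling M + 32 * 48.

Definition decay_rate (F : numFieldType) (M : F) : F := (2 * dimension_threshold M)^-1.

Definition max_step (F : numFieldType) : F := (100 * 1000)^-1.

(** The coefficient that [sample_size] requires when its [L] is the truncation level
    [16 * 1000 * M]. *)
Definition sampling_ratio (F : numFieldType) (M : F) : F :=
  2 * oversampling M * (16 * 1000 * M) + 192 * oversampling M + 1.

(** * Both claims under the Gaussian model *)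

Section gaussian_flow.
Context (R : realType) (d : measure_display) (T : measurableType d) (P : probability T R).
Context (n m : nat) (X : 'I_m -> 'I_n -> bool -> {RV P >-> R}) (x : 'cV[R[i]]_n).
Hypothesis model : gaussian_model X.
Hypotheses (n0 : (0 < n)%N) (m0 : (0 < m)%N).
Variable M : R.
Hypotheses (M1 : 1 <= M) (M2 : mom R 2 <= M) (M3 : mom R 3 <= M) (M4 : mom R 4 <= M).
Hypothesis m_large : sampling_ratio M * n%:R * ln (n%:R : R) <= m%:R.

Let Xf (i : 'I_m * 'I_n * bool) : T -> R := X i.1.1 i.1.2 i.2.

Let mXf i : measurable_fun setT (Xf i).
Proof. exact: measurable_funP. Qed.

Let iXf : mutually_independent P Xf. Proof. exact: model.1. Qed.

Let gXf i (B : set R) : measurable B -> P (Xf i @^-1` B) = normal_prob 0 (Num.sqrt (2^-1)) B.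
Proof. exact: model.2. Qed.

Lemma enc_avec w r : enc (avec X w r) = sample Xf r w.
Proof.
apply/funext => -[j b].
by rewrite /enc /avec /sample /Xf mxE; case: b.
Qed.

Local Notation failure :=
  (10 * expR (- (decay_rate M * n%:R)) + 8 / n%:R ^+ 2).

Let D0 : 0 <= oversampling M.
Proof. by rewrite /oversampling; have := M1; lra. Qed.

Let failure_split (Q : T -> Prop) :
  ((n <= m)%N -> 32 * 48 <= n%:R :> R ->
   oversampling M * n%:R * (16 * 1000 * M + 32 * ln m%:R) <= m%:R ->
   whp P (8 / n%:R ^+ 2) Q) ->
  whp P failure Q.
Proof.
have N0 : 0 < dimension_threshold M by rewrite /dimension_threshold; have := D0; lra.
have t0 : 0 <= 8 / n%:R ^+ 2 :> R by rewrite divr_ge0// exprn_ge0.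
move=> h; have [nN|Nn] := leP n%:R (dimension_threshold M).
  apply: whp_ge1; rewrite -[leLHS]addr0 lerD// /decay_rate small_dimension ?invr_gt0 ?mulr_gt0//.
  by rewrite invfM invrK mulrA mulVf ?mul1r// pnatr_eq0.
move: Nn; rewrite /dimension_threshold => Nn.
have L0 : 0 <= 16 * 1000 * M by have := M1; lra.
have n4 : 4 <= n%:R :> R by have := D0; lra.
have nD : 256 * oversampling M <= n%:R by lra.
have [nm mD] := sample_size D0 L0 n0 n4 nD m_large.
apply: whpW (h nm _ mD) => //; last by have := D0; lra.
by rewrite lerDr mulr_ge0// expR_ge0.
Qed.

Lemma whp_init : whp P failure (fun w => forall z0,
  is_WF_init (avec X w) x z0 -> dist z0 x <= vnorm x / 8).
Proof.
apply: failure_split => nm n_large mD.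
have t0 : 0 <= (n%:R ^+ 2)^-1 :> R by rewrite invr_ge0 exprn_ge0.
have [x0|x0] := eqVneq (vnorm x) 0.
  apply: (whpW _ _ (@whp_true _ _ _ P (fun=> True) _)) => // w _ z0 init.
  by rewrite dist_zero_signal// (init_zero_signal x0 init) x0 mul0r.
have {}x0 : 0 < vnorm x by rewrite lt0r x0 vnorm_ge0.
have u1 := sqnorm_unitx x0.
have iso := whp_isometric mXf iXf gXf n0 m0 u1 M1 M3 M4 mD nm n_large.
have scale := whp_scale mXf iXf gXf n0 m0 u1 M1 M2 mD.
apply: whpW (whp_and iso scale) => [|w]; first by lra.
move=> [iso_w scale_w] z0; apply: (init_dist x0); first by rewrite (funext (enc_avec w)).
by under eq_bigr do rewrite enc_avec.
Qed.

Lemma whp_flow mu : 0 < mu -> mu <= max_step R / n%:R ->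
  whp P failure (fun w => forall z0, dist z0 x <= vnorm x / 8 -> forall tau : nat,
    dist (wf_iter (avec X w) x z0 mu tau) x
      <= 8^-1 * (1 - mu / 4) `^ (tau%:R / 2) * vnorm x).
Proof.
rewrite ler_pdivlMr ?ltr0n// => mu0 mun; apply: failure_split => nm n_large mD.
have {}mun : 100 * (1000 * (mu * n%:R)) <= 1.
  by move: mun; rewrite /max_step; lra.
have t0 : 0 <= (n%:R ^+ 2)^-1 :> R by rewrite invr_ge0 exprn_ge0.
have [x0|x0] := eqVneq (vnorm x) 0.
  apply: (whpW _ _ (@whp_true _ _ _ P (fun=> True) _)) => // w _ z0.
  rewrite dist_zero_signal// x0 mul0r => z0_le tau.
  have z0_eq0 : vnorm z0 = 0 by apply/eqP; rewrite eq_le z0_le vnorm_ge0.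
  by rewrite iter_zero_signal// dist_zero_signal// z0_eq0 mulr0.
have {}x0 : 0 < vnorm x by rewrite lt0r x0 vnorm_ge0.
have := whp_tame mXf iXf gXf n0 m0 (sqnorm_unitx x0) M1 M3 M4 mD nm n_large.
apply: whpW => [|w]; first by lra.
by rewrite -(funext (enc_avec w)) => tame_w z0 z0x tau; exact: flow_contraction.
Qed.

End gaussian_flow.

(** * Positivity and transport of the constants *)

Section constant_values.
Variable M : nat.

Lemma oversampling_ge0 (F : realFieldType) : 0 <= oversampling M%:R :> F.
Proof. by rewrite /oversampling; have := ler0n F M; lra. Qed.

Lemma dimension_threshold_gt0 (F : realFieldType) : 0 < dimension_threshold M%:R :> F.
Proof. by rewrite /dimension_threshold; have := oversampling_ge0 F; lra. Qed.

Lemma decay_rate_gt0 (F : realFieldType) : 0 < decay_rate M%:R :> F.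
Proof. by rewrite invr_gt0; have := dimension_threshold_gt0 F; lra. Qed.

Lemma sampling_ratio_gt0 (F : realFieldType) : 0 < sampling_ratio M%:R :> F.
Proof.
rewrite /sampling_ratio; have D0 := oversampling_ge0 F.
by have := mulr_ge0 D0 (ler0n F M); lra.
Qed.

Lemma max_step_gt0 (F : realFieldType) : 0 < max_step F.
Proof. by rewrite invr_gt0; lra. Qed.

Variables (F G : numFieldType) (f : {rmorphism F -> G}).

Lemma rmorph_oversampling : f (oversampling M%:R) = oversampling M%:R.
Proof. by rewrite /oversampling !rmorphM !rmorph_nat. Qed.

Lemma rmorph_dimension_threshold :
  f (dimension_threshold M%:R) = dimension_threshold M%:R.
Proof.
rewrite /dimension_threshold rmorphD [f (256 * _)]rmorphM rmorph_oversampling.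
by rewrite rmorphM !rmorph_nat.
Qed.

Lemma rmorph_decay_rate : f (decay_rate M%:R) = decay_rate M%:R.
Proof.
by rewrite /decay_rate fmorphV rmorphM rmorph_dimension_threshold rmorph_nat.
Qed.

Lemma rmorph_sampling_ratio : f (sampling_ratio M%:R) = sampling_ratio M%:R.
Proof.
rewrite /sampling_ratio !rmorphD rmorph1 [f (192 * _)]rmorphM [f (2 * _ * _)]rmorphM.
by rewrite [f (2 * _)]rmorphM rmorph_oversampling !rmorphM !rmorph_nat.
Qed.

Lemma rmorph_max_step : f (max_step F) = max_step G.
Proof. by rewrite /max_step fmorphV rmorphM !rmorph_nat. Qed.

End constant_values.

Theorem theorem3p3 :
  exists c0 gamma c1 : rat, [/\ 0 < c0, 0 < gamma & 0 < c1] /\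
  forall (R : realType) (n m : nat) (x : 'cV[R[i]]_n)
         (d : measure_display) (T : measurableType d)
         (P : probability T R)
         (X : 'I_m -> 'I_n -> bool -> {RV P >-> R}),
    gaussian_model X ->
    (0 < n)%N -> (0 < m)%N -> ratr c0 * n%:R * ln (n%:R : R) <= m%:R ->
    (exists E : set T, [/\ measurable E,
        ((1 - 10 * expR (- (ratr gamma * n%:R)) - 8 / n%:R ^+ 2)%:E <= P E)%E &
        forall omega, E omega -> forall z0, is_WF_init (avec X omega) x z0 ->
          dist z0 x <= vnorm x / 8])
    /\
    (forall mu : R, 0 < mu -> mu <= ratr c1 / n%:R ->
      exists E : set T, [/\ measurable E,
        ((1 - 13 * expR (- (ratr gamma * n%:R)) - m%:R * expR (- (3 / 2 * m%:R))
            - 8 / n%:R ^+ 2)%:E <= P E)%E &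
        forall omega, E omega -> forall z0, dist z0 x <= vnorm x / 8 ->
          forall tau : nat,
            dist (wf_iter (avec X omega) x z0 mu tau) x
              <= 8^-1 * (1 - mu / 4) `^ (tau%:R / 2) * vnorm x]).
Proof.
have [N2 bound2] := mom_bounded 2; have [N3 bound3] := mom_bounded 3.
have [N4 bound4] := mom_bounded 4.
pose M := (N2 + N3 + N4 + 1)%N.
have M1 (F : numFieldType) : 1 <= M%:R :> F by rewrite ler1n /M addn1.
exists (sampling_ratio M%:R), (decay_rate M%:R), (max_step rat); split.
  by split; [exact: sampling_ratio_gt0|exact: decay_rate_gt0|exact: max_step_gt0].
move=> R n m x d T P X model n0 m0.
rewrite (rmorph_sampling_ratio M (@ratr R)) (rmorph_decay_rate M (@ratr R)) => m_large.
have M2 : mom R 2 <= M%:R by apply: le_trans (bound2 R) _; rewrite ler_nat /M -!addnA leq_addr.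
have M3 : mom R 3 <= M%:R.
  by apply: le_trans (bound3 R) _; rewrite ler_nat /M -addnA addnAC leq_addl.
have M4 : mom R 4 <= M%:R.
  by apply: le_trans (bound4 R) _; rewrite ler_nat /M addnAC leq_addl.
split=> [|mu mu0].
  have [E [mE PE EQ]] := whp_event (whp_init x model n0 m0 (M1 R) M2 M3 M4 m_large).
  by exists E; split => //; apply: le_trans PE; rewrite lee_fin opprD addrA.
rewrite rmorph_max_step => mun.
have [E [mE PE EQ]] := whp_event (whp_flow x model n0 m0 (M1 R) M3 M4 m_large mu0 mun).
exists E; split => //; apply: le_trans PE; rewrite lee_fin opprD addrA lerD2r.
(* [whp_flow] fails with probability at most [10 e + 8 / n^2], which lies below the bound allowed
   here. *)
set e := expR (- (_ * n%:R)); have e0 : 0 <= e by exact: expR_ge0.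
have f0 : 0 <= m%:R * expR (- (3 / 2 * m%:R)) :> R by rewrite mulr_ge0// expR_ge0.
lra.
Qed.
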